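(* Let $a,b$ be positive reals with $a+b<\tfrac12$, let $\ell=\ell(n)$ be a non-negative integer with $\ell n$ even, and let $\lambda=\ell/(n-1)$ satisfy $\lambda\ge 1/(3a\log n)$ and, in addition, $\lambda=n^{O(1)}$. Let $\varepsilon>0$ be a sufficiently small fixed constant. Define \[ F(\boldsymbol\theta)=\frac{\prod_{1\le j<k\le n}\bigl(1-\lambda(e^{i(\theta_j+\theta_k)}-1)\bigr)^{-1}}{e^{i\ell\sum_{j=1}^n\theta_j}},\qquad \boldsymbol\theta\in[-\pi,\pi]^n, \] the boxes \[ \mathcal R_0=\{\boldsymbol\theta:|\theta_j|\le n^{-1/2+\varepsilon}(1+\lambda)^{-1}\ \forall j\},\qquad \mathcal R_\pi=\{\boldsymbol\theta:|\theta_j+\pi|\le n^{-1/2+\varepsilon}(1+\lambda)^{-1}\ \forall j\} \] (with $\theta_j+\pi$ taken modulo $2\pi$), and $\mathcal R^c=[-\pi,\pi]^n\setminus(\mathcal R_0\cup\mathcal R_\pi)$. Let $c=1-\sqrt{(n-2)/(2(n-1))}$ and let $T$ be the linear map $\boldsymbol z\mapsto\boldsymbol\theta$ given by $(1+\lambda)\theta_j=z_j-\frac{c}{n}\sum_{k=1}^n z_k$ for $1\le j\le n$. Let $\mathcal R'=T(\mathcal R_{\boldsymbol z})$ where $\mathcal R_{\boldsymbol z}=\{\boldsymbol z\in\mathbb R^n:|z_j|\le 2n^{-1/2+\varepsilon}\ \forall j\}$, and $I_{\mathcal R'}(n)=\int_{\mathcal R'}F(\boldsymbol\theta)\,d\boldsymbol\theta$.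 Then, as $n\to\infty$, \[ \int_{\mathcal R^c}|F(\boldsymbol\theta)|\,d\boldsymbol\theta=O(n^{-1})\,I_{\mathcal R'}(n). \]
   Context: Asymptotic notation refers to $n\to\infty$. *)

(* Defs.v *)
From HB Require Import structures.
From mathcomp Require Import all_boot all_order all_algebra.
From mathcomp Require Import complex.
From mathcomp Require Import all_classical all_reals all_analysis.

Set Implicit Arguments.
Unset Strict Implicit.
Unset Printing Implicit Defensive.

Import Order.TTheory GRing.Theory Num.Theory.
Import numFieldNormedType.Exports.

Local Open Scope classical_set_scope.
Local Open Scope ring_scope.
Local Open Scope complex_scope.

(* n-dimensional Lebesgue measure on n.-tuple R: the Dirac mass at the empty
   tuple for n = 0, and for n.+1 the image under (x, t) |-> x :: t of the
   product of the one-dimensional measure with the n-dimensional one. *)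
Section lebesgue_tuple.
Context (R : realType).

Definition tcons n (p : measurableTypeR R * n.-tuple (measurableTypeR R)) :
    n.+1.-tuple (measurableTypeR R) :=
  [tuple of p.1 :: p.2].

Lemma measurable_tcons n : measurable_fun setT (@tcons n).
Proof. exact: measurable_cons. Qed.

Section step.
Context (n : nat).
Context (mu : {sigma_finite_measure set (n.-tuple (measurableTypeR R)) -> \bar R}).

Definition lebesgue_cons : set (n.+1.-tuple (measurableTypeR R)) -> \bar R :=
  pushforward (product_measure1 (@lebesgue_measure R) mu) (@tcons n).

Let lebesgue_cons0 : lebesgue_cons set0 = 0%E.
Proof. by rewrite /lebesgue_cons /pushforward preimage_set0 measure0. Qed.

Let lebesgue_cons_ge0 A : (0 <= lebesgue_cons A)%E.
Proof. by rewrite /lebesgue_cons /pushforward; exact: measure_ge0. Qed.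

Let lebesgue_cons_sigma_additive : semi_sigma_additive lebesgue_cons.
Proof.
have mt := @measurable_tcons n.
move=> F mF tF mUF; rewrite /lebesgue_cons /pushforward preimage_bigcup.
apply: measure_semi_sigma_additive.
- by move=> k; rewrite -[X in measurable X]setTI; exact: mt.
- apply/trivIsetP => /= i j _ _ ij; rewrite -preimage_setI.
  by move/trivIsetP : tF => /(_ _ _ _ _ ij) ->//; rewrite preimage_set0.
- by rewrite -preimage_bigcup -[X in measurable X]setTI; exact: mt.
Qed.

HB.instance Definition _ := isMeasure.Build _ _ _ lebesgue_cons
  lebesgue_cons0 lebesgue_cons_ge0 lebesgue_cons_sigma_additive.

Definition tbox (A : set (measurableTypeR R))
    (B : set (n.-tuple (measurableTypeR R))) : set (n.+1.-tuple (measurableTypeR R)) :=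
  [set t | A (thead t) /\ B [tuple of behead t]].

Lemma tcons_tbox A B : @tcons n @^-1` (tbox A B) = A `*` B.
Proof.
have tK (x : measurableTypeR R) (t : n.-tuple (measurableTypeR R)) :
    [tuple of behead (tcons (x, t))] = t by exact/val_inj.
by apply/seteqP; split=> -[x t] /=; rewrite /tbox /= tK.
Qed.

Lemma measurable_tbox A B : measurable A -> measurable B ->
  measurable (tbox A B).
Proof.
move=> mA mB; rewrite /tbox.
have -> : [set t | A (thead t) /\ B [tuple of behead t]] =
   ((@tnth n.+1 (measurableTypeR R) ^~ ord0) @^-1` A) `&`
   ((fun t : n.+1.-tuple (measurableTypeR R) => [tuple of behead t]) @^-1` B).
  by [].
apply: measurableI; rewrite -[X in measurable X]setTI.
- exact: measurable_tnth.
- exact: measurable_behead.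
Qed.

Lemma lebesgue_cons_tbox A B : measurable A -> measurable B ->
  lebesgue_cons (tbox A B) = (lebesgue_measure A * mu B)%E.
Proof.
move=> mA mB; rewrite /lebesgue_cons /pushforward tcons_tbox.
exact: product_measure1E.
Qed.

Let lebesgue_cons_sigma_finite : sigma_finite setT lebesgue_cons.
Proof.
have /sigma_finiteP[F [UF ndF Foo]] := sigma_finiteT (@lebesgue_measure R).
have /sigma_finiteP[G [UG ndG Goo]] := sigma_finiteT mu.
exists (fun k => tbox (F k) (G k)).
  apply/esym/seteqP; split=> // t _.
  have : (\bigcup_k F k) (thead t) by rewrite -UF.
  have : (\bigcup_k G k) [tuple of behead t] by rewrite -UG.
  move=> [j _ Gj] [i _ Fi]; exists (maxn i j) => //; split.
  - by apply: (subsetPset _ _ (ndF _ _ (leq_maxl i j))).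
  - by apply: (subsetPset _ _ (ndG _ _ (leq_maxr i j))).
move=> k; have [mF Fk] := Foo k; have [mG Gk] := Goo k.
split; first exact: measurable_tbox.
by rewrite lebesgue_cons_tbox// lte_mul_pinfty// ge0_fin_numE.
Qed.

HB.instance Definition _ := @Measure_isSigmaFinite.Build _ _ _ lebesgue_cons
  lebesgue_cons_sigma_finite.

End step.

Fixpoint lebesgue_tuple n :
    {sigma_finite_measure set (n.-tuple (measurableTypeR R)) -> \bar R} :=
  match n with
  | 0 => @dirac _ _ [tuple] R
  | m.+1 => lebesgue_cons (lebesgue_tuple m)
  end.

End lebesgue_tuple.

Lemma lebesgue_tuple_box (R : realType) n (A : 'I_n -> set (measurableTypeR R)) :
  (forall i, measurable (A i)) ->
  measurable [set t : n.-tuple (measurableTypeR R) | forall i, A i (tnth t i)] /\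
  lebesgue_tuple R n [set t | forall i, A i (tnth t i)] =
    (\prod_(i < n) lebesgue_measure (A i))%E.
Proof.
elim: n A => [|n IH] A mA.
  rewrite (_ : [set t | _] = setT); last by apply/seteqP; split => // t _ [].
  by split=> //; rewrite big_ord0 /= diracT.
have [mB eB] := IH (A \o lift ord0) (fun i => mA _).
have tnth_behead (t : n.+1.-tuple (measurableTypeR R)) j :
    tnth [tuple of behead t] j = tnth t (lift ord0 j).
  by rewrite [in RHS](tuple_eta t) tnthS.
have -> : [set t : n.+1.-tuple (measurableTypeR R) | forall i, A i (tnth t i)] =
    tbox (A ord0) [set t | forall i, (A \o lift ord0) i (tnth t i)].
  apply/seteqP; split=> t /=.
    by move=> h; split=> [|i]; [exact: h|rewrite tnth_behead; exact: h].
  case=> h0 h i; have [j ->|->] := unliftP ord0 i; last exact: h0.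
  by rewrite -tnth_behead; exact: h.
split; first exact: measurable_tbox.
by rewrite big_ord_recl /= lebesgue_cons_tbox// eB.
Qed.

(* Integral of a complex-valued function, taken componentwise. *)
Definition cintegral (R : realType) d (T : measurableType d)
    (mu : {measure set T -> \bar R}) (D : set T) (f : T -> R[i]) : R[i] :=
  \int[mu]_(x in D) complex.Re (f x) +i* \int[mu]_(x in D) complex.Im (f x).

Unset Implicit Arguments.

Section integrand.
Context (R : realType).

Definition cexpi (x : R) : R[i] := cos x +i* sin x.

Local Notation Rn n := (n.-tuple (measurableTypeR R)).

Definition density (n l : nat) : R := l%:R / (n%:R - 1).

Definition integrand (n l : nat) (t : Rn n) : R[i] :=
  (\prod_(j < n) \prod_(k < n | (j < k)%N)
     (1 - (density n l)%:C * (cexpi (tnth t j + tnth t k) - 1))^-1)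
  / cexpi (l%:R * \sum_(j < n) tnth t j).

Definition cube (n : nat) : set (Rn n) :=
  [set t | forall j, - pi <= tnth t j <= pi].

Definition scale (eps : R) (n : nat) : R := n%:R `^ (- 2^-1 + eps).

Definition box0 (eps : R) (n l : nat) : set (Rn n) :=
  [set t | forall j, `|tnth t j| <= scale eps n / (1 + density n l)].

Definition boxpi (eps : R) (n l : nat) : set (Rn n) :=
  [set t | forall j, exists m : int,
     `|tnth t j + pi + m%:~R * (2 * pi)| <= scale eps n / (1 + density n l)].

Definition boxc (eps : R) (n l : nat) : set (Rn n) :=
  cube n `\` (box0 eps n l `|` boxpi eps n l).

Definition boxz (eps : R) (n : nat) : set (Rn n) :=
  [set z | forall j, `|tnth z j| <= 2 * scale eps n].

Definition ccoef (n : nat) : R :=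
  1 - Num.sqrt ((n%:R - 2) / (2 * (n%:R - 1))).

Definition Tmap (n l : nat) (z : Rn n) : Rn n :=
  [tuple (tnth z j - ccoef n / n%:R * \sum_(k < n) tnth z k) /
         (1 + density n l) | j < n].

Definition boxT (eps : R) (n l : nat) : set (Rn n) :=
  Tmap n l @` boxz eps n.

End integrand.

(* Main.v *)
(** Put [lam = l / (n - 1)], [k = lam (1 + lam)], [r = n ^ (-1/2 + eps)],
    [d = r / (1 + lam)], and compare everything with the [n]-th power of
    [Z], the integral of [exp (- k (n - 2) x^2 / 2)] over [[-d, d]].

    The pair [(t_j, t_i)] contributes to [- ln |F|] the quantity
    [ln (1 + 2 k (1 - cos (t_j + t_i))) / 2].

    In the central box, [|F|] is, up to a constant factor at least 1 and small errors in
    L^1, the product of the weights [exp (- k (n - 2) t_j^2 / 2)] times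
    [exp (- k (sum t)^2 / 2)], and its phase is a sum of cubic functions of single
    coordinates. Writing the factor in [sum t] as a Fourier integral over a frequency
    [xi] turns the integral into one over [xi] of [n]-th powers of one-dimensional
    cosine integrals. These are nonnegative, and for [xi] in a short window, where
    the linear term of the phase is compensated, they are close to their
    maximum; this gives a lower bound [n^(-a - o(1)) Z^n], and [a < 1/2] makes it
    beat the errors.

    Outside the two boxes, either [- ln |F|] exceeds [n^(1 + eps)], or few pairs
    contribute much. In the latter case almost all coordinates are close to a common
    pole 0 or pi, because some [t_j] has small contributions with almost
    all others, and two of these have a small contribution with each other. Every
    coordinate far from that pole then costs a factor [exp (- n X1 / 32)], some coordinate
    is even farther, and [|F|] is at most [exp (- n^(1.9 eps) / 32)] times a product of
    one-variable functions whose integrals are [Z (1 + o(n^(1.9 eps - 1)))]. *)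

Require Import Defs.
From mathcomp Require Import all_boot all_order all_algebra.
From mathcomp Require Import complex ring lra.
From mathcomp Require Import all_classical all_reals all_analysis.
From mathcomp Require Import measurable_realfun.

Import Order.TTheory GRing.Theory Num.Theory.
Import numFieldNormedType.Exports.

Local Open Scope classical_set_scope.
Local Open Scope ring_scope.
Local Open Scope complex_scope.

Set Implicit Arguments.
Unset Strict Implicit.
Unset Printing Implicit Defensive.

(** * Integrals over cubes of tuples *)

Section box.
Context (R : realType).
Local Notation Rn n := (n.-tuple (measurableTypeR R)).
Implicit Types (n : nat) (d : R).

(** The obstacle is that the phase is not negligible. Under the Gaussian weights its variance is of
    order [La = 4 + 1/k], the squared skewness of the geometric law of mean [lam], which may grow
    like [ln n]. The central integral may thus be smaller than the integral of its modulus by a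
    power of [n], and pointwise bounds on the cosine of the whole phase are useless. In the
    frequency integral the loss can be read off: compensating the linear part of the phase costs
    [xi^2 / 2], about [La / 8], and the cubic part, through the sixth Gaussian moment 15, costs
    [15 La / 72]. The total is [La / 3], and [1/k <= 3 a ln n] turns it into [n^(-a)] up to a
    constant. The errors are [n^(-1/2)] up to powers of [n^eps]. No integral is evaluated
    asymptotically: both sides are compared with [Z^n], so it is enough that the upper bound outside
    and the lower bound inside carry the same normalisation. The boxes [boxT] and [box0] differ only
    inside [boxc], so this difference is controlled by the very quantity to be bounded. *)

Definition sqbox d n : set (Rn n) := [set t | forall j, - d <= tnth t j <= d].
Arguments sqbox : clear implicits.

Definition tbint d n (f : Rn n -> R) : R :=
  \int[lebesgue_tuple R n]_(t in sqbox d n) f t.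

(** Measurability is global but the bound is asked only on the cube: coordinates then belong to the
    class, it is closed under sums, products and continuous functions, and membership gives
    integrability over the cube. *)
Definition bmeas d n (f : Rn n -> R) :=
  measurable_fun setT f /\ exists M, forall t, sqbox d n t -> `|f t| <= M.

Lemma sqbox_measure d n : measurable (sqbox d n) /\
  (lebesgue_tuple R n (sqbox d n) < +oo)%E.
Proof.
have [mb eb] := @lebesgue_tuple_box R n (fun=> `[- d, d]%classic)
  (fun=> measurable_itv _).
have -> : sqbox d n = [set t | forall i, `[- d, d]%classic (tnth t i)].
  by apply/seteqP; split => t /= h i; have := h i; rewrite in_itv.
split => //; rewrite eb.
suff /andP[] : (0 <= \prod_(i < n) lebesgue_measure (`[(- d)%R, d%R]%classic : set (measurableTypeR R)) < +oo)%E by [].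
elim/big_ind : _ => [|x y /andP[x0 xy] /andP[y0 yy]|i _].
- by rewrite lee01 ltry.
- by rewrite mule_ge0//= lte_mul_pinfty// ge0_fin_numE.
- by rewrite measure_ge0/= lebesgue_measure_itv/=; case: ifP => _; rewrite ?ltry// -EFinB ltry.
Qed.

Lemma measurable_sqbox d n : measurable (sqbox d n).
Proof. by have [] := sqbox_measure d n. Qed.

Lemma bmeas_integrable d n (f : Rn n -> R) : bmeas d f ->
  (lebesgue_tuple R n).-integrable (sqbox d n) (EFin \o f).
Proof.
move=> [mf [M fM]]; have [mb fb] := sqbox_measure d n.
apply: measurable_bounded_integrable => //; first exact: measurable_funTS.
exists M; split=> [|x Mx t tb]; first exact: num_real.
exact: le_trans (fM _ tb) (ltW Mx).
Qed.

Lemma tbint_ereal d n (f : Rn n -> R) : bmeas d f ->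
  (\int[lebesgue_tuple R n]_(t in sqbox d n) (f t)%:E)%E = (tbint d f)%:E.
Proof.
move=> bf; rewrite /tbint /Rintegral fineK//.
by apply: integrable_fin_num; [exact: measurable_sqbox|exact: bmeas_integrable].
Qed.

Lemma tbint_eq d n (f g : Rn n -> R) : (forall t, sqbox d n t -> f t = g t) ->
  tbint d f = tbint d g.
Proof. by move=> fg; apply: eq_Rintegral => t; rewrite inE => /fg. Qed.

Lemma tbint_le d n (f g : Rn n -> R) : bmeas d f -> bmeas d g ->
  (forall t, sqbox d n t -> f t <= g t) -> tbint d f <= tbint d g.
Proof.
move=> bf bg fg; apply: le_Rintegral => //; first exact: measurable_sqbox.
- exact: bmeas_integrable.
- exact: bmeas_integrable.
Qed.

Lemma tbintD d n (f g : Rn n -> R) : bmeas d f -> bmeas d g ->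
  tbint d (fun t => f t + g t) = tbint d f + tbint d g.
Proof.
move=> bf bg; apply: RintegralD; first exact: measurable_sqbox.
- exact: bmeas_integrable.
- exact: bmeas_integrable.
Qed.

Lemma tbintB d n (f g : Rn n -> R) : bmeas d f -> bmeas d g ->
  tbint d (fun t => f t - g t) = tbint d f - tbint d g.
Proof.
move=> bf bg; apply: RintegralB; first exact: measurable_sqbox.
- exact: bmeas_integrable.
- exact: bmeas_integrable.
Qed.

Lemma tbintZ d n (k : R) (f : Rn n -> R) : bmeas d f ->
  tbint d (fun t => k * f t) = k * tbint d f.
Proof.
move=> bf; apply: RintegralZl; first exact: measurable_sqbox.
exact: bmeas_integrable.
Qed.

Lemma bmeas_cst d n (k : R) : bmeas d (fun _ : Rn n => k).
Proof. by split; [exact: measurable_cst|exists `|k|]. Qed.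

Lemma bmeasD d n (f g : Rn n -> R) : bmeas d f -> bmeas d g ->
  bmeas d (fun t => f t + g t).
Proof.
move=> [mf [M fM]] [mg [N gN]]; split; first exact: measurable_funD.
exists (M + N) => t tb; rewrite (le_trans (ler_normD _ _))//.
by rewrite lerD// ?fM ?gN.
Qed.

Lemma bmeasM d n (f g : Rn n -> R) : bmeas d f -> bmeas d g ->
  bmeas d (fun t => f t * g t).
Proof.
move=> [mf [M fM]] [mg [N gN]]; split; first exact: measurable_funM.
exists (M * N) => t tb; rewrite normrM.
by rewrite ler_pM// ?fM ?gN.
Qed.

Lemma bmeasN d n (f : Rn n -> R) : bmeas d f -> bmeas d (fun t => - f t).
Proof.
move=> [mf [M fM]]; split; first exact: (measurable_funN mf).
by exists M => t tb; rewrite normrN fM.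
Qed.

Lemma bmeasB d n (f g : Rn n -> R) : bmeas d f -> bmeas d g ->
  bmeas d (fun t => f t - g t).
Proof. by move=> bf bg; apply: bmeasD => //; exact: bmeasN. Qed.

Lemma bmeas_norm d n (f : Rn n -> R) : bmeas d f -> bmeas d (fun t => `|f t|).
Proof.
move=> [mf [M fM]]; split; first exact: measurableT_comp.
by exists M => t tb; rewrite normr_id fM.
Qed.

Lemma bmeas_sum d n I (r : seq I) (P : pred I) (F : I -> Rn n -> R) :
  (forall i, bmeas d (F i)) -> bmeas d (fun t => \sum_(i <- r | P i) F i t).
Proof.
move=> bF; elim: r => [|i r IH].
  rewrite (_ : (fun _ => _) = fun=> 0); first exact: bmeas_cst.
  by apply/funext => t; rewrite big_nil.
rewrite (_ : (fun _ => _) = fun t => (if P i then F i t else 0) +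
    \sum_(j <- r | P j) F j t); last first.
  by apply/funext => t; rewrite big_cons; case: (P i); rewrite ?add0r.
by apply: bmeasD => //; case: (P i) => //; exact: bmeas_cst.
Qed.

Lemma bmeas_prod d n I (r : seq I) (P : pred I) (F : I -> Rn n -> R) :
  (forall i, bmeas d (F i)) -> bmeas d (fun t => \prod_(i <- r | P i) F i t).
Proof.
move=> bF; elim: r => [|i r IH].
  rewrite (_ : (fun _ => _) = fun=> 1); first exact: bmeas_cst.
  by apply/funext => t; rewrite big_nil.
rewrite (_ : (fun _ => _) = fun t => (if P i then F i t else 1) *
    \prod_(j <- r | P j) F j t); last first.
  by apply/funext => t; rewrite big_cons; case: (P i); rewrite ?mul1r.
by apply: bmeasM => //; case: (P i) => //; exact: bmeas_cst.
Qed.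

Lemma measurable_tnthR n (j : 'I_n) : measurable_fun setT (fun t : Rn n => tnth t j : R).
Proof. exact: measurable_tnth. Qed.

Lemma bmeas_tnth d n (j : 'I_n) : bmeas d (fun t : Rn n => tnth t j).
Proof.
split; first exact: measurable_tnthR.
by exists d => t tb; rewrite ler_norml tb.
Qed.

Lemma bmeas_tnth_comp d n (f : R -> R) (j : 'I_n) : measurable_fun setT f ->
  (exists M, forall x, - d <= x <= d -> `|f x| <= M) ->
  bmeas d (fun t : Rn n => f (tnth t j)).
Proof.
move=> mf [M fM]; split.
  by apply: (measurableT_comp mf); exact: measurable_tnthR.
by exists M => t tb; exact/fM.
Qed.

Lemma bmeas_comp d n (g : R -> R) (f : Rn n -> R) : continuous g -> bmeas d f ->
  bmeas d (fun t => g (f t)).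
Proof.
move=> cg [mf [M fM]]; split.
  by apply: measurableT_comp => //; exact: continuous_measurable_fun.
have [->|/set0P[t0 bt0]] := eqVneq (sqbox d n) set0; first by exists 0.
have M0 : - M <= M.
  by have := fM _ bt0; have := normr_ge0 (f t0); lra.
have cgn : {within `[- M, M], continuous (fun x => `|g x|)}.
  apply: continuous_subspaceT => x.
  by apply: (continuous_comp (cg x)); exact: norm_continuous.
have [c cM gc] := EVT_max M0 cgn.
exists `|g c| => t tb; apply: gc.
by rewrite in_itv/= -ler_norml fM.
Qed.

End box.

Arguments sqbox {R} d n.
Arguments tbint {R} d {n} f.

(** * Iterated integrals and products of one-variable functions *)

Section fubini_box.
Context (R : realType).
Local Notation Rn n := (n.-tuple (measurableTypeR R)).
Implicit Types (n : nat) (d : R).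
Local Notation leb := (@lebesgue_measure R).

Local Notation seg d := ([set` `[(- d)%R, d%R]] : set (measurableTypeR R)).

Lemma tcons_sqbox d n : @tcons R n @^-1` (sqbox d n.+1) =
  [set` `[- d, d]] `*` sqbox d n.
Proof.
apply/seteqP; split=> -[x t] /=.
  move=> h; split => /=; first by have := h ord0; rewrite tnth0 in_itv.
  by move=> j; have := h (lift ord0 j); rewrite tnthS.
move=> [/= xd td] j; rewrite in_itv/= in xd.
by have [i ->|->] := unliftP ord0 j; rewrite ?tnthS ?tnth0.
Qed.

Lemma bmeas_cons d n (f : Rn n.+1 -> R) x : bmeas d f -> - d <= x <= d ->
  bmeas d (fun t : Rn n => f [tuple of x :: t]).
Proof.
move=> [mf [M fM]] xd; split.
  have m2 : measurable_fun setT (fun t : Rn n => (x : measurableTypeR R, t)).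
    exact: measurable_pair1.
  exact: (measurableT_comp mf (measurableT_comp (@measurable_tcons R n) m2)).
exists M => t tb; apply: fM.
suff : (@tcons R n @^-1` (sqbox d n.+1)) (x, t) by [].
by rewrite tcons_sqbox; split => //=; rewrite in_itv.
Qed.

(** At a successor [lebesgue_tuple] is the image of a product measure, so Fubini on that product,
    for the integrand cut off outside the cube, peels off the first coordinate. *)
Lemma tbint_cons d n (f : Rn n.+1 -> R) : bmeas d f ->
  tbint d f = \int[leb]_(x in `[- d, d]) tbint d (fun t : Rn n => f [tuple of x :: t]).
Proof.
move=> bf; have [mf [M fM]] := bf.
have mtc := @measurable_tcons R n.
have mfc : measurable_fun setT (f \o @tcons R n) by exact: measurableT_comp.
have mD : measurable ((seg d) `*` sqbox d n).
  by apply: measurableX => //; exact: measurable_sqbox.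
set P := product_measure1 leb (lebesgue_tuple R n).
have Poo : (P ((seg d) `*` sqbox d n) < +oo)%E.
  rewrite /P product_measure1E//; last exact: measurable_sqbox.
  rewrite lte_mul_pinfty//.
    by rewrite ge0_fin_numE//= lebesgue_measure_itv/=; case: ifP => _; rewrite ?ltry// -EFinB ltry.
  by have [] := sqbox_measure d n.
have iD : P.-integrable ((seg d) `*` sqbox d n) (EFin \o (f \o @tcons R n)).
  apply: measurable_bounded_integrable => //.
  - exact: measurable_funTS.
  - exists M; split=> [|x Mx t tb]; first exact: num_real.
    rewrite -tcons_sqbox in tb.
    exact: le_trans (fM _ tb) (ltW Mx).
rewrite /tbint /Rintegral; congr fine.
transitivity (\int[P]_(x in (seg d) `*` sqbox d n) ((f \o @tcons R n) x)%:E)%E.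
  have iD' : P.-integrable (@tcons R n @^-1` sqbox d n.+1) ((EFin \o f) \o @tcons R n).
    by rewrite tcons_sqbox.
  have mf' : measurable_fun setT (EFin \o f) by exact/measurable_EFinP.
  have := integral_pushforward mtc mf' iD' (@measurable_sqbox R d n.+1).
  by rewrite tcons_sqbox.
have iT : P.-integrable setT ((EFin \o (f \o @tcons R n)) \_ ((seg d) `*` sqbox d n)).
  exact/(integrable_mkcond _ mD).1.
have := integral12_prod_meas1 iT; rewrite -integral_mkcond => <-.
rewrite [RHS]integral_mkcond.
apply: eq_integral => x _; rewrite /fubini_F /patch.
case: ifPn => [xd|xd].
  rewrite inE/= in xd; rewrite fineK; last first.
    apply: integrable_fin_num; first exact: measurable_sqbox.
    by apply: bmeas_integrable; apply: bmeas_cons => //; rewrite in_itv in xd.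
  rewrite [RHS]integral_mkcond; apply: eq_integral => t _.
  rewrite /patch; congr (if _ then _ else _).
  by apply/idP/idP; rewrite !inE /=; [case|split].
rewrite integral0_eq// => t _; case: ifPn => //; rewrite inE/= => -[xd' _].
by case/negP : xd; rewrite inE.
Qed.

Lemma tbint0 d (f : Rn 0 -> R) : tbint d f = f [tuple].
Proof.
rewrite /tbint /Rintegral /=.
rewrite (_ : sqbox d 0 = setT); last by apply/seteqP; split => // t _ [].
rewrite (eq_integral (fun=> (f [tuple])%:E)); last first.
  by move=> t _; rewrite tuple0.
by rewrite integral_cst//= /dirac indicE in_setT /= mulr1.
Qed.

Lemma tnth_cons n (x : R) (t : Rn n) i : tnth [tuple of x :: t] (lift ord0 i) = tnth t i.
Proof. exact: tnthS. Qed.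

Lemma bigcons (T : Type) (idx : T) (op : Monoid.law idx) n (F : R -> T) (x : R) (t : Rn n) :
  \big[op/idx]_(j < n.+1) F (tnth [tuple of x :: t] j) =
  op (F x) (\big[op/idx]_(j < n) F (tnth t j)).
Proof.
by rewrite big_ord_recl tnth0; congr (op _ _); apply: eq_bigr => i _; rewrite tnth_cons.
Qed.

Definition bmeas1 d (f : R -> R) :=
  measurable_fun setT f /\ exists M, forall x, - d <= x <= d -> `|f x| <= M.

Definition int1 d (f : R -> R) : R := \int[leb]_(x in `[- d, d]) f x.

Lemma bmeas1_integrable d (f : R -> R) : bmeas1 d f ->
  leb.-integrable `[- d, d] (EFin \o f).
Proof.
move=> [mf [M fM]]; apply: measurable_bounded_integrable => //.
- by rewrite /= lebesgue_measure_itv/=; case: ifP => _; rewrite ?ltry// -EFinB ltry.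
- exact: measurable_funTS.
- exists M; split=> [|x Mx t /= tb]; first exact: num_real.
  by apply: le_trans (fM _ _) (ltW Mx); rewrite in_itv in tb.
Qed.

Lemma bmeas_prod1 d n (f : R -> R) : bmeas1 d f ->
  bmeas d (fun t : Rn n => \prod_(j < n) f (tnth t j)).
Proof.
move=> [mf fM].
by apply: (@bmeas_prod R d n 'I_n _ _ (fun j t => f (tnth t j))) => i; exact: bmeas_tnth_comp.
Qed.

Lemma bmeas_sum1 d n (f : R -> R) : bmeas1 d f ->
  bmeas d (fun t : Rn n => \sum_(j < n) f (tnth t j)).
Proof.
move=> [mf fM].
by apply: (@bmeas_sum R d n 'I_n _ _ (fun j t => f (tnth t j))) => i; exact: bmeas_tnth_comp.
Qed.

Lemma tbint_prod d n (f : R -> R) : bmeas1 d f ->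
  tbint d (fun t : Rn n => \prod_(j < n) f (tnth t j)) = (int1 d f) ^+ n.
Proof.
move=> bf; elim: n => [|n IH]; first by rewrite tbint0 big_ord0 expr0.
rewrite tbint_cons; last exact: bmeas_prod1.
transitivity (\int[leb]_(x in `[- d, d]) (f x * int1 d f ^+ n)).
  apply: eq_Rintegral => x _; rewrite -IH -tbintZ; last exact: bmeas_prod1.
  by apply: tbint_eq => t _; rewrite (bigcons *%R).
rewrite RintegralZr//; last exact: bmeas1_integrable.
by rewrite exprS.
Qed.

Lemma bmeas1M d f g : bmeas1 d f -> bmeas1 d g -> bmeas1 d (fun x => f x * g x).
Proof.
move=> [mf [M fM]] [mg [N gN]]; split; first exact: measurable_funM.
by exists (M * N) => x xd; rewrite normrM ler_pM// ?fM ?gN.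
Qed.

Lemma bmeas1D d f g : bmeas1 d f -> bmeas1 d g -> bmeas1 d (fun x => f x + g x).
Proof.
move=> [mf [M fM]] [mg [N gN]]; split; first exact: measurable_funD.
by exists (M + N) => x xd; rewrite (le_trans (ler_normD _ _))// lerD ?fM ?gN.
Qed.

Lemma bmeas1_cst d k : bmeas1 d (fun=> k).
Proof. by split; [exact: measurable_cst|exists `|k|]. Qed.

Lemma bmeas1_cont d f : continuous f -> bmeas1 d f.
Proof.
move=> cf; split; first exact: continuous_measurable_fun.
have [d0|d0] := ltP d 0; first by exists 0 => x; have := d0; lra.
have cfn : {within `[- d, d], continuous (fun x => `|f x|)}.
  apply: continuous_subspaceT => x.
  by apply: (continuous_comp (cf x)); exact: norm_continuous.
have dd : - d <= d by lra.
have [c cM fc] := EVT_max dd cfn.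
by exists `|f c| => x xd; apply: fc; rewrite in_itv.
Qed.

Lemma int1_eq d f g : (forall x, - d <= x <= d -> f x = g x) -> int1 d f = int1 d g.
Proof. by move=> fg; apply: eq_Rintegral => x; rewrite inE/= in_itv => /fg. Qed.

Lemma int1_le d f g : bmeas1 d f -> bmeas1 d g ->
  (forall x, - d <= x <= d -> f x <= g x) -> int1 d f <= int1 d g.
Proof.
move=> bf bg fg; apply: le_Rintegral => //.
- exact: bmeas1_integrable.
- exact: bmeas1_integrable.
Qed.

Lemma int1D d f g : bmeas1 d f -> bmeas1 d g ->
  int1 d (fun x => f x + g x) = int1 d f + int1 d g.
Proof. by move=> bf bg; apply: RintegralD => //; exact: bmeas1_integrable. Qed.

Lemma int1Z d k f : bmeas1 d f -> int1 d (fun x => k * f x) = k * int1 d f.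
Proof. by move=> bf; apply: RintegralZl => //; exact: bmeas1_integrable. Qed.

Lemma int1B d f g : bmeas1 d f -> bmeas1 d g ->
  int1 d (fun x => f x - g x) = int1 d f - int1 d g.
Proof. by move=> bf bg; apply: RintegralB => //; exact: bmeas1_integrable. Qed.

End fubini_box.
Arguments bmeas1 {R} d f.
Arguments int1 {R} d f.

(** * Exponential moments and cosine integrals under product weights *)

Section weighted.
Context (R : realType).
Local Notation Rn n := (n.-tuple (measurableTypeR R)).
Local Notation leb := (@lebesgue_measure R).
Implicit Types (n : nat) (d : R).

Lemma sum_cons n (F : R -> R) (x : R) (t : Rn n) :
  \sum_(j < n.+1) F (tnth [tuple of x :: t] j) = F x + \sum_(j < n) F (tnth t j).
Proof. exact: (bigcons +%R). Qed.

Lemma prod_cons n (F : R -> R) (x : R) (t : Rn n) :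
  \prod_(j < n.+1) F (tnth [tuple of x :: t] j) = F x * \prod_(j < n) F (tnth t j).
Proof. exact: (bigcons *%R). Qed.

(** Squaring [1 - x/2 <= e^(-x/2)] and inverting leaves a polynomial inequality whose excess factors
    as [x^2 (1 - x) (5/2 - x) / 2]. *)
Lemma expR_le_quad (x : R) : `|x| <= 1 -> expR x <= 1 + x + 2 * x ^+ 2.
Proof.
rewrite ler_norml => /andP[x1 x2].
have h : 1 - x / 2 <= expR (- (x / 2)) by have := expR_ge1Dx (- (x / 2)); lra.
have h0 : 0 < 1 - x / 2 by lra.
have e0 := expR_gt0 (- (x / 2)).
have -> : expR x = (expR (- (x / 2)) ^+ 2)^-1.
  by rewrite -expRM_natl -expRN; congr expR; field.
rewrite -div1r ler_pdivrMr ?exprn_gt0// mulrC.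
have : (1 - x / 2) ^+ 2 <= expR (- (x / 2)) ^+ 2 by nra.
set y := expR _ ^+ 2 => hy.
have q0 : 0 <= 1 + x + 2 * x ^+ 2 by nra.
have : (1 - x / 2) ^+ 2 * (1 + x + 2 * x ^+ 2) <= y * (1 + x + 2 * x ^+ 2).
  exact: ler_wpM2r.
apply: le_trans.
have -> : (1 - x / 2) ^+ 2 * (1 + x + 2 * x ^+ 2) =
  1 + x ^+ 2 * ((1 - x) * (5 / 2 - x) / 2) by field.
have : 0 <= x ^+ 2 * ((1 - x) * (5 / 2 - x) / 2).
  by apply: mulr_ge0; [exact: sqr_ge0|nra].
lra.
Qed.

Section weight.
Variables (d : R) (w : R -> R).
Hypothesis bw : bmeas1 d w.
Hypothesis w0 : forall x, 0 <= w x.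
Let Z := int1 d w.

Lemma bmeas1_w_exp (g : R -> R) (s : R) : bmeas1 d g ->
  bmeas1 d (fun x => w x * expR (s * g x)).
Proof.
move=> [mg [M gM]]; apply: bmeas1M => //; split.
  by apply: measurableT_comp => //; apply: measurable_funM.
exists (expR (`|s| * M)) => x xd; rewrite ger0_norm ?expR_ge0// ler_expR.
by rewrite (le_trans (ler_norm _))// normrM ler_wpM2l// gM.
Qed.

(** For a centred function the linear term of the exponential integrates to 0, so the moment
    generating function is [1 + O(s^2)]. *)
Lemma int1_w_exp_le (g : R -> R) (s : R) : bmeas1 d g ->
  (forall x, - d <= x <= d -> `|g x| <= 1) ->
  int1 d (fun x => w x * g x) = 0 -> `|s| <= 1 ->
  int1 d (fun x => w x * expR (s * g x)) <= Z * expR (2 * s ^+ 2).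
Proof.
move=> bg g1 wg0 s1.
have bwg : bmeas1 d (fun x => w x * g x) by exact: bmeas1M.
have bE := bmeas1_w_exp s bg.
have bs : bmeas1 d (fun x => (1 + 2 * s ^+ 2) * w x + s * (w x * g x)).
  by apply: bmeas1D; apply: bmeas1M => //; exact: bmeas1_cst.
apply: (@le_trans _ _ (int1 d (fun x => (1 + 2 * s ^+ 2) * w x + s * (w x * g x)))).
  apply: int1_le => // x xd.
  have sg1 : `|s * g x| <= 1 by rewrite normrM mulr_ile1// g1.
  have h := expR_le_quad sg1.
  have g2 : g x ^+ 2 <= 1.
    by rewrite -real_normK ?num_real// exprn_ile1// g1.
  have : (s * g x) ^+ 2 <= s ^+ 2.
    by rewrite exprMn -[leRHS]mulr1 ler_wpM2l ?sqr_ge0.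
  move=> h2.
  have : w x * expR (s * g x) <= w x * (1 + s * g x + 2 * s ^+ 2).
    by apply: ler_wpM2l => //; lra.
  by move=> h3; apply: (le_trans h3); rewrite le_eqVlt; apply/orP; left; apply/eqP; ring.
rewrite int1D; last 2 first.
  by apply: bmeas1M => //; exact: bmeas1_cst.
  by apply: bmeas1M => //; exact: bmeas1_cst.
rewrite !int1Z// wg0 mulr0 addr0 mulrC ler_wpM2l//.
  by apply: Rintegral_ge0 => x _; exact: w0.
exact: expR_ge1Dx.
Qed.

(** A centred bounded sum has exponential moments at scale [sqrt n]: bound [e^|x|] by
    [e^x + e^(-x)], factorise, and note that [n] factors [e^(2 s^2)] with [s^2 = 1/n] make [e^2]. *)
Lemma tbint_exp_abs_sum n (g : R -> R) : bmeas1 d g -> (0 < n)%N ->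
  (forall x, - d <= x <= d -> `|g x| <= 1) ->
  int1 d (fun x => w x * g x) = 0 ->
  tbint d (fun t : Rn n => (\prod_(j < n) w (tnth t j)) *
     expR (`|\sum_(j < n) g (tnth t j)| / Num.sqrt n%:R)) <= 2 * expR 2 * Z ^+ n.
Proof.
move=> bg n0 g1 wg0.
pose sn : R := (Num.sqrt n%:R)^-1.
have sn0 : 0 <= sn by rewrite invr_ge0.
have sn1 : `|sn| <= 1.
  rewrite ger0_norm// invf_le1//; last by rewrite sqrtr_gt0 ltr0n.
  by rewrite -[leLHS]sqrtr1 ler_sqrt ?ler0n// ler1n.
have nsn : n%:R * (2 * sn ^+ 2) = 2.
  by rewrite /sn exprVn sqr_sqrtr ?ler0n// mulrCA divff ?mulr1// pnatr_eq0 -lt0n.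
have Z0 : 0 <= Z by apply: Rintegral_ge0 => x _; exact: w0.
have half s : `|s| <= 1 -> s ^+ 2 = sn ^+ 2 ->
    tbint d (fun t : Rn n => \prod_(j < n) (w (tnth t j) * expR (s * g (tnth t j)))) <=
    expR 2 * Z ^+ n.
  move=> s1 s2; rewrite (@tbint_prod _ d n (fun x => w x * expR (s * g x))); last exact: bmeas1_w_exp.
  have h := int1_w_exp_le bg g1 wg0 s1.
  have h0 : 0 <= int1 d (fun x => w x * expR (s * g x)).
    by apply: Rintegral_ge0 => x _; rewrite mulr_ge0 ?expR_ge0.
  apply: (@le_trans _ _ ((Z * expR (2 * s ^+ 2)) ^+ n)).
    by apply: lerXn2r => //; rewrite nnegrE// mulr_ge0 ?expR_ge0.
  by rewrite exprMn -expRM_natl s2 nsn mulrC.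
have bp s : bmeas d (fun t : Rn n => \prod_(j < n) (w (tnth t j) * expR (s * g (tnth t j)))).
  by apply: (@bmeas_prod1 _ d n (fun x => w x * expR (s * g x))); exact: bmeas1_w_exp.
apply: (@le_trans _ _ (tbint d (fun t : Rn n =>
   (\prod_(j < n) (w (tnth t j) * expR (sn * g (tnth t j)))) +
   (\prod_(j < n) (w (tnth t j) * expR (- sn * g (tnth t j))))))).
  apply: tbint_le.
  - apply: bmeasM; first exact: bmeas_prod1.
    apply: (bmeas_comp (@continuous_expR R)); apply: bmeasM; last exact: bmeas_cst.
    by apply: bmeas_norm; exact: bmeas_sum1.
  - exact: bmeasD.
  - move=> t _; rewrite !big_split/= -mulrDr ler_wpM2l ?prodr_ge0//.
    rewrite -!expR_sum -!mulr_sumr.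
    set S := \sum_(i < n) _.
    rewrite -/sn mulrC mulNr.
    have [S0|S0] := leP 0 S.
      by rewrite ger0_norm// lerDl expR_ge0.
    by rewrite ltr0_norm// mulrN lerDr expR_ge0.
rewrite tbintD//.
have h1 := half _ sn1 erefl.
have h2 : tbint d (fun t : Rn n => \prod_(j < n) (w (tnth t j) * expR (- sn * g (tnth t j)))) <=
    expR 2 * Z ^+ n.
  by apply: half; rewrite ?normrN ?sqrrN.
by rewrite -mulrA mulr_natl mulr2n; exact: lerD.
Qed.

(** This is the real part of a product of [n] complex integrals with zero imaginary parts. The
    induction carries the sine integral along because the addition formula mixes the two. *)
Lemma tbint_prod_cos n (u : R -> R) : measurable_fun setT u ->
  int1 d (fun x => w x * sin (u x)) = 0 ->
  tbint d (fun t : Rn n => (\prod_(j < n) w (tnth t j)) *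
     cos (\sum_(j < n) u (tnth t j))) = (int1 d (fun x => w x * cos (u x))) ^+ n.
Proof.
move=> mu0 ws0.
have msin : measurable_fun setT (@sin R) := continuous_measurable_fun (@continuous_sin R).
have mcos : measurable_fun setT (@cos R) := continuous_measurable_fun (@continuous_cos R).
have bsin : bmeas1 d (fun x => w x * sin (u x)).
  apply: bmeas1M => //; split; first exact: measurableT_comp.
  by exists 1 => x _; exact: sin_max.
have bcos : bmeas1 d (fun x => w x * cos (u x)).
  apply: bmeas1M => //; split; first exact: measurableT_comp.
  by exists 1 => x _; exact: cos_max.
have mS m : measurable_fun setT (fun t : Rn m => \sum_(j < m) u (tnth t j)).
  rewrite (_ : (fun _ => _) = fun t : Rn m => \sum_(j <- enum 'I_m) u (tnth t j)).
    apply: (@measurable_sum _ _ _ _ _ _ (fun j (t : Rn m) => u (tnth t j))) => j.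
    by apply: (measurableT_comp mu0); exact: measurable_tnthR.
  by apply/funext => t; rewrite big_enum.
have bC m : bmeas d (fun t : Rn m => (\prod_(j < m) w (tnth t j)) * cos (\sum_(j < m) u (tnth t j))).
  apply: bmeasM; first exact: bmeas_prod1.
  by split; [exact: (measurableT_comp mcos (mS m))|exists 1 => t _; exact: cos_max].
have bS m : bmeas d (fun t : Rn m => (\prod_(j < m) w (tnth t j)) * sin (\sum_(j < m) u (tnth t j))).
  apply: bmeasM; first exact: bmeas_prod1.
  by split; [exact: (measurableT_comp msin (mS m))|exists 1 => t _; exact: sin_max].
suff /(_ n)[] : forall m, tbint d (fun t : Rn m => (\prod_(j < m) w (tnth t j)) *
     cos (\sum_(j < m) u (tnth t j))) = (int1 d (fun x => w x * cos (u x))) ^+ m /\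
  tbint d (fun t : Rn m => (\prod_(j < m) w (tnth t j)) *
     sin (\sum_(j < m) u (tnth t j))) = 0 by [].
elim=> [|m [IHc IHs]].
  by rewrite !tbint0 !big_ord0 cos0 sin0 mulr0 mulr1 expr0.
rewrite !tbint_cons//; split.
- transitivity (\int[leb]_(x in `[- d, d])
     (w x * cos (u x) * (int1 d (fun x => w x * cos (u x))) ^+ m)).
    apply: eq_Rintegral => x _.
    transitivity (tbint d (fun t : Rn m =>
        w x * cos (u x) * ((\prod_(j < m) w (tnth t j)) * cos (\sum_(j < m) u (tnth t j))) -
        w x * sin (u x) * ((\prod_(j < m) w (tnth t j)) * sin (\sum_(j < m) u (tnth t j))))).
      apply: tbint_eq => t _; rewrite prod_cons sum_cons cosD; ring.
    rewrite tbintB; [|by apply: bmeasM => //; exact: bmeas_cst..].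
    by rewrite !tbintZ// IHc IHs mulr0 subr0.
  rewrite RintegralZr//; last exact: bmeas1_integrable.
  by rewrite exprS.
- transitivity (\int[leb]_(x in `[- d, d])
     (w x * sin (u x) * (int1 d (fun x => w x * cos (u x))) ^+ m)).
    apply: eq_Rintegral => x _.
    transitivity (tbint d (fun t : Rn m =>
        w x * sin (u x) * ((\prod_(j < m) w (tnth t j)) * cos (\sum_(j < m) u (tnth t j))) +
        w x * cos (u x) * ((\prod_(j < m) w (tnth t j)) * sin (\sum_(j < m) u (tnth t j))))).
      apply: tbint_eq => t _; rewrite prod_cons sum_cons sinD; ring.
    rewrite tbintD; [|by apply: bmeasM => //; exact: bmeas_cst..].
    by rewrite !tbintZ// IHc IHs mulr0 addr0.
  rewrite RintegralZr//; last exact: bmeas1_integrable.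
  by rewrite -/(int1 d _) ws0 mul0r.
Qed.

End weight.
End weighted.

(** * One-dimensional integrals *)

Section calculus.
Context (R : realType).
Local Notation leb := (@lebesgue_measure R).
Implicit Types (d a b c A L x y : R).

Lemma is_derive_continuous (F f : R -> R) : (forall x, is_derive x 1 F (f x)) ->
  continuous F.
Proof.
move=> dF x; apply: differentiable_continuous; apply/derivable1_diffP.
exact: (@ex_derive _ _ _ _ _ _ _ (dF x)).
Qed.

Lemma Rintegral_FTC2 (F f : R -> R) a b : a < b -> continuous f ->
  (forall x, is_derive x 1 F (f x)) ->
  \int[leb]_(x in `[a, b]) f x = F b - F a.
Proof.
move=> ab cf dF; have cF := is_derive_continuous dF.
rewrite /Rintegral (@continuous_FTC2 _ f F a b)//.
- exact: continuous_subspaceT.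
- split; first by move=> x _; exact: (@ex_derive _ _ _ _ _ _ _ (dF x)).
  + by apply: cvg_at_right_filter; exact: cF.
  + by apply: cvg_at_left_filter; exact: cF.
- by move=> x _; rewrite derive1E (@derive_val _ _ _ _ _ _ _ (dF x)).
Qed.

Lemma Rintegral_affine (f : R -> R) a b c x0 : 0 < c -> a <= b -> continuous f ->
  \int[leb]_(x in `[c * a + x0, c * b + x0]) f x =
  c * \int[leb]_(x in `[a, b]) f (c * x + x0).
Proof.
move=> c0 ab cf.
have dF x : is_derive x 1 (fun x => c * x + x0) c.
  by apply: is_derive_eq; rewrite /GRing.scale /= !mulr1 addr0.
have F'E : derive1 (fun x : R => c * x + x0) = cst c.
  by apply/funext => x; rewrite derive1E (@derive_val _ _ _ _ _ _ _ (dF x)).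
have cF := is_derive_continuous dF.
have cfF : continuous (fun x => f (c * x + x0)).
  by move=> x; apply: (continuous_comp (cF x)); exact: cf.
have := @integration_by_substitution_increasing R (fun x => c * x + x0) f a b ab.
rewrite F'E /= => h; rewrite /Rintegral h//.
- rewrite -[RHS]RintegralZl//; last first.
    apply: continuous_compact_integrable; first exact: segment_compact.
    exact: continuous_subspaceT.
  by rewrite /Rintegral; congr fine; apply: eq_integral => x _; rewrite !fctE mulrC.
- by move=> x y _ _ xy; rewrite ltrD2r ltr_pM2l.
- by move=> x _; exact: cst_continuous.
- exact: is_cvg_cst.
- exact: is_cvg_cst.
- split; first by move=> x _; exact: (@ex_derive _ _ _ _ _ _ _ (dF x)).
  + by apply: cvg_at_right_filter; exact: cF.
  + by apply: cvg_at_left_filter; exact: cF.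
- exact: continuous_subspaceT.
Qed.

Lemma int1_odd d (f : R -> R) : continuous f -> (forall x, f (- x) = - f x) ->
  int1 d f = 0.
Proof.
move=> cf fN.
have [d0|d0] := ltP d 0.
  by rewrite /int1 set_itv_ge ?Rintegral_set0// bnd_simp -ltNge; lra.
have dd : - d <= d by lra.
have := @integration_by_substitution_oppr R f (- d) d dd.
rewrite opprK => /(_ (continuous_subspaceT cf)) h.
have E : int1 d f = int1 d (fun x => - f x).
  rewrite {1}/int1 /Rintegral h; congr fine; apply: eq_integral => x _ /=.
  by rewrite fN.
have : int1 d (fun x => - f x) = - int1 d f.
  transitivity (int1 d (fun x => - 1 * f x)); first by apply: int1_eq => x _; rewrite mulN1r.
  by rewrite int1Z ?mulN1r//; exact: bmeas1_cont.
by rewrite -E => ?; lra.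
Qed.

(** There is no factor 1/2 in the exponent: the standard weight [e^(-x^2/2)] is [gauss 2^-1], and
    [gauss (- 2^-1)] is its inverse. *)
Definition gauss A x : R := expR (- (A * x ^+ 2)).

Lemma is_derive_gauss A x : is_derive x 1 (gauss A) (- (2 * A * x) * gauss A x).
Proof.
rewrite /gauss; apply: is_derive_eq.
rewrite /GRing.scale /=; ring.
Qed.

Lemma continuous_gauss A : continuous (gauss A).
Proof. exact: is_derive_continuous (is_derive_gauss A). Qed.

Lemma gauss_ge0 A x : 0 <= gauss A x. Proof. exact: expR_ge0. Qed.
Lemma gauss_gt0 A x : 0 < gauss A x. Proof. exact: expR_gt0. Qed.
Lemma gaussN A x : gauss A (- x) = gauss A x. Proof. by rewrite /gauss sqrrN. Qed.

Lemma gauss_le1 A x : 0 <= A -> gauss A x <= 1.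
Proof. by move=> A0; rewrite /gauss expR_le1 oppr_le0 mulr_ge0// sqr_ge0. Qed.

Lemma continuous_Xgauss A n : continuous (fun x => x ^+ n * gauss A x).
Proof. by move=> x; apply: cvgM; [exact: exprn_continuous|exact: continuous_gauss]. Qed.

Lemma is_derive_exp n x : is_derive x 1 (fun y : R => y ^+ n.+1) (n.+1%:R * x ^+ n).
Proof.
rewrite (_ : (fun _ => _) = id ^+ n.+1); last by apply/funext => y; rewrite exprfctE.
have := @is_deriveX R R id n.+1 x 1 1 (is_derive_id x 1).
by rewrite /GRing.scale /= mulr1.
Qed.

(** Integration by parts; for even [k] the two boundary terms add up with a favourable sign and are
    dropped. Truncated moments therefore obey the same upper bounds as the full Gaussian ones. *)
Lemma gauss_moment A d (k : nat) : 0 < d -> ~~ odd k ->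
  2 * A * int1 d (fun x => x ^+ k.+2 * gauss A x) <=
  k.+1%:R * int1 d (fun x => x ^+ k * gauss A x).
Proof.
move=> d0 ek.
have dF x : is_derive x 1 (fun x => x ^+ k.+1 * gauss A x)
    (k.+1%:R * (x ^+ k * gauss A x) - 2 * A * (x ^+ k.+2 * gauss A x)).
  have d1 := is_derive_gauss A x.
  apply: (is_derive_eq (is_deriveM (is_derive_exp k x) d1)).
  rewrite /GRing.scale /= !exprS; ring.
have cf : continuous (fun x => k.+1%:R * (x ^+ k * gauss A x) - 2 * A * (x ^+ k.+2 * gauss A x)).
  move=> x; apply: cvgB; apply: cvgM; by [exact: cvg_cst|exact: continuous_Xgauss].
have dd : - d < d by lra.
have := Rintegral_FTC2 dd cf dF; rewrite -/(int1 d _).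
have bX n : bmeas1 d (fun x => x ^+ n * gauss A x).
  by apply: bmeas1_cont; exact: continuous_Xgauss.
rewrite int1B; last 2 first.
  by apply: bmeas1M => //; exact: bmeas1_cst.
  by apply: bmeas1M => //; exact: bmeas1_cst.
rewrite !int1Z// gaussN exprNn -signr_odd /= ek expr1 mulN1r mulNr opprK => h.
rewrite -subr_ge0 h addr_ge0// mulr_ge0 ?gauss_ge0// exprn_ge0//; exact: ltW.
Qed.
End calculus.

(** * The truncated Gaussian Fourier transform *)

Section hubbard_stratonovich.
Context (R : realType).
Local Notation leb := (@lebesgue_measure R).
Implicit Types (L x y : R).

(** For large [L] this is nearly proportional to [e^(-y^2/2)]. Only the ratio to its value at 0
    matters, so the full Gaussian integral never has to be known. *)
Definition trunc_fourier L y : R := int1 L (fun x => gauss 2^-1 x * cos (x * y)).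

Lemma continuous_cosM (y : R) : continuous (fun x : R => cos (x * y)).
Proof.
move=> x; apply: (continuous_comp (f := fun x => x * y)); last exact: continuous_cos.
by apply: cvgM; [exact: cvg_id|exact: cvg_cst].
Qed.

Lemma continuous_sinM (y : R) : continuous (fun x : R => sin (x * y)).
Proof.
move=> x; apply: (continuous_comp (f := fun x => x * y)); last exact: continuous_sin.
by apply: cvgM; [exact: cvg_id|exact: cvg_cst].
Qed.

(** The left side is the derivative under the integral sign, so this is the differential equation
    [F' = - y F] of the Gaussian up to a boundary term. *)
Lemma trunc_fourier_parts L y : 0 < L ->
  int1 L (fun x => - x * gauss 2^-1 x * sin (x * y)) =
  2 * gauss 2^-1 L * sin (L * y) - y * trunc_fourier L y.
Proof.
move=> L0.
have bc : bmeas1 L (fun x => gauss 2^-1 x * cos (x * y)).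
  apply: bmeas1_cont => x; apply: cvgM; [exact: continuous_gauss|exact: continuous_cosM].
have cxs : continuous (fun x => - x * gauss 2^-1 x * sin (x * y)).
  move=> x; apply: cvgM; last exact: continuous_sinM.
  by apply: cvgM; [apply: cvgN; exact: cvg_id|exact: continuous_gauss].
have dS x : is_derive x 1 (fun x => sin (x * y)) (y * cos (x * y)).
  apply: is_derive_eq; rewrite /GRing.scale /=; ring.
have dF x : is_derive x 1 (fun x => gauss 2^-1 x * sin (x * y))
   (- x * gauss 2^-1 x * sin (x * y) + y * (gauss 2^-1 x * cos (x * y))).
  apply: (is_derive_eq (is_deriveM (is_derive_gauss _ x) (dS x))).
  by rewrite /GRing.scale /=; field.
have LL : - L < L by lra.
have h := Rintegral_FTC2 LL _ dF.
have /h : continuous (fun x => - x * gauss 2^-1 x * sin (x * y) +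
    y * (gauss 2^-1 x * cos (x * y))).
  move=> x; apply: cvgD; first exact: cxs.
  apply: cvgM; first exact: cvg_cst.
  by apply: cvgM; [exact: continuous_gauss|exact: continuous_cosM].
rewrite -/(int1 L _) int1D; last 2 first.
  exact: bmeas1_cont.
  by apply: bmeas1M => //; exact: bmeas1_cst.
rewrite int1Z// -/(trunc_fourier L y) gaussN mulNr sinN => e.
lra.
Qed.

Lemma is_derive_trunc_fourier L y : 0 < L ->
  is_derive y 1 (trunc_fourier L) (2 * gauss 2^-1 L * sin (L * y) - y * trunc_fourier L y).
Proof.
move=> L0; rewrite -trunc_fourier_parts//.
pose f (y x : R) : R := gauss 2^-1 x * cos (x * y).
(* Dominates the derivative in the parameter: [|x| <= L], and the Gaussian and the sine are at most
   1. *)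
pose G : R -> R := fun=> L.
have df (z x : R) : is_derive z 1 (f ^~ x) (- x * gauss 2^-1 x * sin (x * z)).
  rewrite /f; apply: is_derive_eq; rewrite /GRing.scale /=; ring.
have Ia : `]y - 1, y + 1[%classic y by rewrite /= in_itv/=; apply/andP; split; lra.
have intf z : `]y - 1, y + 1[%classic z -> leb.-integrable `[- L, L] (EFin \o f z).
  move=> _; apply: bmeas1_integrable; apply: bmeas1_cont => x.
  by apply: cvgM; [exact: continuous_gauss|exact: continuous_cosM].
have derf z x : `]y - 1, y + 1[%classic z -> `[- L, L]%classic x -> derivable (f ^~ x) z 1.
  by move=> _ _; exact: (@ex_derive _ _ _ _ _ _ _ (df z x)).
have d1E z x : derive1 (f ^~ x) z = - x * gauss 2^-1 x * sin (x * z).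
  by rewrite derive1E (@derive_val _ _ _ _ _ _ _ (df z x)).
have G0 x : 0 <= G x by exact: ltW.
have iG : leb.-integrable `[- L, L] (EFin \o G).
  by apply: bmeas1_integrable; exact: bmeas1_cst.
have Gub z x : `]y - 1, y + 1[%classic z -> `[- L, L]%classic x ->
    `|derive1 (f ^~ x) z| <= G x.
  move=> _ /=; rewrite in_itv/= d1E => xL.
  rewrite !normrM normrN (ger0_norm (gauss_ge0 _ _)) /G.
  have h1 : `|x| <= L by rewrite ler_norml.
  have h2 : gauss 2^-1 x <= 1 by apply: gauss_le1; rewrite invr_ge0.
  have h3 := sin_max (x * z).
  have h4 := gauss_ge0 2^-1 x.
  have h5 := normr_ge0 (sin (x * z)).
  have h6 := normr_ge0 x.
  rewrite -[leRHS]mulr1 -mulrA; apply: ler_pM => //; first exact: mulr_ge0.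
  by rewrite -[leRHS]mulr1 ler_pM.
have mL : measurable (`[- L, L]%classic : set (measurableTypeR R)) by [].
have dv := @derivable_under_integral R _ _ leb f _ mL y (y - 1) (y + 1) Ia intf derf G G0 iG Gub.
have dE := @differentiation_under_integral R _ _ leb f _ mL y (y - 1) (y + 1) Ia intf derf G G0 iG Gub.
apply: DeriveDef; first exact: dv.
rewrite -derive1E; move: dE; rewrite /= => dE.
rewrite [LHS]dE /int1; apply: eq_Rintegral => x _.
exact: d1E.
Qed.

Lemma trunc_fourierN L y : trunc_fourier L (- y) = trunc_fourier L y.
Proof. by apply: int1_eq => x _; rewrite mulrN cosN. Qed.

(* [K y = trunc_fourier L y * e^(y^2/2)] has derivative
   [2 e^(-L^2/2) sin (L y) e^(y^2/2)], which bounds the deviation from [K 0]. *)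
Lemma trunc_fourier_approx L y : 0 < L ->
  `|trunc_fourier L y - trunc_fourier L 0 * gauss 2^-1 y| <=
  2 * `|y| * gauss 2^-1 L.
Proof.
move=> L0; wlog y0 : y / 0 <= y => [hw|].
  have [/hw//|y0] := leP 0 y.
  have := hw (- y); rewrite trunc_fourierN gaussN normrN; apply.
  by rewrite oppr_ge0 ltW.
move: y0; rewrite le_eqVlt => /predU1P[<-|y0].
  by rewrite /gauss expr0n mulr0 oppr0 expR0 mulr1 subrr normr0 mulr0 mul0r.
pose K (z : R) : R := trunc_fourier L z * gauss (- 2^-1) z.
have dK (z : R) : is_derive z 1 K (2 * gauss 2^-1 L * sin (L * z) * gauss (- 2^-1) z).
  apply: (is_derive_eq (is_deriveM (is_derive_trunc_fourier z L0) (is_derive_gauss _ z))).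
  by rewrite /GRing.scale /=; field.
have cK : {within `[0, y], continuous K}.
  apply: continuous_subspaceT; exact: is_derive_continuous dK.
have [c] := MVT y0 (fun x _ => dK x) cK.
rewrite in_itv/= subr0 => /andP[c0 cy] KE.
have gg : gauss 2^-1 y * gauss (- 2^-1) y = 1.
  by rewrite /gauss -expRD mulNr opprK addNr expR0.
have K0 : K 0 = trunc_fourier L 0.
  by rewrite /K /gauss expr0n mulr0 oppr0 expR0 mulr1.
have -> : trunc_fourier L y - trunc_fourier L 0 * gauss 2^-1 y = gauss 2^-1 y * (K y - K 0).
  by rewrite mulrBr K0 /K mulrCA gg mulr1 [in RHS]mulrC.
rewrite KE !normrM (gtr0_norm y0) !(ger0_norm (gauss_ge0 _ _)) (ger0_norm (ler0n _ 2)).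
have g1 : gauss (- 2^-1) c <= gauss (- 2^-1) y.
  by rewrite /gauss ler_expR !mulNr !opprK ler_pM2l ?invr_gt0//; nra.
have h3 := sin_max (L * c).
have hL := gauss_ge0 2^-1 L.
have hy := gauss_ge0 2^-1 y.
have hc := gauss_ge0 (- 2^-1) c.
have h5 := normr_ge0 (sin (L * c)).
have : `|sin (L * c)| * gauss (- 2^-1) c <= gauss (- 2^-1) y.
  by rewrite -[leRHS]mul1r ler_pM.
move=> h6.
have : gauss 2^-1 y * (`|sin (L * c)| * gauss (- 2^-1) c) <= 1.
  by rewrite -[leRHS]gg; apply: ler_wpM2l.
move=> h7.
have h8 : 0 <= 2 * gauss 2^-1 L * y by rewrite !mulr_ge0// ltW.
have := ler_wpM2l h8 h7.
by rewrite mulr1 => h9; rewrite [leRHS](_ : _ = 2 * gauss 2^-1 L * y); [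
  rewrite [leLHS](_ : _ = 2 * gauss 2^-1 L * y * (gauss 2^-1 y * (`|sin (L * c)| * gauss (- 2^-1) c)));
  [|ring]|ring].
Qed.

Lemma trunc_fourier_cos L y h : 0 < L ->
  int1 L (fun x => gauss 2^-1 x * cos (x * y + h)) = cos h * trunc_fourier L y.
Proof.
move=> L0.
have bc : bmeas1 L (fun x => gauss 2^-1 x * cos (x * y)).
  apply: bmeas1_cont => x; apply: cvgM; [exact: continuous_gauss|exact: continuous_cosM].
have cs : continuous (fun x => gauss 2^-1 x * sin (x * y)).
  move=> x; apply: cvgM; [exact: continuous_gauss|exact: continuous_sinM].
transitivity (int1 L (fun x => cos h * (gauss 2^-1 x * cos (x * y)) -
                               sin h * (gauss 2^-1 x * sin (x * y)))).
  by apply: int1_eq => x _; rewrite cosD; ring.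
rewrite int1B; last 2 first.
  by apply: bmeas1M => //; exact: bmeas1_cst.
  by apply: bmeas1M; [exact: bmeas1_cst|exact: bmeas1_cont].
rewrite !int1Z//; last exact: bmeas1_cont.
rewrite (@int1_odd _ _ _ cs) ?mulr0 ?subr0// => x.
by rewrite gaussN mulNr sinN mulrN.
Qed.

Lemma trunc_fourier0_le L : 0 < L -> trunc_fourier L 0 <= 2 * L.
Proof.
move=> L0.
have -> : 2 * L = int1 L (fun=> 1).
  rewrite /int1 Rintegral_cst// mul1r /= lebesgue_measure_itv/= lte_fin.
  have -> : - L < L by lra.
  by rewrite -EFinB /=; ring.
apply: int1_le.
- apply: bmeas1_cont => x; apply: cvgM; [exact: continuous_gauss|exact: continuous_cosM].
- exact: bmeas1_cst.
- by move=> x _; rewrite mulr0 cos0 mulr1; apply: gauss_le1; rewrite invr_ge0.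
Qed.

Lemma trunc_fourier0_gt0 L : 0 < L -> 0 < trunc_fourier L 0.
Proof.
move=> L0.
have h : 2 * L * gauss 2^-1 L <= trunc_fourier L 0.
  have -> : 2 * L * gauss 2^-1 L = int1 L (fun=> gauss 2^-1 L).
    rewrite /int1 Rintegral_cst// /= lebesgue_measure_itv/= lte_fin.
    have -> : - L < L by lra.
    by rewrite -EFinB /=; ring.
  apply: int1_le.
  - exact: bmeas1_cst.
  - apply: bmeas1_cont => x; apply: cvgM; [exact: continuous_gauss|exact: continuous_cosM].
  - move=> x xL; rewrite mulr0 cos0 mulr1 /gauss ler_expR lerN2 ler_pM2l ?invr_gt0//.
    by rewrite -real_normK ?num_real// lerXn2r ?nnegrE ?normr_ge0 ?(ltW L0)// ler_norml.
apply: lt_le_trans h; by rewrite !mulr_gt0// gauss_gt0.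
Qed.
End hubbard_stratonovich.

(** * The central integral as an integral over frequencies *)

Section main_term.
Context (R : realType).
Local Notation Rn n := (n.-tuple (measurableTypeR R)).
Local Notation leb := (@lebesgue_measure R).
Local Notation seg d := ([set` `[(- d)%R, d%R]] : set (measurableTypeR R)).
Implicit Types (n : nat) (d L : R).

Lemma leb_seg_lty d : (leb (seg d) < +oo)%E.
Proof. by rewrite /= lebesgue_measure_itv/=; case: ifP => _; rewrite ?ltry// -EFinB ltry. Qed.

Lemma int1_tbint d L n (f : measurableTypeR R -> Rn n -> R) M :
  measurable_fun setT (fun p : measurableTypeR R * Rn n => f p.1 p.2) ->
  (forall x t, - L <= x <= L -> sqbox d n t -> `|f x t| <= M) ->
  int1 L (fun x => tbint d (f x)) = tbint d (fun t => int1 L (f ^~ t)).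
Proof.
move=> mf fM.
pose P := product_measure1 leb (lebesgue_tuple R n).
have mD : measurable ((seg L) `*` sqbox d n).
  by apply: measurableX => //; exact: measurable_sqbox.
have Poo : (P ((seg L) `*` sqbox d n) < +oo)%E.
  rewrite /P product_measure1E//; last exact: measurable_sqbox.
  rewrite lte_mul_pinfty//; first by rewrite ge0_fin_numE//; exact: leb_seg_lty.
  by have [] := sqbox_measure d n.
have iD : P.-integrable ((seg L) `*` sqbox d n) (EFin \o (fun p => f p.1 p.2)).
  apply: measurable_bounded_integrable => //; first exact: measurable_funTS.
  exists M; split=> [|x Mx [y t] [/= yL tb]]; first exact: num_real.
  by apply: le_trans (ltW Mx); apply: fM => //; rewrite in_itv in yL.
have iT : P.-integrable setT ((EFin \o (fun p => f p.1 p.2)) \_ ((seg L) `*` sqbox d n)).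
  exact/(integrable_mkcond _ mD).1.
have bt x : - L <= x <= L -> bmeas d (f x).
  move=> xL; split; last by exists M => t; exact: fM.
  exact: (measurableT_comp mf (measurable_pair1 x)).
have bx t : sqbox d n t -> bmeas1 L (f ^~ t).
  move=> tb; split; last by exists M => x xL; exact: fM.
  exact: (measurableT_comp mf (measurable_pair2 t)).
have := Fubini iT.
rewrite {1}/int1 {2}/tbint /Rintegral => e; congr fine.
transitivity (\int[leb]_x \int[lebesgue_tuple R n]_y
  ((EFin \o (fun p => f p.1 p.2)) \_ ((seg L) `*` sqbox d n)) (x, y))%E.
  rewrite integral_mkcond; apply: eq_integral => x _.
  rewrite /patch; case: ifPn => [xd|xd].
    rewrite inE/= in_itv/= in xd; rewrite -tbint_ereal; last exact: bt.
    rewrite integral_mkcond; apply: eq_integral => t _.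
    rewrite /patch; congr (if _ then _ else _).
    by apply/idP/idP; rewrite !inE /= in_itv/=; [split|case].
  rewrite integral0_eq// => t _; case: ifPn => //; rewrite inE/= => -[xd' _].
  by case/negP : xd; rewrite inE.
rewrite e [RHS]integral_mkcond; apply: eq_integral => t _.
rewrite [RHS]/patch; case: ifPn => [td|td].
  rewrite inE/= in td; rewrite /int1 /Rintegral fineK; last first.
    by apply: integrable_fin_num => //; apply: bmeas1_integrable; exact: bx.
  rewrite [RHS]integral_mkcond; apply: eq_integral => x _.
  rewrite /patch; congr (if _ then _ else _).
  by apply/idP/idP; rewrite !inE /=; [case|split].
rewrite integral0_eq// => x _; rewrite /patch; case: ifPn => //; rewrite inE/= => -[_ td'].
by case/negP : td; rewrite inE.
Qed.

Lemma norm_sum_le n (F : 'I_n -> R) (B : R) : (forall j, `|F j| <= B) ->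
  `|\sum_(j < n) F j| <= n%:R * B.
Proof.
move=> FB; apply: (le_trans (ler_norm_sum _ _ _)).
rewrite mulr_natl -[n in B *+ n]card_ord -sumr_const.
by apply: ler_sum => j _.
Qed.

Lemma continuous_cos_affine (y h : R) : continuous (fun x : R => cos (x * y + h)).
Proof.
move=> x; apply: (@continuous_comp _ _ _ (fun x : R => x * y + h) (@cos R)); last exact: continuous_cos.
by apply: cvgD; [apply: cvgM; [exact: cvg_id|exact: cvg_cst]|exact: cvg_cst].
Qed.

Lemma measurable_sum1 n (u : R -> R) : measurable_fun setT u ->
  measurable_fun setT (fun t : Rn n => \sum_(j < n) u (tnth t j)).
Proof.
move=> mu0; rewrite (_ : (fun _ => _) = fun t : Rn n => \sum_(j <- enum 'I_n) u (tnth t j)).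
  apply: (@measurable_sum _ _ _ _ _ _ (fun j (t : Rn n) => u (tnth t j))) => j.
  by apply: (measurableT_comp mu0); exact: measurable_tnthR.
by apply/funext => t; rewrite big_enum.
Qed.

(** The double integral over [xi] and [t] is computed in both orders. For fixed [xi] it is an [n]-th
    power by [tbint_prod_cos], as oddness of the phase kills the sine integrals. For fixed [t] it is
    the truncated transform at [c] times the sum, and replacing this by a Gaussian costs the
    subtracted term, because the sum is at most [n d]. *)
Lemma main_term_ge d L A c n (eta : R -> R) : 0 < L -> 0 <= A -> 0 <= c -> 0 <= d ->
  continuous eta -> (forall x, eta (- x) = - eta x) ->
  int1 L (fun xi => gauss 2^-1 xi *
     (int1 d (fun x => gauss A x * cos (eta x + xi * (c * x)))) ^+ n)
   - 2 * (c * (n%:R * d)) * gauss 2^-1 L * (int1 d (gauss A)) ^+ n <=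
  trunc_fourier L 0 * tbint d (fun t : Rn n => (\prod_(j < n) gauss A (tnth t j)) *
     (gauss 2^-1 (c * \sum_(j < n) tnth t j) * cos (\sum_(j < n) eta (tnth t j)))).
Proof.
move=> L0 A0 c0 d0 ceta etaN.
pose W (t : Rn n) := \prod_(j < n) gauss A (tnth t j).
pose S (t : Rn n) := \sum_(j < n) tnth t j.
pose H (t : Rn n) := \sum_(j < n) eta (tnth t j).
have W0 t : 0 <= W t by apply: prodr_ge0 => j _; exact: gauss_ge0.
have W1 t : W t <= 1.
  apply: prodr_ile1 => j _; rewrite gauss_ge0/=; exact: gauss_le1.
have bg : bmeas1 d (gauss A) by apply: bmeas1_cont; exact: continuous_gauss.
have bW : bmeas d W by exact: bmeas_prod1.
have bS : bmeas d S.
  by apply: (@bmeas_sum1 _ d n id); apply: bmeas1_cont => x; exact: cvg_id.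
have bH : bmeas d H by apply: bmeas_sum1; exact: bmeas1_cont.
pose f (xi : measurableTypeR R) (t : Rn n) : R :=
   W t * (gauss 2^-1 xi * cos (xi * (c * S t) + H t)).
have mW : measurable_fun setT W by case: bW.
have mS : measurable_fun setT S by case: bS.
have mH : measurable_fun setT H by case: bH.
have mfst : measurable_fun setT (fun p : measurableTypeR R * Rn n => p.1 : R).
  exact: measurable_fst.
have mf : measurable_fun setT (fun p : measurableTypeR R * Rn n => f p.1 p.2).
  rewrite /f; apply: measurable_funM.
    exact: (measurableT_comp mW measurable_snd).
  apply: measurable_funM.
    exact: (measurableT_comp (continuous_measurable_fun (@continuous_gauss R 2^-1)) mfst).
  apply: (measurableT_comp (continuous_measurable_fun (@continuous_cos R))).
  apply: measurable_funD; last exact: (measurableT_comp mH measurable_snd).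
  apply: measurable_funM; first exact: mfst.
  apply: measurable_funM; first exact: measurable_cst.
  exact: (measurableT_comp mS measurable_snd).
have fM x t : - L <= x <= L -> sqbox d n t -> `|f x t| <= 1.
  move=> _ _; rewrite /f !normrM (ger0_norm (W0 t)) (ger0_norm (gauss_ge0 _ _)).
  have g1 : gauss 2^-1 x <= 1 by apply: gauss_le1; rewrite invr_ge0.
  rewrite -[leRHS]mulr1; apply: ler_pM; rewrite ?mulr_ge0 ?gauss_ge0//.
  by rewrite -[leRHS]mulr1; apply: ler_pM; rewrite ?gauss_ge0// cos_max.
have FE := int1_tbint mf fM.
have bFf : bmeas d (fun t : Rn n => W t * (cos (H t) * trunc_fourier L (c * S t))).
  apply: bmeasM => //; apply: bmeasM; first exact: (bmeas_comp (@continuous_cos R)).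
  apply: bmeas_comp; last by apply: bmeasM => //; exact: bmeas_cst.
  exact: is_derive_continuous (fun y => is_derive_trunc_fourier y L0).
have E1 : int1 L (fun xi => gauss 2^-1 xi *
     (int1 d (fun x => gauss A x * cos (eta x + xi * (c * x)))) ^+ n) =
   tbint d (fun t : Rn n => W t * (cos (H t) * trunc_fourier L (c * S t))).
  transitivity (int1 L (fun x => tbint d (f x))).
    apply: int1_eq => xi _.
    have cu : continuous (fun x => eta x + xi * (c * x)).
      move=> x; apply: cvgD; first exact: ceta.
      apply: cvgM; first exact: cvg_cst.
      by apply: cvgM; [exact: cvg_cst|exact: cvg_id].
    rewrite -(@tbint_prod_cos _ d _ bg n (fun x => eta x + xi * (c * x))); first last.
    - apply: int1_odd => x.
        apply: cvgM; first exact: continuous_gauss.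
        by apply: (continuous_comp (cu x)); exact: continuous_sin.
      by rewrite gaussN etaN !mulrN -opprD sinN mulrN.
    - exact: continuous_measurable_fun.
    rewrite -tbintZ; last first.
      apply: bmeasM => //; apply: (bmeas_comp (@continuous_cos R)).
      by apply: (@bmeas_sum1 _ d n (fun x => eta x + xi * (c * x))); exact: bmeas1_cont.
    apply: tbint_eq => t _; rewrite /f mulrCA; congr (_ * (_ * cos _)).
    by rewrite big_split/= -!mulr_sumr addrC.
  rewrite FE; apply: tbint_eq => t _.
  rewrite /f int1Z; last first.
    apply: bmeas1_cont => x; apply: cvgM; first exact: continuous_gauss.
    exact: continuous_cos_affine.
  by rewrite trunc_fourier_cos.
have bG : bmeas d (fun t : Rn n => gauss 2^-1 (c * S t) * cos (H t)).
  apply: bmeasM; last exact: (bmeas_comp (@continuous_cos R)).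
  apply: (bmeas_comp (@continuous_gauss R 2^-1)).
  by apply: bmeasM => //; exact: bmeas_cst.
rewrite E1 -(tbint_prod n bg) -!tbintZ//; last exact: bmeasM.
rewrite -tbintB//; last by apply: bmeasM => //; exact: bmeas_cst.
apply: tbint_le.
- by apply: bmeasB => //; apply: bmeasM => //; exact: bmeas_cst.
- by apply: bmeasM; [exact: bmeas_cst|exact: bmeasM].
move=> t tb; rewrite -/(W t) -/(S t) -/(H t).
have Sb : `|c * S t| <= c * (n%:R * d).
  rewrite normrM ger0_norm// ler_wpM2l//; apply: norm_sum_le => j.
  by rewrite ler_norml tb.
have h := trunc_fourier_approx (c * S t) L0.
have gL := gauss_ge0 2^-1 L.
have h2 : cos (H t) * trunc_fourier L (c * S t) <=
   trunc_fourier L 0 * gauss 2^-1 (c * S t) * cos (H t) + 2 * (c * (n%:R * d)) * gauss 2^-1 L.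
  rewrite mulrC -lerBlDl -mulrBl.
  rewrite (le_trans (ler_norm _))// normrM.
  rewrite -[leRHS]mulr1 ler_pM ?cos_max//.
  apply: (le_trans h); rewrite ler_wpM2r// ler_wpM2l//.
have := ler_wpM2l (W0 t) h2.
move=> h3; rewrite lerBlDr; apply: (le_trans h3).
by rewrite le_eqVlt; apply/orP; left; apply/eqP; ring.
Qed.

End main_term.

(** * Taylor bounds with explicit remainders *)

Section taylor.
Context (R : realType).
Implicit Types (x y : R).

(** The trigonometric bounds below form a chain: each difference has a derivative whose sign is
    given by an earlier bound. The top coefficients in [sin_le5] and [vers_le6] are larger than
    those of Taylor, which leaves slack. *)
Lemma ge0_of_derive (F f : R -> R) : (forall x, is_derive x 1 F (f x)) ->
  0 <= F 0 -> (forall x, 0 <= x -> 0 <= f x) -> forall x, 0 <= x -> 0 <= F x.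
Proof.
move=> dF F0 f0 x; rewrite le_eqVlt => /predU1P[<-//|x0].
have cF : {within `[0, x], continuous F}.
  by apply: continuous_subspaceT; exact: is_derive_continuous dF.
have [c] := MVT x0 (fun x _ => dF x) cF.
rewrite in_itv/= subr0 => /andP[c0 cx] e.
have : 0 <= f c * x by rewrite mulr_ge0 ?f0// ltW.
by rewrite -e; lra.
Qed.

Lemma sin_le x : 0 <= x -> sin x <= x.
Proof.
have d y : is_derive y 1 (fun z : R => z - sin z) (1 - cos y).
  by apply: is_derive_eq; rewrite /GRing.scale /=; field.
move=> x0; have := ge0_of_derive d _ _ x0; rewrite sin0 subrr lexx => /(_ isT).
by rewrite subr_ge0; apply => y _; rewrite subr_ge0 cos_le1.
Qed.

Lemma vers_le x : 1 - cos x <= x ^+ 2 / 2.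
Proof.
wlog x0 : x / 0 <= x => [hw|].
  have [/hw//|/ltW x0] := leP 0 x.
  by rewrite -cosN -sqrrN; apply: hw; rewrite oppr_ge0.
have d y : is_derive y 1 (fun z : R => z ^+ 2 / 2 - (1 - cos z)) (y - sin y).
  by apply: is_derive_eq; rewrite /GRing.scale /=; field.
have := ge0_of_derive d _ _ x0.
rewrite cos0 expr0n mul0r subrr subr0 lexx => /(_ isT).
by rewrite subr_ge0; apply => y y0; rewrite subr_ge0 sin_le.
Qed.

Lemma sin_ge x : 0 <= x -> x - x ^+ 3 / 6 <= sin x.
Proof.
have d y : is_derive y 1 (fun z : R => sin z - (z - z ^+ 3 / 6)) (cos y - (1 - y ^+ 2 / 2)).
  by apply: is_derive_eq; rewrite /GRing.scale /=; field.
move=> x0; have := ge0_of_derive d _ _ x0.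
rewrite sin0 expr0n mul0r !subr0 lexx => /(_ isT).
rewrite subr_ge0; apply => y _; have := vers_le y; lra.
Qed.

Lemma vers_ge x : x ^+ 2 / 2 - x ^+ 4 / 24 <= 1 - cos x.
Proof.
wlog x0 : x / 0 <= x => [hw|].
  have [/hw//|/ltW x0] := leP 0 x.
  have := hw (- x); rewrite cosN sqrrN (_ : (- x) ^+ 4 = x ^+ 4); last by ring.
  by apply; rewrite oppr_ge0.
have d y : is_derive y 1 (fun z : R => (1 - cos z) - (z ^+ 2 / 2 - z ^+ 4 / 24))
    (sin y - (y - y ^+ 3 / 6)).
  by apply: is_derive_eq; rewrite /GRing.scale /=; field.
have := ge0_of_derive d _ _ x0.
rewrite cos0 !expr0n !mul0r !subr0 subrr lexx => /(_ isT).
by rewrite subr_ge0; apply => y y0; rewrite subr_ge0 sin_ge.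
Qed.

Lemma sin_le5 x : 0 <= x -> sin x <= x - x ^+ 3 / 6 + x ^+ 5 / 24.
Proof.
have d y : is_derive y 1 (fun z : R => (z - z ^+ 3 / 6 + z ^+ 5 / 24) - sin z)
    ((1 - y ^+ 2 / 2 + 5 * y ^+ 4 / 24) - cos y).
  by apply: is_derive_eq; rewrite /GRing.scale /=; field.
move=> x0; have := ge0_of_derive d _ _ x0.
rewrite sin0 !expr0n !mul0r !subr0 addr0 lexx => /(_ isT).
rewrite subr_ge0; apply => y _; have := vers_ge y.
have : 0 <= y ^+ 4 by rewrite exprn_even_ge0.
lra.
Qed.

Lemma vers_le6 x : 1 - cos x <= x ^+ 2 / 2 - x ^+ 4 / 24 + x ^+ 6 / 24.
Proof.
wlog x0 : x / 0 <= x => [hw|].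
  have [/hw//|/ltW x0] := leP 0 x.
  have := hw (- x); rewrite cosN sqrrN (_ : (- x) ^+ 4 = x ^+ 4); last by ring.
  rewrite (_ : (- x) ^+ 6 = x ^+ 6); last by ring.
  by apply; rewrite oppr_ge0.
have d y : is_derive y 1 (fun z : R => (z ^+ 2 / 2 - z ^+ 4 / 24 + z ^+ 6 / 24) - (1 - cos z))
    ((y - y ^+ 3 / 6 + y ^+ 5 / 4) - sin y).
  by apply: is_derive_eq; rewrite /GRing.scale /=; field.
have := ge0_of_derive d _ _ x0.
rewrite cos0 !expr0n /= !mul0r !(subrr, subr0, addr0) lexx => /(_ isT).
rewrite subr_ge0; apply => y y0; have := sin_le5 y0.
have : 0 <= y ^+ 5 by rewrite exprn_ge0.
lra.
Qed.

Lemma ln1D_bounds y : 0 <= y ->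
  y - y ^+ 2 / 2 <= ln (1 + y) <= y - y ^+ 2 / 2 + y ^+ 3 / 3.
Proof.
move=> y0.
have cl (z : R) : 0 <= z -> is_derive z 1 (fun z : R => ln (1 + z)) ((1 + z)^-1).
  move=> z0; have z1 : 0 < 1 + z by lra.
  have dl := is_derive1_ln z1.
  have dz : is_derive z 1 (fun z : R => 1 + z) 1.
    exact: (is_derive_eq (is_deriveD (is_derive_cst (1 : R) z (1 : R)) (is_derive_id z (1 : R))) (add0r _)).
  by have := is_derive1_comp dl dz; rewrite mulr1.
move: y0; rewrite le_eqVlt => /predU1P[<-|y0].
  by rewrite !expr0n !mul0r subr0 !addr0 ln1 lexx.
(* [ge0_of_derive] asks for a derivative on the whole line, which [ln (1 + z)] does not have; this
   version works on [[0, y]]. *)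
have aux (F f : R -> R) : (forall z : R, 0 <= z -> is_derive z 1 F (f z)) -> F 0 = 0 ->
    (forall z : R, 0 <= z -> 0 <= f z) -> 0 <= F y.
  move=> dF F0 f0.
  have cF : {within `[0, y], continuous F}.
    apply: derivable_within_continuous => z; rewrite in_itv/= => /andP[z0 _].
    exact: (@ex_derive _ _ _ _ _ _ _ (dF z z0)).
  have dF' x : x \in `]0, y[ -> is_derive x 1 F (f x).
    by rewrite in_itv/= => /andP[/ltW x0 _]; exact: dF.
  have [c] := MVT y0 dF' cF.
  rewrite in_itv/= F0 !subr0 => /andP[c0 cy] ->.
  by rewrite mulr_ge0 ?f0// ltW.
apply/andP; split.
  have := aux (fun z => ln (1 + z) - (z - z ^+ 2 / 2)) (fun z => (1 + z)^-1 - (1 - z)).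
  rewrite subr_ge0; apply.
  - move=> z z0; have := cl z z0 => ?.
    apply: is_derive_eq; rewrite /GRing.scale /=; field.
  by rewrite gt_eqF//; lra.
  - by rewrite addr0 ln1 expr0n mul0r !subrr.
  - move=> z z0; rewrite subr_ge0 -[(1 + z)^-1]mul1r ler_pdivlMr; last by lra.
    nra.
have := aux (fun z => (z - z ^+ 2 / 2 + z ^+ 3 / 3) - ln (1 + z))
            (fun z => (1 - z + z ^+ 2) - (1 + z)^-1).
rewrite subr_ge0; apply.
- move=> z z0; have := cl z z0 => ?.
  apply: is_derive_eq; rewrite /GRing.scale /=; field.
  by rewrite gt_eqF//; lra.
- by rewrite addr0 ln1 !expr0n !mul0r !subr0 addr0.
- move=> z z0; rewrite subr_ge0 -[(1 + z)^-1]mul1r ler_pdivrMr; last by lra.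
  have : 0 <= z ^+ 3 by rewrite exprn_ge0.
  by move=> h; rewrite [leRHS](_ : _ = 1 + z ^+ 3); [lra|ring].
Qed.

End taylor.

(** * Modulus and phase of a pair factor *)

Section pair_factor.
Context (R : realType).
Implicit Types (x y k lam : R).

Definition vers x : R := 1 - cos x.
(** The variance of the geometric law of mean [lam]. It enters through [|1 - lam (e^(i x) - 1)|^2 =
    1 + 2 kappa vers x]. *)
Definition kappa lam : R := lam * (1 + lam).

(* [- ln |f|] and [arg f], with [f x = e^(-i lam x) / (1 - lam (e^(i x) - 1))]
   the characteristic function of the centred geometric law of mean [lam]. *)
Definition logmod k x : R := ln (1 + 2 * k * vers x) / 2.
Definition phase lam x : R := atan (lam * sin x / (1 + lam * vers x)) - lam * x.

Lemma vers_ge0 x : 0 <= vers x.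
Proof. by rewrite subr_ge0 cos_le1. Qed.

Lemma versN x : vers (- x) = vers x. Proof. by rewrite /vers cosN. Qed.

Lemma kappa_ge0 lam : 0 <= lam -> 0 <= kappa lam.
Proof. by move=> l0; rewrite mulr_ge0// addr_ge0. Qed.

Lemma logmod_arg_ge1 k x : 0 <= k -> 1 <= 1 + 2 * k * vers x.
Proof. by move=> k0; rewrite lerDl !mulr_ge0// vers_ge0. Qed.

Lemma logmod_ge0 k x : 0 <= k -> 0 <= logmod k x.
Proof. by move=> k0; rewrite divr_ge0// ln_ge0// logmod_arg_ge1. Qed.

Lemma cexpiD x y : cexpi R (x + y) = cexpi R x * cexpi R y.
Proof. by rewrite /cexpi cosD sinD; apply/eqP; rewrite eq_complex /= eqxx/= addrC. Qed.

Lemma cexpi0 : cexpi R 0 = 1.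
Proof. by rewrite /cexpi cos0 sin0. Qed.

Lemma cexpiN x : cexpi R (- x) = (cexpi R x)^-1.
Proof.
have e : cexpi R (- x) * cexpi R x = 1 by rewrite -cexpiD addNr cexpi0.
have u : cexpi R x != 0.
  by apply: contra_eq_neq e => ->; rewrite mulr0 eq_sym oner_neq0.
by apply: (mulIf u); rewrite e mulVf.
Qed.

Lemma cexpi_sum (I : Type) (r : seq I) (P : pred I) (F : I -> R) :
  cexpi R (\sum_(i <- r | P i) F i) = \prod_(i <- r | P i) cexpi R (F i).
Proof. by elim/big_rec2: _ => [|i a b _ <-]; rewrite ?cexpi0// cexpiD. Qed.

(** Polar form of the reciprocal of [D - i s]. Since [D > 0], the argument is the principal value
    [atan (s / D)]; its linear part [lam * x] is kept apart so that it can cancel against the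
    denominator of the integrand. *)
Lemma pair_factorE lam x : 0 <= lam ->
  (1 - lam%:C * (cexpi R x - 1))^-1 =
  (expR (- logmod (kappa lam) x))%:C * cexpi R (phase lam x + lam * x).
Proof.
move=> l0; set k := kappa lam.
have V0 := vers_ge0 x.
have k0 : 0 <= k by exact: kappa_ge0.
pose D := 1 + lam * vers x; pose s := lam * sin x; pose t := s / D.
have D0 : 0 < D by rewrite /D; nra.
have N0 : 0 < 1 + t ^+ 2 by have := sqr_ge0 t; lra.
have DN : D ^+ 2 * (1 + t ^+ 2) = 1 + 2 * k * vers x.
  have -> : D ^+ 2 * (1 + t ^+ 2) = D ^+ 2 + s ^+ 2 by rewrite /t; field; rewrite gt_eqF.
  rewrite /s exprMn sin2cos2 /D /vers /k /kappa; ring.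
have eL : expR (- logmod k x) = (D * Num.sqrt (1 + t ^+ 2))^-1.
  have q0 : 0 < 1 + 2 * k * vers x by have := logmod_arg_ge1 x k0; lra.
  have : (expR (- logmod k x)) ^+ 2 = ((D * Num.sqrt (1 + t ^+ 2))^-1) ^+ 2.
    rewrite -expRM_natl exprVn exprMn sqr_sqrtr ?(ltW N0)// DN.
    rewrite /logmod (_ : 2 * - (ln (1 + 2 * k * vers x) / 2) = - ln (1 + 2 * k * vers x)).
      by rewrite expRN lnK.
    by field.
  move/eqP; rewrite eqrXn2 ?expR_ge0 ?invr_ge0 ?mulr_ge0 ?sqrtr_ge0 ?(ltW D0)//.
  by move/eqP.
have ca : cos (atan t) = (Num.sqrt (1 + t ^+ 2))^-1 by rewrite cos_atan.
have c0 : cos (atan t) != 0 by rewrite ca invr_eq0 gt_eqF// sqrtr_gt0.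
have sa : sin (atan t) = t * cos (atan t).
  by rewrite -[t in t * _]atanK /tan -mulrA mulVf ?mulr1.
rewrite /phase subrK -/D -/s -/t eL.
set q := Num.sqrt (1 + t ^+ 2) in ca *.
have q0 : 0 < q by rewrite sqrtr_gt0.
have qq : q ^+ 2 = 1 + t ^+ 2 by rewrite sqr_sqrtr// ltW.
have E : 1 - lam%:C * (cexpi R x - 1) = (D +i* - s)%C.
  rewrite /cexpi /D /s /vers; apply/eqP; rewrite eq_complex /=.
  by apply/andP; split; apply/eqP; ring.
rewrite E.
have P1 : (D +i* - s)%C * (((D * q)^-1)%:C * cexpi R (atan t)) = 1.
  have Dn : D != 0 by rewrite gt_eqF.
  have qn : q != 0 by rewrite gt_eqF.
  have sDt : s = t * D by rewrite /t divfK.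
  rewrite /cexpi sa ca; apply/eqP; rewrite eq_complex /=; apply/andP; split; apply/eqP.
    transitivity ((1 + t ^+ 2) / q ^+ 2); last by rewrite qq divff// gt_eqF.
    by rewrite sDt; field; rewrite Dn qn.
  by rewrite sDt; field; rewrite Dn qn.
have u : (D +i* - s)%C != 0.
  by apply: contra_eq_neq P1 => ->; rewrite mul0r eq_sym oner_neq0.
by apply: (mulfI u); rewrite P1 divff.
Qed.

(** Insert the expansion of [vers] into that of the logarithm. The coefficients [k] and [k + 6 k^2]
    are the second and fourth cumulants of the geometric law; in [phase_cubic] the third one,
    [k (1 + 2 lam)], appears. *)
Lemma logmod_quartic k x : 0 <= k ->
  `|k * x ^+ 2 / 2 - logmod k x - (k + 6 * k ^+ 2) * x ^+ 4 / 24| <=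
  (k + k ^+ 2 + k ^+ 3) * x ^+ 6.
Proof.
move=> k0; have V0 := vers_ge0 x.
have V1 : vers x <= x ^+ 2 / 2 := vers_le x.
have V2 : x ^+ 2 / 2 - x ^+ 4 / 24 <= vers x := vers_ge x.
have V3 : vers x <= x ^+ 2 / 2 - x ^+ 4 / 24 + x ^+ 6 / 24 := vers_le6 x.
have y0 : 0 <= 2 * k * vers x by rewrite !mulr_ge0.
have /andP[L1 L2] := ln1D_bounds y0.
set V := vers x in V0 V1 V2 V3 y0 L1 L2 *.
rewrite /logmod -/V; set l := ln _ in L1 L2 *.
have x2 : 0 <= x ^+ 2 by exact: sqr_ge0.
have X6 : 0 <= x ^+ 6 by rewrite exprn_even_ge0.
have X4 : 0 <= x ^+ 4 by rewrite exprn_even_ge0.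
have V3' : V ^+ 3 <= x ^+ 6 / 8.
  rewrite (_ : x ^+ 6 / 8 = (x ^+ 2 / 2) ^+ 3); last by field.
  by rewrite lerXn2r// nnegrE; lra.
have Vsq1 : V ^+ 2 <= x ^+ 4 / 4.
  rewrite (_ : x ^+ 4 / 4 = (x ^+ 2 / 2) ^+ 2); last by field.
  by rewrite lerXn2r// nnegrE; lra.
have Vsq2 : x ^+ 4 / 4 - V ^+ 2 <= x ^+ 6 / 24.
  have -> : x ^+ 4 / 4 - V ^+ 2 = (x ^+ 2 / 2 - V) * (x ^+ 2 / 2 + V) by field.
  have -> : x ^+ 6 / 24 = x ^+ 4 / 24 * x ^+ 2 by field.
  by apply: ler_pM; lra.
have k2 : 0 <= k ^+ 2 by exact: sqr_ge0.
have k3 : 0 <= k ^+ 3 by rewrite exprn_ge0.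
have l1 : 2 * (k * V) - 2 * (k ^+ 2 * V ^+ 2) <= l.
  by move: L1; rewrite (_ : (2 * k * V) ^+ 2 = 4 * (k ^+ 2 * V ^+ 2)); [lra|ring].
have l2 : l <= 2 * (k * V) - 2 * (k ^+ 2 * V ^+ 2) + 8 / 3 * (k ^+ 3 * V ^+ 3).
  move: L2; rewrite (_ : (2 * k * V) ^+ 2 = 4 * (k ^+ 2 * V ^+ 2)); last by ring.
  by rewrite (_ : (2 * k * V) ^+ 3 = 8 * (k ^+ 3 * V ^+ 3)); [lra|ring].
have a1 := ler_wpM2l k0 V2.
have a2 := ler_wpM2l k0 V3.
have a3 := ler_wpM2l k2 Vsq1.
have a4 := ler_wpM2l k2 Vsq2.
have a5 := ler_wpM2l k3 V3'.
have b1 := mulr_ge0 k0 X6.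
have b2 := mulr_ge0 k2 X6.
have b3 := mulr_ge0 k3 X6.
rewrite ler_norml; apply/andP; split; lra.
Qed.

Lemma phaseN lam x : phase lam (- x) = - phase lam x.
Proof.
rewrite /phase sinN versN mulrN mulNr atanN mulrN; ring.
Qed.

(** Subtracting [lam * x] leaves a derivative proportional to [vers x], hence a phase that is cubic
    at 0. *)
Lemma is_derive_phase lam x : 0 <= lam ->
  is_derive x 1 (phase lam)
   (- (kappa lam * (1 + 2 * lam) * vers x / (1 + 2 * kappa lam * vers x))).
Proof.
move=> l0; have V0 := vers_ge0 x.
have k0 := kappa_ge0 l0.
pose D (y : R) := 1 + lam * vers y; pose s (y : R) := lam * sin y.
have D0 : 0 < D x by rewrite /D; nra.
have Dn : D x != 0 by rewrite gt_eqF.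
have dD : is_derive x 1 D (lam * sin x).
  by rewrite /D /vers; apply: is_derive_eq; rewrite /GRing.scale /=; ring.
have ds : is_derive x 1 s (lam * cos x).
  by rewrite /s; apply: is_derive_eq; rewrite /GRing.scale /=; ring.
have dt : is_derive x 1 (fun y => s y / D y)
    ((lam * cos x * D x - s x * (lam * sin x)) / D x ^+ 2).
  have := is_deriveM ds (is_deriveV Dn dD).
  move/is_derive_eq; apply; rewrite /GRing.scale /=; field.
  by rewrite Dn.
have da := @is_derive1_comp R (@atan R) (fun y => s y / D y) x _ _ (is_derive1_atan (s x / D x)) dt.
have dl : is_derive x 1 (fun y : R => lam * y) lam.
  by apply: is_derive_eq; rewrite /GRing.scale /= mulr1.
apply: (is_derive_eq (is_deriveB da dl)).
have N0 : 1 + (s x / D x) ^+ 2 != 0.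
  by rewrite gt_eqF//; have := sqr_ge0 (s x / D x); lra.
have Q0 : 1 + 2 * kappa lam * vers x != 0.
  by rewrite gt_eqF//; have := logmod_arg_ge1 x k0; lra.
have DN : D x ^+ 2 + s x ^+ 2 = 1 + 2 * kappa lam * vers x.
  rewrite /s exprMn sin2cos2 /D /vers /kappa; ring.
have -> : (1 + (s x / D x) ^+ 2)^-1 = D x ^+ 2 / (D x ^+ 2 + s x ^+ 2).
  have -> : 1 + (s x / D x) ^+ 2 = (D x ^+ 2 + s x ^+ 2) / D x ^+ 2 by field.
  by rewrite invf_div.
rewrite DN.
have -> : D x ^+ 2 / (1 + 2 * kappa lam * vers x) *
   ((lam * cos x * D x - s x * (lam * sin x)) / D x ^+ 2) =
   (lam * cos x * D x - lam ^+ 2 * sin x ^+ 2) / (1 + 2 * kappa lam * vers x).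
  by rewrite /s; field; rewrite Q0 Dn.
apply: (mulIf Q0); rewrite mulrBl mulNr !divfK//.
rewrite sin2cos2 /D /kappa /vers; ring.
Qed.

Lemma phase0 lam : phase lam 0 = 0.
Proof. by rewrite /phase sin0 !mulr0 mul0r atan0 subr0. Qed.

Lemma phase_cubic lam x : 0 <= lam ->
  `|phase lam x + kappa lam * (1 + 2 * lam) * x ^+ 3 / 6| <=
  kappa lam * (1 + 2 * lam) * (1 + kappa lam) * `|x| ^+ 5.
Proof.
move=> l0; wlog x0 : x / 0 <= x => [hw|].
  have [/hw//|/ltW x0] := leP 0 x.
  have := hw (- x); rewrite phaseN normrN oppr_ge0 => /(_ x0).
  rewrite (_ : - phase lam x + _ = - (phase lam x + kappa lam * (1 + 2 * lam) * x ^+ 3 / 6)).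
    by rewrite normrN.
  by field.
rewrite (ger0_norm x0).
have k0 := kappa_ge0 l0.
set k := kappa lam in k0 *; set c := k * (1 + 2 * lam).
have c0 : 0 <= c by rewrite /c mulr_ge0//; lra.
(* [- g] is the derivative of the phase; the two-sided bound [gb] is integrated below. *)
pose g (y : R) := c * vers y / (1 + 2 * k * vers y).
have gb (y : R) : c * (y ^+ 2 / 2 - y ^+ 4 / 24 - k * y ^+ 4 / 2) <= g y <= c * (y ^+ 2 / 2).
  have V0 := vers_ge0 y.
  have V1 : vers y <= y ^+ 2 / 2 := vers_le y.
  have V2 : y ^+ 2 / 2 - y ^+ 4 / 24 <= vers y := vers_ge y.
  have Q0 : 0 < 1 + 2 * k * vers y by have := logmod_arg_ge1 y k0; lra.
  have h : vers y - 2 * k * vers y ^+ 2 <= vers y / (1 + 2 * k * vers y) <= vers y.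
    apply/andP; split.
      rewrite ler_pdivlMr//.
      have -> : (vers y - 2 * k * vers y ^+ 2) * (1 + 2 * k * vers y) =
        vers y - 4 * k ^+ 2 * vers y ^+ 3 by ring.
      have := sqr_ge0 k; have : 0 <= vers y ^+ 3 by rewrite exprn_ge0.
      by move=> h1 h2; have := mulr_ge0 h2 h1; lra.
    by rewrite ler_pdivrMr// ler_peMr// logmod_arg_ge1.
  have Vsq : vers y ^+ 2 <= y ^+ 4 / 4.
    rewrite (_ : y ^+ 4 / 4 = (y ^+ 2 / 2) ^+ 2); last by field.
    by rewrite lerXn2r// nnegrE//; have := sqr_ge0 y; lra.
  have a := ler_wpM2l k0 Vsq.
  have -> : g y = c * (vers y / (1 + 2 * k * vers y)) by rewrite /g mulrA.
  case/andP: h => h1 h2.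
  by apply/andP; split; apply: ler_wpM2l => //; lra.
have d1 (y : R) : is_derive y 1 (fun z : R => phase lam z + c * z ^+ 3 / 6) (c * (y ^+ 2 / 2) - g y).
  have dp := is_derive_phase y l0.
  by apply: is_derive_eq; rewrite /GRing.scale /= /g -/k -/c; field;
    rewrite gt_eqF//; have := logmod_arg_ge1 y k0; lra.
have F0 : phase lam 0 + c * 0 ^+ 3 / 6 = 0 by rewrite phase0 expr0n mulr0 mul0r addr0.
have h1 : 0 <= phase lam x + c * x ^+ 3 / 6.
  apply: (ge0_of_derive d1 _ _ x0); first by rewrite F0.
  by move=> y _; rewrite subr_ge0; have /andP[] := gb y.
rewrite ger0_norm// -subr_ge0.
have d2 (y : R) : is_derive y 1 (fun z : R => c * (1 + k) * z ^+ 5 - (phase lam z + c * z ^+ 3 / 6))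
   (5 * c * (1 + k) * y ^+ 4 - (c * (y ^+ 2 / 2) - g y)).
  by have := d1 y => ?; apply: is_derive_eq; rewrite /GRing.scale /=; field.
apply: (ge0_of_derive d2 _ _ x0).
  by rewrite F0 expr0n mulr0 subr0.
move=> y _; have /andP[h _] := gb y.
have ck : 0 <= c * k by exact: mulr_ge0.
have y4 : 0 <= y ^+ 4 by rewrite exprn_even_ge0.
have := mulr_ge0 ck y4; have := mulr_ge0 c0 y4; lra.
Qed.

End pair_factor.

(** * Pair sums and the polar form of the integrand *)

Section pairs.
Context (R : realType).
Local Notation Rn n := (n.-tuple (measurableTypeR R)).
Implicit Types (n : nat).

Definition pairsum n (G : 'I_n -> 'I_n -> R) : R :=
  \sum_(j < n) \sum_(k < n | (j < k)%N) G j k.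

Lemma pairsum_double n (G : 'I_n -> 'I_n -> R) : (forall j k, G j k = G k j) ->
  2 * pairsum G = \sum_(j < n) \sum_(k < n) G j k - \sum_(j < n) G j j.
Proof.
move=> GC.
have E : \sum_(j < n) \sum_(k < n) G j k =
    \sum_(j < n) (\sum_(k < n | (j < k)%N) G j k + \sum_(k < n | (k < j)%N) G j k + G j j).
  apply: eq_bigr => j _.
  rewrite (bigD1 j)//= addrC; congr (_ + _).
  rewrite (bigID (fun k : 'I_n => (j < k)%N))/=; congr (_ + _).
    apply: eq_bigl => k; rewrite andbC; case: ltnP => //= jk.
    by rewrite -val_eqE/= gtn_eqF.
  apply: eq_bigl => k; rewrite -leqNgt [RHS]ltn_neqAle -val_eqE/=.
  by [].
rewrite E big_split/= big_split/= addrK.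
have -> : \sum_(j < n) \sum_(k < n | (k < j)%N) G j k = pairsum G.
  rewrite (exchange_big_dep predT)//=.
  by apply: eq_bigr => k _; apply: eq_bigr => j _; exact: GC.
by rewrite /pairsum mulr_natl mulr2n.
Qed.

Lemma pairsum_eq n (G G' : 'I_n -> 'I_n -> R) : (forall j k, G j k = G' j k) ->
  pairsum G = pairsum G'.
Proof. by move=> GG; apply: eq_bigr => j _; apply: eq_bigr => k _. Qed.

Lemma pairsumD n (G G' : 'I_n -> 'I_n -> R) :
  pairsum (fun j k => G j k + G' j k) = pairsum G + pairsum G'.
Proof. by rewrite /pairsum -big_split/=; apply: eq_bigr => j _; rewrite big_split. Qed.

Lemma pairsumB n (G G' : 'I_n -> 'I_n -> R) :
  pairsum (fun j k => G j k - G' j k) = pairsum G - pairsum G'.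
Proof. by rewrite /pairsum -sumrB; apply: eq_bigr => j _; rewrite sumrB. Qed.

Lemma pairsumZ n (c : R) (G : 'I_n -> 'I_n -> R) :
  pairsum (fun j k => c * G j k) = c * pairsum G.
Proof. by rewrite /pairsum mulr_sumr; apply: eq_bigr => j _; rewrite mulr_sumr. Qed.

Lemma pairsum_le n (G G' : 'I_n -> 'I_n -> R) : (forall j k, G j k <= G' j k) ->
  pairsum G <= pairsum G'.
Proof. by move=> GG; apply: ler_sum => j _; apply: ler_sum => k _. Qed.

Lemma norm_pairsum_le n (G : 'I_n -> 'I_n -> R) (B : R) : 0 <= B ->
  (forall j k, `|G j k| <= B) -> `|pairsum G| <= n%:R ^+ 2 * B.
Proof.
move=> B0 GB; rewrite expr2 -mulrA; apply: norm_sum_le => j.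
rewrite big_mkcond; apply: norm_sum_le => k; case: ifP => // _.
by rewrite normr0.
Qed.

Lemma double_sum_prod n (f g : 'I_n -> R) :
  \sum_(j < n) \sum_(k < n) f j * g k = (\sum_(j < n) f j) * (\sum_(k < n) g k).
Proof. by rewrite mulr_suml; apply: eq_bigr => j _; rewrite mulr_sumr. Qed.

Lemma pairsum_lin n (g : 'I_n -> R) :
  pairsum (fun j k => g j + g k) = (n%:R - 1) * \sum_(j < n) g j.
Proof.
have := @pairsum_double n (fun j k => g j + g k) (fun j k => addrC _ _).
have -> : \sum_(j < n) \sum_(k < n) (g j + g k) = 2 * n%:R * \sum_(j < n) g j.
  under eq_bigr => j _ do rewrite big_split/= sumr_const card_ord -mulr_natl.
  by rewrite big_split/= -mulr_sumr sumr_const card_ord -[X in _ + X]mulr_natl; ring.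
rewrite big_split/=; lra.
Qed.

Section powers.
Variables (n : nat) (t : 'I_n -> R).
Let mu k := \sum_(j < n) t j ^+ k.

Lemma pairsum_sq : pairsum (fun j k => (t j + t k) ^+ 2) = (n%:R - 2) * mu 2 + mu 1 ^+ 2.
Proof.
have := @pairsum_double n (fun j k => (t j + t k) ^+ 2) (fun j k => congr1 (fun x => x ^+ 2) (addrC _ _)).
have -> : \sum_(j < n) \sum_(k < n) (t j + t k) ^+ 2 = 2 * n%:R * mu 2 + 2 * mu 1 ^+ 2.
  transitivity (\sum_(j < n) \sum_(k < n) (t j ^+ 2 * 1 + 1 * t k ^+ 2 + (2 * t j ^+ 1) * t k ^+ 1)).
    by apply: eq_bigr => j _; apply: eq_bigr => k _; ring.
  under eq_bigr do rewrite !big_split/=.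
  rewrite !big_split/= !double_sum_prod !sumr_const card_ord -mulr_sumr /mu; ring.
have -> : \sum_(j < n) (t j + t j) ^+ 2 = 4 * mu 2.
  by rewrite mulr_sumr; apply: eq_bigr => j _; ring.
lra.
Qed.

Lemma pairsum_cube :
  pairsum (fun j k => (t j + t k) ^+ 3) = (n%:R - 4) * mu 3 + 3 * mu 1 * mu 2.
Proof.
have := @pairsum_double n (fun j k => (t j + t k) ^+ 3) (fun j k => congr1 (fun x => x ^+ 3) (addrC _ _)).
have -> : \sum_(j < n) \sum_(k < n) (t j + t k) ^+ 3 = 2 * n%:R * mu 3 + 6 * mu 1 * mu 2.
  transitivity (\sum_(j < n) \sum_(k < n) (t j ^+ 3 * 1 + 1 * t k ^+ 3 +
     (3 * t j ^+ 2) * t k ^+ 1 + (3 * t j ^+ 1) * t k ^+ 2)).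
    by apply: eq_bigr => j _; apply: eq_bigr => k _; ring.
  under eq_bigr do rewrite !big_split/=.
  rewrite !big_split/= !double_sum_prod !sumr_const card_ord -!mulr_sumr /mu; ring.
have -> : \sum_(j < n) (t j + t j) ^+ 3 = 8 * mu 3.
  by rewrite mulr_sumr; apply: eq_bigr => j _; ring.
lra.
Qed.

Lemma pairsum_quartic : pairsum (fun j k => (t j + t k) ^+ 4) =
  (n%:R - 8) * mu 4 + 4 * mu 1 * mu 3 + 3 * mu 2 ^+ 2.
Proof.
have := @pairsum_double n (fun j k => (t j + t k) ^+ 4) (fun j k => congr1 (fun x => x ^+ 4) (addrC _ _)).
have -> : \sum_(j < n) \sum_(k < n) (t j + t k) ^+ 4 =
    2 * n%:R * mu 4 + 8 * mu 1 * mu 3 + 6 * mu 2 ^+ 2.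
  transitivity (\sum_(j < n) \sum_(k < n) (t j ^+ 4 * 1 + 1 * t k ^+ 4 +
     (4 * t j ^+ 3) * t k ^+ 1 + (6 * t j ^+ 2) * t k ^+ 2 + (4 * t j ^+ 1) * t k ^+ 3)).
    by apply: eq_bigr => j _; apply: eq_bigr => k _; ring.
  under eq_bigr do rewrite !big_split/=.
  rewrite !big_split/= !double_sum_prod !sumr_const card_ord -!mulr_sumr /mu; ring.
have -> : \sum_(j < n) (t j + t j) ^+ 4 = 16 * mu 4.
  by rewrite mulr_sumr; apply: eq_bigr => j _; ring.
lra.
Qed.
End powers.

Definition modsum k n (t : Rn n) : R :=
  pairsum (fun j i => logmod k (tnth t j + tnth t i)).
Definition phasesum lam n (t : Rn n) : R :=
  pairsum (fun j i => phase lam (tnth t j + tnth t i)).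

Lemma density_ge0 n l : (1 < n)%N -> 0 <= density R n l.
Proof. by move=> n1; rewrite divr_ge0// subr_ge0 ler1n ltnW. Qed.

(** As [l = lam (n - 1)] and every coordinate lies in [n - 1] pairs, the denominator distributes
    over the pairs as [e^(i lam (t_j + t_k))] and removes exactly the linear part of each
    argument. *)
Lemma integrandE n l (t : Rn n) : (1 < n)%N ->
  integrand R n l t = (expR (- modsum (kappa (density R n l)) t))%:C *
    cexpi R (phasesum (density R n l) t).
Proof.
move=> n1; have l0 := density_ge0 l n1.
rewrite /integrand; set lam := density R n l in l0 *.
have lE : l%:R * \sum_(j < n) tnth t j = pairsum (fun j k => lam * (tnth t j + tnth t k)).
  rewrite pairsumZ (@pairsum_lin n (fun j => tnth t j)) mulrA; congr (_ * _).
  by rewrite /lam /density divfK// subr_eq0 pnatr_eq1 gtn_eqF.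
rewrite lE.
under eq_bigr => j _ do under eq_bigr => k _ do rewrite pair_factorE//.
have -> : (expR (- modsum (kappa lam) t))%:C =
   \prod_(j < n) \prod_(k < n | (j < k)%N) (expR (- logmod (kappa lam) (tnth t j + tnth t k)))%:C :> R[i].
  rewrite /modsum /pairsum -sumrN expR_sum (rmorph_prod (real_complex R)).
  apply: eq_bigr => j _; rewrite -sumrN expR_sum (rmorph_prod (real_complex R)).
  by [].
rewrite -cexpiN.
under eq_bigr do rewrite big_split/=.
rewrite big_split/= -mulrA; congr (_ * _).
under eq_bigr do rewrite -cexpi_sum.
rewrite -cexpi_sum -cexpiD; congr cexpi.
rewrite /phasesum -/(pairsum (fun j k => phase lam (tnth t j + tnth t k) + lam * (tnth t j + tnth t k))).
by rewrite pairsumD addrK.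
Qed.

Lemma normc_integrand n l (t : Rn n) : (1 < n)%N ->
  ComplexField.Normc.normc (integrand R n l t) =
  expR (- modsum (kappa (density R n l)) t).
Proof.
move=> n1; rewrite integrandE// /cexpi /=.
set e := expR _; set p := phasesum _ _.
rewrite !mul0r subr0 addr0 !exprMn -mulrDr cos2Dsin2 mulr1 sqrtr_sqr ger0_norm//.
exact: expR_ge0.
Qed.

Lemma Re_integrand n l (t : Rn n) : (1 < n)%N ->
  complex.Re (integrand R n l t) =
  expR (- modsum (kappa (density R n l)) t) * cos (phasesum (density R n l) t).
Proof. by move=> n1; rewrite integrandE// /cexpi /= mul0r subr0. Qed.

End pairs.

(** * Elementary inequalities for the error terms *)

Section estimates.
Context (R : realType).
Local Notation Rn n := (n.-tuple (measurableTypeR R)).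
Implicit Types (n : nat) (x y : R).

Lemma norm_cos_sub x y : `|cos x - cos y| <= `|x - y|.
Proof.
wlog xy : x y / x <= y => [hw|].
  have [/hw//|/ltW yx] := leP x y.
  by rewrite distrC [leRHS]distrC hw.
move: xy; rewrite le_eqVlt => /predU1P[->|xy]; first by rewrite !subrr.
have cc : {within `[x, y], continuous (@cos R)}.
  by apply: continuous_subspaceT; exact: continuous_cos.
have [c _ e] := MVT xy (fun z _ => is_derive_cos z) cc.
rewrite distrC e normrM normrN distrC -[leRHS]mul1r.
by rewrite distrC ler_wpM2r// sin_max.
Qed.

(** Trades smallness for growth: with [1/s] the expected size of the error [y], it produces the
    factor [1/s] times an exponential of bounded order, which the exponential moments can
    integrate. *)
Lemma norm_expR_sub1 (s y : R) : 1 <= s -> `|expR y - 1| <= s^-1 * expR (s * `|y|).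
Proof.
move=> s1; have s0 : 0 < s by lra.
rewrite -ler_pdivrMl ?invr_gt0// invrK.
have [y0|y0] := leP 0 y.
  have e1 : 1 <= expR y by rewrite -expR0 ler_expR.
  rewrite ger0_norm ?subr_ge0// (ger0_norm y0).
  have h := expR_ge1Dx ((s - 1) * y).
  have -> : expR (s * y) = expR y * expR ((s - 1) * y).
    by rewrite -expRD; congr expR; ring.
  have h2 : expR y - 1 <= y * expR y.
    have := expR_ge1Dx (- y); rewrite expRN => h3.
    have := ler_wpM2r (expR_ge0 y) h3; rewrite mulVf ?gt_eqF ?expR_gt0//; lra.
  have h4 : expR y * (1 + (s - 1) * y) <= expR y * expR ((s - 1) * y).
    by rewrite ler_wpM2l// expR_ge0.
  apply: le_trans h4.
  have : (s - 1) * (expR y - 1) <= (s - 1) * (y * expR y) by rewrite ler_wpM2l//; lra.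
  lra.
have e1 : expR y <= 1 by rewrite expR_le1 ltW.
rewrite ler0_norm ?subr_le0// (ltr0_norm y0).
have h := expR_ge1Dx (s * - y).
have h2 := expR_ge1Dx y.
have : s * (- (expR y - 1)) <= s * - y by rewrite ler_wpM2l; lra.
lra.
Qed.

Lemma sqr_le_expR x : x ^+ 2 <= 2 * expR `|x|.
Proof.
have := @expR_ge1Dxn R `|x| 1 (normr_ge0 x).
rewrite (_ : 2`!%:R = 2 :> R)// real_normK ?num_real//; lra.
Qed.

Lemma expR1_le4 : expR 1 <= 4 :> R.
Proof.
have h : `|1 : R| <= 1 by rewrite normr1.
have := expR_le_quad h; lra.
Qed.

Lemma expR2_le16 : expR 2 <= 16 :> R.
Proof.
have -> : (2 : R) = 1 + 1 by ring.
rewrite expRD (_ : (16 : R) = 4 * 4); last by ring.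
by apply: ler_pM; rewrite ?expR_ge0// expR1_le4.
Qed.

Lemma continuous_vers : continuous (@vers R).
Proof. by move=> x; apply: cvgB; [exact: cvg_cst|exact: continuous_cos]. Qed.

Lemma continuous_logmod (k : R) : 0 <= k -> continuous (@logmod R k).
Proof.
move=> k0 x; apply: cvgM; last exact: cvg_cst.
apply: (@continuous_comp _ _ _ (fun x : R => 1 + 2 * k * vers x) (@ln R)).
  apply: cvgD; first exact: cvg_cst.
  by apply: cvgM; [exact: cvg_cst|exact: continuous_vers].
by apply: continuous_ln; have := logmod_arg_ge1 x k0; lra.
Qed.

Lemma continuous_phase (lam : R) : 0 <= lam -> continuous (@phase R lam).
Proof. by move=> l0; exact: is_derive_continuous (fun x => is_derive_phase x l0). Qed.

Lemma bmeas_pairsum (d : R) n (f : R -> R) : continuous f ->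
  bmeas d (fun t : Rn n => pairsum (fun j i => f (tnth t j + tnth t i))).
Proof.
move=> cf; rewrite /pairsum.
apply: (@bmeas_sum _ d n 'I_n _ _ (fun j t => \sum_(k < n | (j < k)%N) f (tnth t j + tnth t k))) => j.
apply: (@bmeas_sum _ d n 'I_n _ _ (fun k t => f (tnth t j + tnth t k))) => k.
by apply: (bmeas_comp cf); apply: bmeasD; exact: bmeas_tnth.
Qed.

Lemma expR_avg3 x y z : expR ((x + y + z) / 3) <= expR x + (expR y + expR z).
Proof.
have ex := expR_ge0 x; have ey := expR_ge0 y; have ez := expR_ge0 z.
have [yx|xy] := leP y x; have [zx|xz] := leP z x.
- by apply: (@le_trans _ _ (expR x)); [rewrite ler_expR; lra|lra].
- by apply: (@le_trans _ _ (expR z)); [rewrite ler_expR; lra|lra].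
- by apply: (@le_trans _ _ (expR y)); [rewrite ler_expR; lra|lra].
have [zy|yz] := leP z y.
- by apply: (@le_trans _ _ (expR y)); [rewrite ler_expR; lra|lra].
- by apply: (@le_trans _ _ (expR z)); [rewrite ler_expR; lra|lra].
Qed.

Lemma lipschitz_continuous (f : R -> R) (K : R) : (forall x y, `|f x - f y| <= K * `|x - y|) ->
  continuous f.
Proof.
move=> fK x; apply/cvgrPdist_le => /= e e0.
have K1 : 0 < `|K| + 1 by rewrite ltr_wpDl.
near=> y; apply: (le_trans (fK x y)).
apply: (@le_trans _ _ ((`|K| + 1) * `|x - y|)).
  apply: ler_wpM2r => //; have := ler_norm K; lra.
rewrite mulrC -ler_pdivlMr//; near: y.
have eK : 0 < e / (`|K| + 1) by rewrite divr_gt0.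
have /cvgrPdist_le/(_ _ eK) : y @[y --> x] --> x by exact: cvg_id.
by [].
Unshelve. all: end_near. Qed.

Lemma int1_ge_window (L a b c : R) (f : R -> R) : bmeas1 L f ->
  (forall x, - L <= x <= L -> 0 <= f x) -> - L <= a -> a <= b -> b <= L ->
  (forall x, a <= x <= b -> c <= f x) -> c * (b - a) <= int1 L f.
Proof.
move=> bf f0 La ab bL fc.
have sub : `[a, b]%classic `<=` `[- L, L]%classic.
  by move=> x /=; rewrite !in_itv/= => /andP[h1 h2]; apply/andP; split; lra.
have iL := bmeas1_integrable bf.
have iab : (@lebesgue_measure R).-integrable `[a, b] (EFin \o f).
  by apply: integrableS iL => //; exact: sub.
have ic : (@lebesgue_measure R).-integrable `[a, b] (EFin \o (fun=> c)).
  apply: continuous_compact_integrable; first exact: segment_compact.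
  by apply: continuous_subspaceT => x; exact: cvg_cst.
apply: (@le_trans _ _ (\int[lebesgue_measure]_(x in `[a, b]) f x)).
  have -> : c * (b - a) = \int[lebesgue_measure]_(x in `[a, b]) c.
    rewrite Rintegral_cst// /= lebesgue_measure_itv/= lte_fin.
    have [ab'|ba] := ltP a b; first by rewrite -EFinB.
    by rewrite (_ : b = a) ?subrr//; lra.
  apply: le_Rintegral => // x /=; rewrite in_itv/=; exact: fc.
rewrite /int1 /Rintegral; apply: fine_le.
- by apply: integrable_fin_num iab.
- by apply: integrable_fin_num iL.
- apply: ge0_subset_integral => //.
  + by apply/measurable_EFinP; case: bf => mf _; exact: measurable_funTS.
Qed.

(** Used to raise [1 - v] to the [n]-th power, where [n v^2] stays bounded. *)
Lemma expR_le_1B (v : R) : 0 <= v -> 3 * v <= 1 -> expR (- (v + 2 * v ^+ 2)) <= 1 - v.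
Proof.
move=> v0 v1; have v2 : 0 < 1 - v by lra.
have h : v / (1 - v) <= v + 2 * v ^+ 2.
  rewrite ler_pdivrMr//.
  have : 0 <= v ^+ 2 * (1 - 2 * v) by rewrite mulr_ge0 ?sqr_ge0//; lra.
  lra.
apply: (@le_trans _ _ (expR (- (v / (1 - v))))); first by rewrite ler_expR lerN2.
rewrite expRN -[leRHS]invrK lef_pV2 ?posrE ?expR_gt0 ?invr_gt0//.
have e : (1 - v)^-1 = 1 + v / (1 - v) by field; rewrite gt_eqF.
by rewrite [leLHS]e expR_ge1Dx.
Qed.

(** Here [xi0^2 / 2] is about [La / 8 = 9 La / 72] and [N v] about [15 La / 72], together [La / 3].
    The ratios [N / (N - 2)], the shift [tau] and the term [2 v^2] are absorbed by the 5. *)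
Lemma window_exponent (N La tau xi0 v : R) : 25 <= N -> 4 <= La -> (La + 1) ^+ 2 <= N ->
  0 <= tau -> La * tau <= 1 -> 0 <= xi0 ->
  xi0 ^+ 2 <= La / 4 * (N ^+ 2 / (N - 2) ^+ 2) ->
  v = (15 / 36 * La * (N ^+ 2 / (N - 2) ^+ 3) + tau ^+ 2 / (N - 2)) / 2 ->
  [/\ 0 <= v, 3 * v <= 1, xi0 <= La &
      (xi0 + tau) ^+ 2 / 2 + N * (v + 2 * v ^+ 2) <= La / 3 + 5].
Proof.
move=> hN hL hLN t0 t1 x0 hx vE.
have N2 : 0 < N - 2 by lra.
have N0 : 0 < N by lra.
have LN : 5 * La <= N by nra.
have tau14 : tau <= 1 / 4 by nra.
have tau2 : tau ^+ 2 <= 1 / 16 by nra.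
have r2 : N ^+ 2 / (N - 2) ^+ 2 <= 1 + 5 / N.
  rewrite ler_pdivrMr ?exprn_gt0//.
  have -> : (1 + 5 / N) * (N - 2) ^+ 2 = ((N + 5) * (N - 2) ^+ 2) / N by field; rewrite gt_eqF.
  rewrite ler_pdivlMr//.
  have -> : (N + 5) * (N - 2) ^+ 2 = N ^+ 2 * N + (N * (N - 16) + 20) by ring.
  have : 0 <= N * (N - 16) by rewrite mulr_ge0//; lra.
  lra.
have r3 : N ^+ 3 / (N - 2) ^+ 3 <= 1 + 8 / N.
  rewrite ler_pdivrMr ?exprn_gt0//.
  have -> : (1 + 8 / N) * (N - 2) ^+ 3 = ((N + 8) * (N - 2) ^+ 3) / N by field; rewrite gt_eqF.
  rewrite ler_pdivlMr//.
  have -> : (N + 8) * (N - 2) ^+ 3 = N ^+ 3 * N + (2 * N ^+ 2 * (N - 18) + 88 * N - 64) by ring.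
  have : 0 <= 2 * N ^+ 2 * (N - 18) by rewrite mulr_ge0 ?mulr_ge0 ?sqr_ge0//; lra.
  lra.
have L8 : La * (8 / N) <= 8 / 5 by rewrite mulrA ler_pdivrMr//; lra.
have L5 : La * (5 / N) <= 1 by rewrite mulrA ler_pdivrMr//; lra.
have L0 : 0 <= La by lra.
have a2 : La * (N ^+ 2 / (N - 2) ^+ 2) <= La + 1.
  by apply: (le_trans (ler_wpM2l L0 r2)); lra.
have a3 : La * (N ^+ 3 / (N - 2) ^+ 3) <= La + 8 / 5.
  by apply: (le_trans (ler_wpM2l L0 r3)); lra.
have xi2 : xi0 ^+ 2 <= (La + 1) / 4 by clear r2 r3 L8 L5 a3; lra.
clear r2 r3 L8 L5 a2 hx.
have xiL : xi0 <= La by nra.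
have xit : xi0 * tau <= 1.
  by apply: le_trans t1; apply: ler_wpM2r.
have NvE : N * v = (15 / 36 * (La * (N ^+ 3 / (N - 2) ^+ 3)) + tau ^+ 2 * (N / (N - 2))) / 2.
  by rewrite vE; field; rewrite gt_eqF.
have nr : N / (N - 2) <= 2 by rewrite ler_pdivrMr//; lra.
have nr0 : 0 <= N / (N - 2) by rewrite divr_ge0// ltW.
have tn : tau ^+ 2 * (N / (N - 2)) <= 1 / 8.
  have -> : 1 / 8 = 1 / 16 * 2 :> R by field.
  by apply: ler_pM => //; exact: sqr_ge0.
have Nv : N * v <= 15 / 72 * La + 2 / 5.
  by rewrite NvE; clear NvE vE LN hLN xi2 xit nr; lra.
clear NvE a3 tn nr nr0.
have v0 : 0 <= v.
  rewrite vE divr_ge0// addr_ge0//; last by rewrite divr_ge0 ?sqr_ge0// ltW.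
  apply: mulr_ge0; first by lra.
  by apply: divr_ge0; [exact: sqr_ge0|exact/exprn_ge0/ltW].
have Nv0 : 0 <= N * v by rewrite mulr_ge0// ltW.
have v3 : 3 * v <= 1.
  have : N * (3 * v) <= N * 1 by lra.
  by rewrite ler_pM2l.
split => //.
have Nvs : N * v ^+ 2 <= 1 / 4.
  have e : N * (N * v ^+ 2) <= N * (1 / 4).
    have -> : N * (N * v ^+ 2) = (N * v) ^+ 2 by ring.
    have : (N * v) ^+ 2 <= ((La + 1) / 2) ^+ 2.
      by apply: lerXn2r; rewrite ?nnegrE//; clear -Nv L0 hL; lra.
    lra.
  by move: e; rewrite ler_pM2l.
lra.
Qed.

(** * The central box *)

Section central.
Variables (n : nat) (lam d r : R).
Hypothesis n3 : (2 < n)%N.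
Hypothesis lam0 : 0 < lam.
Hypothesis d0 : 0 < d.
Hypothesis r0 : 0 < r.
Variables (k A Z m m4 : R).
Hypothesis kE : k = kappa lam.
Hypothesis dr : d ^+ 2 <= r ^+ 2.
Hypothesis kdr : k * d ^+ 2 <= r ^+ 2.
Hypothesis AE : A = k * (n%:R - 2) / 2.
Hypothesis ZE : Z = int1 d (gauss A).
Hypothesis mE : m = int1 d (fun x => x ^+ 2 * gauss A x) / Z.
Hypothesis m4E : m4 = int1 d (fun x => x ^+ 4 * gauss A x) / Z.
Local Notation W := (fun t : Rn n => \prod_(j < n) gauss A (tnth t j)).
(** [m] and [m4] are moments of the normalised one-dimensional weight. [q] is the leading part of
    the mean of the quartic pair sum, and [eta] arises from the cubic one by replacing the random
    [mu t 2] by its mean [n m], which makes the phase a sum over single coordinates. [g1], [g2],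
    [g4] are the centred powers, scaled to be at most 1 in absolute value on the box. *)
Local Notation k4 := (k + 6 * k ^+ 2).
Local Notation q := (k4 / 24 * (n%:R ^+ 2 * m4 + 3 * n%:R ^+ 2 * m ^+ 2)).
Local Notation c3 := (k * (1 + 2 * lam) / 6).
Local Notation eta := (fun x : R => - (c3 * n%:R * (x ^+ 3 + 3 * m * x))).
Local Notation mu t i := (\sum_(j < n) tnth t j ^+ i).
Local Notation g1 := (fun x : R => x / d).
Local Notation g2 := (fun x : R => (x ^+ 2 - m) / d ^+ 2).
Local Notation g4 := (fun x : R => (x ^+ 4 - m4) / d ^+ 4).
Local Notation S g := (fun t : Rn n => \sum_(j < n) g (tnth t j)).

Lemma kappa_gt0 : 0 < k. Proof. by rewrite kE mulr_gt0// addr_gt0. Qed.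

Lemma nR3 : 3 <= n%:R :> R. Proof. by rewrite (ler_nat R 3 n). Qed.

Lemma gaussrate_gt0 : 0 < A.
Proof.
rewrite AE; have h1 := nR3; apply: divr_gt0 => //; apply: mulr_gt0; first exact: kappa_gt0.
by rewrite subr_gt0; lra.
Qed.

Lemma int1_gauss_gt0 : 0 < Z.
Proof.
rewrite ZE; have h : 2 * d * gauss A d <= int1 d (gauss A).
  have -> : 2 * d * gauss A d = int1 d (fun=> gauss A d).
    rewrite /int1 Rintegral_cst// /= lebesgue_measure_itv/= lte_fin.
    have -> : - d < d by have := d0; lra.
    by rewrite -EFinB /=; ring.
  apply: int1_le.
  - exact: bmeas1_cst.
  - by apply: bmeas1_cont; exact: continuous_gauss.
  - move=> x xL; rewrite /gauss ler_expR lerN2 ler_pM2l ?gaussrate_gt0//.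
    by rewrite -real_normK ?num_real// lerXn2r ?nnegrE ?normr_ge0 ?(ltW d0)// ler_norml.
by apply: lt_le_trans h; rewrite !mulr_gt0// gauss_gt0.
Qed.

Let bG : bmeas1 d (gauss A).
Proof. by apply: bmeas1_cont; exact: continuous_gauss. Qed.

Let bX i : bmeas1 d (fun x => x ^+ i * gauss A x).
Proof. by apply: bmeas1_cont; exact: continuous_Xgauss. Qed.

Lemma moment_bounds i : ~~ odd i ->
  0 <= int1 d (fun x => x ^+ i * gauss A x) / Z <= d ^+ i.
Proof.
move=> ei; have Z0 := int1_gauss_gt0; apply/andP; split.
  rewrite divr_ge0 ?(ltW Z0)//; apply: Rintegral_ge0 => x _.
  by rewrite mulr_ge0 ?gauss_ge0// exprn_even_ge0.
rewrite ler_pdivrMr// ZE -int1Z//; apply: int1_le => //.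
  by apply: bmeas1M => //; exact: bmeas1_cst.
move=> x xd; rewrite ler_wpM2r ?gauss_ge0//.
rewrite -(ger0_norm (exprn_even_ge0 x ei)) normrX.
by rewrite lerXn2r ?nnegrE ?normr_ge0 ?(ltW d0)// ler_norml.
Qed.

Lemma m_bounds : 0 <= m <= d ^+ 2. Proof. by rewrite mE; exact: moment_bounds. Qed.
Lemma normX_le x i : - d <= x <= d -> `|x ^+ i| <= d ^+ i.
Proof.
by move=> xd; rewrite normrX lerXn2r ?nnegrE ?normr_ge0 ?(ltW d0)// ler_norml.
Qed.

(** The 32 rounds up the [2 e^2] of [tbint_exp_abs_sum]. This form serves both errors: directly for
    the modulus, and through [x^2 <= 2 e^|x|] for the phase. *)
Definition exp_bound (g : R -> R) := tbint d (fun t => W t * expR (`|S g t| / Num.sqrt n%:R)) <= 32 * Z ^+ n.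

Let exp_bound_of g : continuous g -> (forall x, - d <= x <= d -> `|g x| <= 1) ->
  int1 d (fun x => gauss A x * g x) = 0 -> exp_bound g.
Proof.
move=> cg gb g0; have bg := bmeas1_cont d cg.
have n0 : (0 < n)%N by apply: leq_trans n3.
have := tbint_exp_abs_sum bG (@gauss_ge0 _ A) bg n0 gb g0; rewrite -ZE.
move/le_trans; apply; rewrite ler_wpM2r ?exprn_ge0 ?(ltW int1_gauss_gt0)//.
have := expR2_le16; lra.
Qed.

Let g1_exp : exp_bound g1.
Proof.
have cg1 : continuous g1 by move=> x; apply: cvgM; [exact: cvg_id|exact: cvg_cst].
apply: exp_bound_of => //.
  move=> x xd; rewrite normf_div (gtr0_norm d0) ler_pdivrMr// mul1r.
  by rewrite ler_norml.
apply: int1_odd.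
  by move=> x; apply: cvgM; [exact: continuous_gauss|exact: cg1].
by move=> x; rewrite gaussN /g1 mulNr mulrN.
Qed.

Let centered_bound i : (0 < i)%N -> ~~ odd i ->
  exp_bound (fun x => (x ^+ i - int1 d (fun x => x ^+ i * gauss A x) / Z) / d ^+ i).
Proof.
move=> i0 ei; pose mi := int1 d (fun x => x ^+ i * gauss A x) / Z.
rewrite -/mi; pose g (x : R) := (x ^+ i - mi) / d ^+ i; rewrite -/g.
have Z0 := int1_gauss_gt0.
have di : 0 < d ^+ i by rewrite exprn_gt0.
have /andP[m0 m1] : 0 <= mi <= d ^+ i by exact: moment_bounds.
have cg : continuous g.
  move=> x; apply: cvgM; last exact: cvg_cst.
  by apply: cvgB; [exact: exprn_continuous|exact: cvg_cst].
apply: exp_bound_of => //.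
  move=> x xd; rewrite normf_div (gtr0_norm di) ler_pdivrMr// mul1r.
  have h := normX_le i xd; rewrite (ger0_norm (exprn_even_ge0 x ei)) in h.
  have h0 := exprn_even_ge0 x ei.
  by rewrite ler_norml; apply/andP; split; lra.
transitivity (int1 d (fun x => (d ^+ i)^-1 * (x ^+ i * gauss A x - mi * gauss A x))).
  by apply: int1_eq => x _; rewrite /g; ring.
rewrite int1Z; last first.
  have -> : (fun x => x ^+ i * gauss A x - mi * gauss A x) =
            (fun x => x ^+ i * gauss A x + (- mi) * gauss A x).
    by apply/funext => x; rewrite mulNr.
  by apply: bmeas1D => //; apply: bmeas1M => //; exact: bmeas1_cst.
rewrite int1B//; last by apply: bmeas1M => //; exact: bmeas1_cst.
by rewrite int1Z// /mi -ZE divfK ?subrr ?mulr0// gt_eqF.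
Qed.

Let g2_exp : exp_bound g2. Proof. by rewrite mE; exact: (@centered_bound 2). Qed.
Let g4_exp : exp_bound g4. Proof. by rewrite m4E; exact: (@centered_bound 4). Qed.

Definition quartic_defect (t : Rn n) : R := pairsum (fun j i =>
  k * (tnth t j + tnth t i) ^+ 2 / 2 - logmod k (tnth t j + tnth t i)).

Let k_ge0 : 0 <= k. Proof. exact: ltW kappa_gt0. Qed.

Lemma weight_split (t : Rn n) : expR (- modsum k t) =
  W t * gauss 2^-1 (Num.sqrt k * \sum_(j < n) tnth t j) * expR (quartic_defect t).
Proof.
rewrite /gauss -expR_sum -!expRD; congr expR.
rewrite exprMn sqr_sqrtr// /quartic_defect pairsumB -/(modsum k t).
have -> : pairsum (fun j i : 'I_n => k * (tnth t j + tnth t i) ^+ 2 / 2) =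
    k / 2 * ((n%:R - 2) * mu t 2 + mu t 1 ^+ 2).
  rewrite -(@pairsum_sq R n (fun j => tnth t j)) -pairsumZ.
  by apply: pairsum_eq => j i; ring.
have -> : mu t 1 = \sum_(j < n) tnth t j by apply: eq_bigr => j _; rewrite expr1.
by rewrite sumrN -mulr_sumr AE; field.
Qed.

Lemma mu_le (t : Rn n) i : sqbox d n t -> `|mu t i| <= n%:R * d ^+ i.
Proof. by move=> tb; apply: norm_sum_le => j; apply: normX_le; exact: tb. Qed.

Let kd4 : k4 * d ^+ 4 <= 7 * r ^+ 4.
Proof.
have h0 := k_ge0; have h1 := dr; have h2 := kdr.
have d2 := sqr_ge0 d; have r2 := sqr_ge0 r; have kd := mulr_ge0 h0 d2.
have a1 : k * d ^+ 4 <= r ^+ 4.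
  have -> : k * d ^+ 4 = (k * d ^+ 2) * d ^+ 2 by ring.
  have -> : r ^+ 4 = r ^+ 2 * r ^+ 2 by ring.
  exact: ler_pM.
have a2 : k ^+ 2 * d ^+ 4 <= r ^+ 4.
  have -> : k ^+ 2 * d ^+ 4 = (k * d ^+ 2) * (k * d ^+ 2) by ring.
  have -> : r ^+ 4 = r ^+ 2 * r ^+ 2 by ring.
  exact: ler_pM.
lra.
Qed.

Let kd6 : (k + k ^+ 2 + k ^+ 3) * d ^+ 6 <= 3 * r ^+ 6.
Proof.
have h0 := k_ge0; have h1 := dr; have h2 := kdr.
have d2 := sqr_ge0 d; have r2 := sqr_ge0 r; have kd := mulr_ge0 h0 d2.
have r6 : r ^+ 6 = r ^+ 2 * r ^+ 2 * r ^+ 2 by ring.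
have a1 : k * d ^+ 6 <= r ^+ 6.
  have -> : k * d ^+ 6 = (k * d ^+ 2) * d ^+ 2 * d ^+ 2 by ring.
  by rewrite r6; apply: ler_pM => //; [exact: mulr_ge0|exact: ler_pM].
have a2 : k ^+ 2 * d ^+ 6 <= r ^+ 6.
  have -> : k ^+ 2 * d ^+ 6 = (k * d ^+ 2) * (k * d ^+ 2) * d ^+ 2 by ring.
  by rewrite r6; apply: ler_pM => //; [exact: mulr_ge0|exact: ler_pM].
have a3 : k ^+ 3 * d ^+ 6 <= r ^+ 6.
  have -> : k ^+ 3 * d ^+ 6 = (k * d ^+ 2) * (k * d ^+ 2) * (k * d ^+ 2) by ring.
  by rewrite r6; apply: ler_pM => //; [exact: mulr_ge0|exact: ler_pM].
lra.
Qed.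

(* The square of [kappa (1 + 2 lam) d^3] is [kappa^2 (1 + 4 kappa) d^6]. *)
Let kd3 : k * (1 + 2 * lam) * d ^+ 3 <= 3 * r ^+ 3.
Proof.
have h0 := k_ge0; have h1 := dr; have h2 := kdr; have hl := lam0.
have d2 := sqr_ge0 d; have r2 := sqr_ge0 r; have kd := mulr_ge0 h0 d2.
have r6 : r ^+ 6 = r ^+ 2 * r ^+ 2 * r ^+ 2 by ring.
have hd := ltW d0; have hr := ltW r0.
have l0 : 0 <= k * (1 + 2 * lam) * d ^+ 3.
  by apply: mulr_ge0; [apply: mulr_ge0 => //; lra|exact: exprn_ge0].
rewrite -(ler_pXn2r (n := 2))// ?nnegrE//; last by rewrite mulr_ge0// exprn_ge0.
have -> : (k * (1 + 2 * lam) * d ^+ 3) ^+ 2 = k ^+ 2 * d ^+ 6 + 4 * (k ^+ 3 * d ^+ 6).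
  by rewrite kE /kappa; ring.
have a2 : k ^+ 2 * d ^+ 6 <= r ^+ 6.
  have -> : k ^+ 2 * d ^+ 6 = (k * d ^+ 2) * (k * d ^+ 2) * d ^+ 2 by ring.
  by rewrite r6; apply: ler_pM => //; [exact: mulr_ge0|exact: ler_pM].
have a3 : k ^+ 3 * d ^+ 6 <= r ^+ 6.
  have -> : k ^+ 3 * d ^+ 6 = (k * d ^+ 2) * (k * d ^+ 2) * (k * d ^+ 2) by ring.
  by rewrite r6; apply: ler_pM => //; [exact: mulr_ge0|exact: ler_pM].
have r60 : 0 <= r ^+ 6 by rewrite exprn_ge0.
rewrite (_ : (3 * r ^+ 3) ^+ 2 = 9 * r ^+ 6); last by ring.
lra.
Qed.

(** Centring [mu t 4] and [mu t 2] in [pairsum_quartic] leaves terms linear in the sums [S g], with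
    coefficients of order [n r^4]. As these sums are of order [sqrt n], the error is of order
    [n sqrt n r^4]. *)
Lemma quartic_defect_close (t : Rn n) : sqbox d n t ->
  `|quartic_defect t - q| <= 192 * (n%:R ^+ 2 * r ^+ 6) + 3 * (n%:R * r ^+ 4) +
    2 * (n%:R * r ^+ 4) * (`|S g4 t| + `|S g1 t| + `|S g2 t|).
Proof.
move=> tb; have h0 := k_ge0; have hd := d0.
have nn : 0 <= n%:R :> R by exact: ler0n.
have e1 : `|quartic_defect t - k4 / 24 * pairsum (fun j i => (tnth t j + tnth t i) ^+ 4)| <=
    192 * (n%:R ^+ 2 * r ^+ 6).
  rewrite -pairsumZ /quartic_defect -pairsumB.
  have -> : 192 * (n%:R ^+ 2 * r ^+ 6) = n%:R ^+ 2 * (192 * r ^+ 6) by ring.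
  have c0 : 0 <= 192 * r ^+ 6 := mulr_ge0 (ler0n _ 192) (exprn_ge0 6 (ltW r0)).
  apply: (norm_pairsum_le c0).
  move=> j i; set x := tnth t j + tnth t i.
  have -> : k * x ^+ 2 / 2 - logmod k x - k4 / 24 * x ^+ 4 =
     k * x ^+ 2 / 2 - logmod k x - k4 * x ^+ 4 / 24 by ring.
  apply: (le_trans (logmod_quartic x h0)).
  have x6 : x ^+ 6 <= 64 * d ^+ 6.
    have -> : 64 * d ^+ 6 = (2 * d) ^+ 6 by ring.
    rewrite -(ger0_norm (exprn_even_ge0 x (isT : ~~ odd 6))) normrX.
    rewrite lerXn2r ?nnegrE ?normr_ge0//; first by lra.
    have /andP[t1 t2] := tb j; have /andP[t3 t4] := tb i.
    by rewrite ler_norml /x; apply/andP; split; lra.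
  have k6 : 0 <= k + k ^+ 2 + k ^+ 3 by rewrite !addr_ge0// exprn_ge0.
  apply: (le_trans (ler_wpM2l k6 x6)); have := kd6; lra.
have S1E : mu t 1 = d * S g1 t.
  by rewrite mulr_sumr; apply: eq_bigr => j _; field; rewrite gt_eqF.
have S2E : mu t 2 - n%:R * m = d ^+ 2 * S g2 t.
  rewrite mulr_sumr -[n in n%:R * m]card_ord mulr_natl -sumr_const -sumrB.
  by apply: eq_bigr => j _; field; rewrite gt_eqF.
have S4E : mu t 4 - n%:R * m4 = d ^+ 4 * S g4 t.
  rewrite mulr_sumr -[n in n%:R * m4]card_ord mulr_natl -sumr_const -sumrB.
  by apply: eq_bigr => j _; field; rewrite gt_eqF.
have b4 := mu_le 4 tb; have b3 := mu_le 3 tb; have b2 := mu_le 2 tb.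
have /andP[m0 m1] := m_bounds.
set s1 := S g1 t in S1E *; set s2 := S g2 t in S2E *; set s4 := S g4 t in S4E *.
have k40 : 0 <= k4 by rewrite addr_ge0// mulr_ge0// sqr_ge0.
have e2 : `|k4 / 24 * pairsum (fun j i => (tnth t j + tnth t i) ^+ 4) - q| <=
    k4 / 24 * (n%:R * d ^+ 4 * (`|s4| + 8 + 4 * `|s1| + 6 * `|s2|)).
  rewrite (@pairsum_quartic R n (fun j => tnth t j)) -mulrBr normrM.
  rewrite (ger0_norm (divr_ge0 k40 (ler0n _ 24))) ler_wpM2l ?divr_ge0//.
  have -> : (n%:R - 8) * mu t 4 + 4 * mu t 1 * mu t 3 + 3 * mu t 2 ^+ 2 -
     (n%:R ^+ 2 * m4 + 3 * n%:R ^+ 2 * m ^+ 2) =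
     n%:R * (d ^+ 4 * s4) - 8 * mu t 4 + 4 * (d * s1) * mu t 3 +
     3 * (d ^+ 2 * s2) * (mu t 2 + n%:R * m).
    by rewrite -S4E -S2E -S1E; ring.
  have c1 : `|n%:R * (d ^+ 4 * s4)| = n%:R * d ^+ 4 * `|s4|.
    by rewrite !normrM (ger0_norm nn) ger0_norm ?exprn_ge0 ?(ltW hd)// mulrA.
  have c2 : `|8 * mu t 4| <= n%:R * d ^+ 4 * 8.
    by rewrite normrM ger0_norm// mulrC ler_wpM2r.
  have c3' : `|4 * (d * s1) * mu t 3| <= n%:R * d ^+ 4 * (4 * `|s1|).
    rewrite !normrM (ger0_norm (ler0n _ 4)) (gtr0_norm hd).
    have h : 0 <= 4 * (d * `|s1|) by rewrite !mulr_ge0// ltW.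
    apply: (le_trans (ler_wpM2l h b3)).
    by rewrite le_eqVlt; apply/orP; left; apply/eqP; ring.
  have c4 : `|3 * (d ^+ 2 * s2) * (mu t 2 + n%:R * m)| <= n%:R * d ^+ 4 * (6 * `|s2|).
    rewrite normrM [`|3 * _|]normrM [`|d ^+ 2 * s2|]normrM (ger0_norm (ler0n _ 3)) (ger0_norm (sqr_ge0 d)).
    have h : 0 <= 3 * (d ^+ 2 * `|s2|).
      by apply: mulr_ge0 => //; apply: mulr_ge0 => //; exact: sqr_ge0.
    have hb : `|mu t 2 + n%:R * m| <= 2 * (n%:R * d ^+ 2).
      apply: (le_trans (ler_normD _ _)).
      have := ler_wpM2l nn m1; rewrite normrM (ger0_norm nn) (ger0_norm m0).
      by move=> ?; lra.
    apply: (le_trans (ler_wpM2l h hb)).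
    by rewrite le_eqVlt; apply/orP; left; apply/eqP; ring.
  apply: (le_trans (ler_normD _ _)).
  have := ler_normD (n%:R * (d ^+ 4 * s4) - 8 * mu t 4) (4 * (d * s1) * mu t 3).
  have := ler_normB (n%:R * (d ^+ 4 * s4)) (8 * mu t 4).
  by rewrite c1; lra.
have e3 : k4 / 24 * (n%:R * d ^+ 4 * (`|s4| + 8 + 4 * `|s1| + 6 * `|s2|)) <=
   3 * (n%:R * r ^+ 4) + 2 * (n%:R * r ^+ 4) * (`|s4| + `|s1| + `|s2|).
  have -> : k4 / 24 * (n%:R * d ^+ 4 * (`|s4| + 8 + 4 * `|s1| + 6 * `|s2|)) =
     (k4 * d ^+ 4) * (n%:R * ((`|s4| + 8 + 4 * `|s1| + 6 * `|s2|) / 24)) by field.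
  have x0 : 0 <= n%:R * ((`|s4| + 8 + 4 * `|s1| + 6 * `|s2|) / 24).
    by rewrite mulr_ge0// divr_ge0// !addr_ge0// mulr_ge0.
  apply: (le_trans (ler_wpM2r x0 kd4)).
  have r4 : 0 <= n%:R * r ^+ 4 by rewrite mulr_ge0// exprn_even_ge0.
  have y1 := mulr_ge0 r4 (normr_ge0 s1); have y2 := mulr_ge0 r4 (normr_ge0 s2).
  have y4 := mulr_ge0 r4 (normr_ge0 s4).
  lra.
have -> : quartic_defect t - q =
  (quartic_defect t - k4 / 24 * pairsum (fun j i => (tnth t j + tnth t i) ^+ 4)) +
  (k4 / 24 * pairsum (fun j i => (tnth t j + tnth t i) ^+ 4) - q) by ring.
apply: (le_trans (ler_normD _ _)); lra.
Qed.

(** Replacing [mu t 2] by [n m] leaves [mu t 1 * (mu t 2 - n m)], a product of two centred sums and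
    hence of order [n] instead of [n^2]. *)
Lemma phasesum_close (t : Rn n) : sqbox d n t ->
  `|phasesum lam t - S eta t| <=
  192 * (n%:R ^+ 2 * r ^+ 5) + 2 * (n%:R * r ^+ 3) +
  r ^+ 3 * (S g1 t ^+ 2 + S g2 t ^+ 2).
Proof.
move=> tb; have h0 := k_ge0; have hd := d0; have hl := lam0; have hr := r0.
have nn : 0 <= n%:R :> R by exact: ler0n.
have k30 : 0 <= k * (1 + 2 * lam) by apply: mulr_ge0 => //; lra.
have e1 : `|phasesum lam t - (- c3) * pairsum (fun j i => (tnth t j + tnth t i) ^+ 3)| <=
    192 * (n%:R ^+ 2 * r ^+ 5).
  rewrite -pairsumZ /phasesum -pairsumB.
  have -> : 192 * (n%:R ^+ 2 * r ^+ 5) = n%:R ^+ 2 * (192 * r ^+ 5) by ring.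
  have c0 : 0 <= 192 * r ^+ 5 := mulr_ge0 (ler0n _ 192) (exprn_ge0 5 (ltW hr)).
  apply: (norm_pairsum_le c0).
  move=> j i; set x := tnth t j + tnth t i.
  have := phase_cubic x (ltW hl); rewrite -kE => h.
  have -> : phase lam x - (- c3) * x ^+ 3 = phase lam x + k * (1 + 2 * lam) * x ^+ 3 / 6 by field.
  apply: (le_trans h).
  have x5 : `|x| ^+ 5 <= 32 * d ^+ 5.
    have -> : 32 * d ^+ 5 = (2 * d) ^+ 5 by ring.
    rewrite lerXn2r ?nnegrE ?normr_ge0//; first by lra.
    have /andP[t1 t2] := tb j; have /andP[t3 t4] := tb i.
    by rewrite ler_norml /x; apply/andP; split; lra.
  have k31 : 0 <= k * (1 + 2 * lam) * (1 + k) by apply: mulr_ge0 => //; lra.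
  apply: (le_trans (ler_wpM2l k31 x5)).
  have -> : k * (1 + 2 * lam) * (1 + k) * (32 * d ^+ 5) =
    32 * ((k * (1 + 2 * lam) * d ^+ 3) * (d ^+ 2 + k * d ^+ 2)) by ring.
  have -> : 192 * r ^+ 5 = 32 * ((3 * r ^+ 3) * (2 * r ^+ 2)) by ring.
  rewrite ler_pM2l//; apply: ler_pM.
  - by rewrite mulr_ge0// exprn_ge0// ltW.
  - by have d2 := sqr_ge0 d; have := mulr_ge0 h0 d2; lra.
  - exact: kd3.
  - have := dr; have := kdr; lra.
have S1E : mu t 1 = d * S g1 t.
  by rewrite mulr_sumr; apply: eq_bigr => j _; field; rewrite gt_eqF.
have S2E : mu t 2 - n%:R * m = d ^+ 2 * S g2 t.
  rewrite mulr_sumr -[n in n%:R * m]card_ord mulr_natl -sumr_const -sumrB.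
  by apply: eq_bigr => j _; field; rewrite gt_eqF.
have SeE : S eta t = - c3 * (n%:R * (mu t 3 + 3 * m * mu t 1)).
  rewrite [in RHS]mulr_sumr -big_split/= !mulr_sumr.
  by apply: eq_bigr => j _; ring.
have b3 := mu_le 3 tb.
set s1 := S g1 t in S1E *; set s2 := S g2 t in S2E *.
have e2 : `|- c3 * pairsum (fun j i => (tnth t j + tnth t i) ^+ 3) - S eta t| <=
    2 * (n%:R * r ^+ 3) + r ^+ 3 * (s1 ^+ 2 + s2 ^+ 2).
  rewrite SeE (@pairsum_cube R n (fun j => tnth t j)).
  have -> : - c3 * ((n%:R - 4) * mu t 3 + 3 * mu t 1 * mu t 2) -
      - c3 * (n%:R * (mu t 3 + 3 * m * mu t 1)) =
      c3 * (4 * mu t 3 - 3 * (d * s1) * (d ^+ 2 * s2)).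
    by rewrite -S1E -S2E; ring.
  rewrite normrM (ger0_norm (divr_ge0 k30 (ler0n _ 6))).
  have hb : `|4 * mu t 3 - 3 * (d * s1) * (d ^+ 2 * s2)| <=
      d ^+ 3 * (4 * n%:R + 3 / 2 * (s1 ^+ 2 + s2 ^+ 2)).
    apply: (le_trans (ler_normB _ _)).
    rewrite mulrDr; apply: lerD.
      by rewrite normrM ger0_norm//; move: b3; lra.
    have -> : 3 * (d * s1) * (d ^+ 2 * s2) = d ^+ 3 * (3 * (s1 * s2)) by ring.
    rewrite normrM ger0_norm ?exprn_ge0 ?(ltW hd)// ler_wpM2l ?exprn_ge0 ?(ltW hd)//.
    rewrite normrM ger0_norm//.
    have : `|s1 * s2| <= (s1 ^+ 2 + s2 ^+ 2) / 2.
      rewrite ler_norml; apply/andP; split.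
        by have := sqr_ge0 (s1 + s2); lra.
      by have := sqr_ge0 (s1 - s2); lra.
    lra.
  apply: (le_trans (ler_wpM2l (divr_ge0 k30 (ler0n _ 6)) hb)).
  have x0 : 0 <= (4 * n%:R + 3 / 2 * (s1 ^+ 2 + s2 ^+ 2)) / 6.
    by have := sqr_ge0 s1; have := sqr_ge0 s2; move: nn; lra.
  have -> : c3 * (d ^+ 3 * (4 * n%:R + 3 / 2 * (s1 ^+ 2 + s2 ^+ 2))) =
    (k * (1 + 2 * lam) * d ^+ 3) * ((4 * n%:R + 3 / 2 * (s1 ^+ 2 + s2 ^+ 2)) / 6) by field.
  apply: (le_trans (ler_wpM2r x0 kd3)).
  have r3 : 0 <= r ^+ 3 by rewrite exprn_ge0// ltW.
  have y1 := mulr_ge0 r3 (sqr_ge0 s1); have y2 := mulr_ge0 r3 (sqr_ge0 s2).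
  have y3 := mulr_ge0 r3 nn.
  lra.
have -> : phasesum lam t - S eta t =
  (phasesum lam t - (- c3) * pairsum (fun j i => (tnth t j + tnth t i) ^+ 3)) +
  (- c3 * pairsum (fun j i => (tnth t j + tnth t i) ^+ 3) - S eta t) by ring.
apply: (le_trans (ler_normD _ _)); lra.
Qed.

Let bW : bmeas d W. Proof. exact: bmeas_prod1. Qed.

Let W_ge0 (t : Rn n) : 0 <= W t.
Proof. by apply: prodr_ge0 => j _; exact: gauss_ge0. Qed.

Let bS (g : R -> R) : continuous g -> bmeas d (S g).
Proof. by move=> cg; apply: bmeas_sum1; exact: bmeas1_cont. Qed.

Let cg1 : continuous g1.
Proof. by move=> x; apply: cvgM; [exact: cvg_id|exact: cvg_cst]. Qed.

Let cgX i (c e : R) : continuous (fun x : R => (x ^+ i - c) / e).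
Proof.
move=> x; apply: cvgM; last exact: cvg_cst.
by apply: cvgB; [exact: exprn_continuous|exact: cvg_cst].
Qed.

Let cg2 : continuous g2. Proof. exact: cgX. Qed.
Let cg4 : continuous g4. Proof. exact: cgX. Qed.

Lemma continuous_eta : continuous eta.
Proof.
move=> x; apply: cvgN; apply: cvgM; first exact: cvg_cst.
apply: cvgD; first exact: exprn_continuous.
by apply: cvgM; [exact: cvg_cst|exact: cvg_id].
Qed.

Let bWexp (g : R -> R) : continuous g ->
  bmeas d (fun t => W t * expR (`|S g t| / Num.sqrt n%:R)).
Proof.
move=> cg; apply: bmeasM => //; apply: (bmeas_comp (@continuous_expR R)).
by apply: bmeasM; [apply: bmeas_norm; exact: bS|exact: bmeas_cst].
Qed.

Let tbintW : tbint d W = Z ^+ n. Proof. by rewrite tbint_prod// -ZE. Qed.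

Let bQ : bmeas d quartic_defect.
Proof.
apply: (@bmeas_pairsum d n (fun x => k * x ^+ 2 / 2 - logmod k x)) => x.
apply: cvgB; last exact: continuous_logmod.
apply: cvgM; last exact: cvg_cst.
by apply: cvgM; [exact: cvg_cst|exact: exprn_continuous].
Qed.

Let bPh : bmeas d (@phasesum R lam n).
Proof. by apply: (@bmeas_pairsum d n (phase lam)); exact: continuous_phase (ltW lam0). Qed.

Let sn := Num.sqrt n%:R : R.

Lemma modulus_error : 6 * (n%:R * sn * r ^+ 4) <= 1 ->
  192 * (n%:R ^+ 2 * r ^+ 6) + 3 * (n%:R * r ^+ 4) <= 6 * (n%:R * sn * r ^+ 4) ->
  tbint d (fun t => W t * `|expR (quartic_defect t - q) - 1|) <=
  2304 * (n%:R * sn * r ^+ 4) * Z ^+ n.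
Proof.
move=> C1 C2; have n3' := nR3; have hr := r0.
have sn0 : 0 < sn by rewrite sqrtr_gt0; lra.
have np : 0 < n%:R :> R by lra.
have r4 : 0 < r ^+ 4 by rewrite exprn_gt0.
have q0 : 0 < n%:R * sn * r ^+ 4 by rewrite !mulr_gt0.
(* Chosen so that [s] times the bound on the defect is at most 1 plus the average of three terms
   [|S g| / sqrt n], each of which has a bounded exponential moment. The final constant is
   [2304 = 6 * 4 * (3 * 32)]. *)
pose s := (6 * (n%:R * sn * r ^+ 4))^-1.
have s1 : 1 <= s by rewrite /s invf_ge1// mulr_gt0.
have s0 : 0 < s by lra.
have sE : s * (6 * (n%:R * sn * r ^+ 4)) = 1 by rewrite mulVf// gt_eqF// mulr_gt0.
have sE2 : s * (2 * (n%:R * r ^+ 4)) = (3 * sn)^-1.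
  by rewrite /s; field; rewrite !gt_eqF.
have b4 := bWexp cg4; have b1 := bWexp cg1; have b2 := bWexp cg2.
rewrite -/sn in b1 b2 b4.
apply: (@le_trans _ _ (tbint d (fun t => s^-1 * (expR 1 * (W t * expR (`|S g4 t| / sn) +
   (W t * expR (`|S g1 t| / sn) + W t * expR (`|S g2 t| / sn))))))).
  apply: tbint_le.
  - apply: bmeasM => //; apply: bmeas_norm; apply: bmeasB; last exact: bmeas_cst.
    by apply: (bmeas_comp (@continuous_expR R)); apply: bmeasB => //; exact: bmeas_cst.
  - apply: bmeasM; first exact: bmeas_cst.
    apply: bmeasM; first exact: bmeas_cst.
    by apply: bmeasD => //; exact: bmeasD.
  - move=> t tb; rewrite -!mulrDr.
    have h := norm_expR_sub1 (quartic_defect t - q) s1.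
    have -> : s^-1 * (expR 1 * (W t * (expR (`|S g4 t| / sn) +
        (expR (`|S g1 t| / sn) + expR (`|S g2 t| / sn))))) =
      W t * (s^-1 * (expR 1 * (expR (`|S g4 t| / sn) +
        (expR (`|S g1 t| / sn) + expR (`|S g2 t| / sn))))) by ring.
    apply: ler_wpM2l => //; apply: (le_trans h).
    have sV0 : 0 < s^-1 by rewrite invr_gt0; exact: s0.
    rewrite (ler_pM2l sV0).
    have hq := quartic_defect_close tb.
    have hs : s * `|quartic_defect t - q| <=
       1 + (`|S g4 t| / sn + `|S g1 t| / sn + `|S g2 t| / sn) / 3.
      apply: (le_trans (ler_wpM2l (ltW s0) hq)).
      have -> : (`|S g4 t| / sn + `|S g1 t| / sn + `|S g2 t| / sn) / 3 =
        s * (2 * (n%:R * r ^+ 4)) * (`|S g4 t| + `|S g1 t| + `|S g2 t|).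
        by rewrite sE2; field; rewrite gt_eqF.
      rewrite mulrDr [X in _ + X <= _]mulrA lerD2r.
      have := ler_wpM2l (ltW s0) C2; rewrite sE; lra.
    apply: (@le_trans _ _ (expR (1 + (`|S g4 t| / sn + `|S g1 t| / sn + `|S g2 t| / sn) / 3))).
      by rewrite ler_expR.
    rewrite expRD ler_wpM2l ?expR_ge0//.
    set x := `|S g4 t| / sn; set y := `|S g1 t| / sn; set z := `|S g2 t| / sn.
    exact: expR_avg3.
rewrite !tbintZ//; last 2 first.
  by apply: bmeasD => //; exact: bmeasD.
  apply: bmeasM; first exact: bmeas_cst.
  by apply: bmeasD => //; exact: bmeasD.
rewrite tbintD//; last exact: bmeasD.
rewrite tbintD//.
have e4 : tbint d (fun t => W t * expR (`|S g4 t| / sn)) <= 32 * Z ^+ n := g4_exp.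
have e1 : tbint d (fun t => W t * expR (`|S g1 t| / sn)) <= 32 * Z ^+ n := g1_exp.
have e2 : tbint d (fun t => W t * expR (`|S g2 t| / sn)) <= 32 * Z ^+ n := g2_exp.
have Zn : 0 <= Z ^+ n by rewrite exprn_ge0 ?(ltW int1_gauss_gt0).
have Es := expR1_le4; have Es0 := expR_ge0 (1 : R).
have sVE : s^-1 = 6 * (n%:R * sn * r ^+ 4) by rewrite invrK.
rewrite sVE.
set I4 := tbint _ _ in e4 *; set I1 := tbint _ _ in e1 *; set I2 := tbint _ _ in e2 *.
have h1 : I4 + (I1 + I2) <= 96 * Z ^+ n by lra.
have h2 : expR 1 * (I4 + (I1 + I2)) <= 4 * (96 * Z ^+ n).
  apply: (le_trans (ler_wpM2l Es0 h1)); apply: ler_wpM2r => //; lra.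
have q6 : 0 <= 6 * (n%:R * sn * r ^+ 4) by rewrite mulr_ge0// ltW.
apply: (le_trans (ler_wpM2l q6 h2)).
by rewrite le_eqVlt; apply/orP; left; apply/eqP; ring.
Qed.

Lemma sum_sq_int (g : R -> R) : continuous g -> exp_bound g ->
  tbint d (fun t => W t * S g t ^+ 2) <= 64 * n%:R * Z ^+ n.
Proof.
move=> cg hg; have n3' := nR3.
have sn0 : 0 < sn by rewrite sqrtr_gt0; lra.
have bg2 : bmeas d (fun t => W t * S g t ^+ 2).
  by apply: bmeasM => //; rewrite /GRing.exp /=; apply: bmeasM; exact: bS.
apply: (@le_trans _ _ (tbint d (fun t => 2 * n%:R * (W t * expR (`|S g t| / sn))))).
  apply: tbint_le => //.
    by apply: bmeasM; [exact: bmeas_cst|exact: bWexp].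
  move=> t _; rewrite [leRHS]mulrCA; apply: ler_wpM2l => //.
  have := sqr_le_expR (S g t / sn).
  rewrite normf_div (gtr0_norm sn0) expr_div_n /sn sqr_sqrtr; last by lra.
  by rewrite ler_pdivrMr; lra.
rewrite tbintZ; last exact: bWexp.
have n0 : 0 <= 2 * n%:R :> R by lra.
apply: (le_trans (ler_wpM2l n0 hg)).
by rewrite le_eqVlt; apply/orP; left; apply/eqP; ring.
Qed.

Lemma phase_error :
  tbint d (fun t => W t * `|phasesum lam t - S eta t|) <=
  (192 * (n%:R ^+ 2 * r ^+ 5) + 130 * (n%:R * r ^+ 3)) * Z ^+ n.
Proof.
have hr := r0; have r3 : 0 <= r ^+ 3 by rewrite exprn_ge0// ltW.
have bq (g : R -> R) : continuous g -> bmeas d (fun t => W t * S g t ^+ 2).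
  by move=> cg; apply: bmeasM => //; rewrite /GRing.exp /=; apply: bmeasM; exact: bS.
have b1 := bq _ cg1; have b2 := bq _ cg2.
set E1 := 192 * (n%:R ^+ 2 * r ^+ 5) + 2 * (n%:R * r ^+ 3).
apply: (@le_trans _ _ (tbint d (fun t => E1 * W t + r ^+ 3 * (W t * S g1 t ^+ 2 + W t * S g2 t ^+ 2)))).
  apply: tbint_le.
  - apply: bmeasM => //; apply: bmeas_norm; apply: bmeasB => //.
    exact: (bS continuous_eta).
  - apply: bmeasD; first by apply: bmeasM => //; exact: bmeas_cst.
    by apply: bmeasM; [exact: bmeas_cst|exact: bmeasD].
  - move=> t tb; have := ler_wpM2l (W_ge0 t) (phasesum_close tb).
    move/le_trans; apply; rewrite -/E1.
    by rewrite le_eqVlt; apply/orP; left; apply/eqP; ring.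
rewrite tbintD; last 2 first.
  by apply: bmeasM => //; exact: bmeas_cst.
  by apply: bmeasM; [exact: bmeas_cst|exact: bmeasD].
rewrite !tbintZ//; last exact: bmeasD.
rewrite tbintD// tbintW.
have h1 := sum_sq_int cg1 g1_exp; have h2 := sum_sq_int cg2 g2_exp.
set I1 := tbint _ _ in h1 *; set I2 := tbint _ _ in h2 *.
have h3 : I1 + I2 <= 128 * n%:R * Z ^+ n by lra.
have := ler_wpM2l r3 h3; rewrite /E1; lra.
Qed.

(** The factor in the sum of the coordinates is at most 1, so each of the two replacements costs no
    more than its error integrated against the weights. *)
Lemma central_lower : 6 * (n%:R * sn * r ^+ 4) <= 1 ->
  192 * (n%:R ^+ 2 * r ^+ 6) + 3 * (n%:R * r ^+ 4) <= 6 * (n%:R * sn * r ^+ 4) ->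
  expR q * (tbint d (fun t => W t *
      (gauss 2^-1 (Num.sqrt k * \sum_(j < n) tnth t j) * cos (S eta t))) -
    (2304 * (n%:R * sn * r ^+ 4) + 192 * (n%:R ^+ 2 * r ^+ 5) +
     130 * (n%:R * r ^+ 3)) * Z ^+ n) <=
  tbint d (fun t : Rn n => expR (- modsum k t) * cos (phasesum lam t)).
Proof.
move=> C1 C2.
have h1 := modulus_error C1 C2; have h2 := phase_error.
have bY : bmeas d (fun t : Rn n => gauss 2^-1 (Num.sqrt k * \sum_(j < n) tnth t j)).
  apply: (bmeas_comp (@continuous_gauss R 2^-1)); apply: bmeasM; first exact: bmeas_cst.
  by apply: (@bS id) => x; exact: cvg_id.
have bc : bmeas d (fun t => cos (S eta t)).
  by apply: (bmeas_comp (@continuous_cos R)); exact: (bS continuous_eta).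
have b1 : bmeas d (fun t => W t *
      (gauss 2^-1 (Num.sqrt k * \sum_(j < n) tnth t j) * cos (S eta t))).
  by apply: bmeasM => //; exact: bmeasM.
have b2 : bmeas d (fun t => W t * `|expR (quartic_defect t - q) - 1|).
  apply: bmeasM => //; apply: bmeas_norm; apply: bmeasB; last exact: bmeas_cst.
  by apply: (bmeas_comp (@continuous_expR R)); apply: bmeasB => //; exact: bmeas_cst.
have b3 : bmeas d (fun t => W t * `|phasesum lam t - S eta t|).
  by apply: bmeasM => //; apply: bmeas_norm; apply: bmeasB => //; exact: (bS continuous_eta).
have hh := expR_ge0 q.
apply: (@le_trans _ _ (tbint d (fun t => expR q * ((W t *
      (gauss 2^-1 (Num.sqrt k * \sum_(j < n) tnth t j) * cos (S eta t)) -
    W t * `|expR (quartic_defect t - q) - 1|) - W t * `|phasesum lam t - S eta t|)))).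
  rewrite tbintZ; last by apply: bmeasB => //; exact: bmeasB.
  rewrite tbintB//; last exact: bmeasB.
  rewrite tbintB//; apply: ler_wpM2l => //; lra.
apply: tbint_le.
- apply: bmeasM; first exact: bmeas_cst.
  by apply: bmeasB => //; exact: bmeasB.
- apply: bmeasM; last exact: (bmeas_comp (@continuous_cos R)).
  apply: (bmeas_comp (@continuous_expR R)); apply: bmeasN.
  apply: (@bmeas_pairsum d n (logmod k)); exact: continuous_logmod.
move=> t _; rewrite weight_split.
set g := gauss _ _; set D := quartic_defect t; set P := phasesum lam t; set H := S eta t.
have g0 : 0 <= g by exact: gauss_ge0.
have g1' : g <= 1 by apply: gauss_le1; rewrite invr_ge0.
have eD : expR D = expR q * expR (D - q) by rewrite -expRD; congr expR; ring.
rewrite eD.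
have key : g * cos H - `|expR (D - q) - 1| - `|P - H| <= g * expR (D - q) * cos P.
  have c1 := norm_cos_sub P H.
  have c2 : `|g * (expR (D - q) - 1) * cos P| <= `|expR (D - q) - 1|.
    rewrite !normrM (ger0_norm g0) mulrAC -[leRHS]mul1r.
    apply: ler_wpM2r => //; rewrite -[leRHS]mulr1; apply: ler_pM => //; exact: cos_max.
  have c3' : `|g * (cos P - cos H)| <= `|P - H|.
    rewrite normrM (ger0_norm g0); apply: le_trans c1.
    by rewrite ler_piMl.
  have := ler_norm (- (g * (expR (D - q) - 1) * cos P)); rewrite normrN.
  have := ler_norm (- (g * (cos P - cos H))); rewrite normrN.
  lra.
have := ler_wpM2l (mulr_ge0 hh (W_ge0 t)) key; lra.
Qed.

(** Equal to [(1 + 2 lam)^2 / k], the squared skewness of the geometric law: the square of its third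
    cumulant over the cube of its variance. *)
Local Notation La := (4 + k^-1).
Local Notation C xi := (int1 d (fun x => gauss A x * cos (eta x + xi * (Num.sqrt k * x)))).

Let sk : 0 < Num.sqrt k. Proof. by rewrite sqrtr_gt0; exact: kappa_gt0. Qed.

Let skd : Num.sqrt k * d <= r.
Proof.
rewrite -(ler_pXn2r (n := 2))// ?nnegrE ?(ltW r0) ?mulr_ge0 ?(ltW sk) ?(ltW d0)//.
by rewrite exprMn sqr_sqrtr// kdr.
Qed.

Let cu xi : continuous (fun x => gauss A x * cos (eta x + xi * (Num.sqrt k * x))).
Proof.
move=> x; apply: cvgM; first exact: continuous_gauss.
apply: (@continuous_comp _ _ _ (fun x : R => eta x + xi * (Num.sqrt k * x)) (@cos R)); last exact: continuous_cos.
apply: cvgD; first exact: continuous_eta.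
by apply: cvgM; [exact: cvg_cst|apply: cvgM; [exact: cvg_cst|exact: cvg_id]].
Qed.

Let continuous_C : continuous (fun xi : R => C xi).
Proof.
apply: (@lipschitz_continuous _ (r * Z)) => x y.
have aux x' y' : C x' <= C y' + (r * Z) * `|x' - y'|.
  rewrite [X in _ <= _ + X](_ : _ = int1 d (fun x => (r * `|x' - y'|) * gauss A x)); last first.
    by rewrite int1Z// ZE; ring.
  rewrite -int1D; last 2 first.
    exact: bmeas1_cont.
    by apply: bmeas1M => //; exact: bmeas1_cst.
  apply: int1_le.
  - exact: bmeas1_cont.
  - apply: bmeas1D; first exact: bmeas1_cont.
    by apply: bmeas1M => //; exact: bmeas1_cst.
  - move=> z zd.
    have h := norm_cos_sub (eta z + x' * (Num.sqrt k * z)) (eta z + y' * (Num.sqrt k * z)).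
    have h2 : `|eta z + x' * (Num.sqrt k * z) - (eta z + y' * (Num.sqrt k * z))| <= r * `|x' - y'|.
      have -> : eta z + x' * (Num.sqrt k * z) - (eta z + y' * (Num.sqrt k * z)) =
        (Num.sqrt k * z) * (x' - y') by ring.
      rewrite normrM ler_wpM2r//; apply: le_trans skd.
      by rewrite normrM (gtr0_norm sk) ler_wpM2l ?(ltW sk)// ler_norml.
    have := ler_norm (cos (eta z + x' * (Num.sqrt k * z)) - cos (eta z + y' * (Num.sqrt k * z))).
    set c1 := cos _ in h *; set c2 := cos _ in h * => h3.
    have h4 : c1 <= c2 + r * `|x' - y'| by lra.
    have := ler_wpM2l (gauss_ge0 A z) h4; rewrite mulrDr => h5.
    by apply: (le_trans h5); rewrite lerD2l mulrC.
have h1 := aux x y; have h2 := aux y x; rewrite distrC in h2.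
by rewrite ler_norml; apply/andP; split; lra.
Qed.

(** The frequency integrand is nonnegative on all of [[-L, L]], so it may be restricted to a window
    of length [1 / La] to the right of the compensating frequency. Dividing by
    [trunc_fourier L 0 <= 2 L] returns to the integral over the box. *)
Lemma main_lower (L : R) : 1 <= L -> L * r + 2 * (n%:R * r ^+ 3) <= 1 ->
  25 <= n%:R :> R -> (La + 1) ^+ 2 <= n%:R -> La + 1 <= L ->
  2 * (n%:R * r) * gauss 2^-1 L <= expR (- (La / 3 + 5)) / La ->
  (expR (- (La / 3 + 5)) / La - 2 * (n%:R * r) * gauss 2^-1 L) / (2 * L) * Z ^+ n <=
  tbint d (fun t => W t *
      (gauss 2^-1 (Num.sqrt k * \sum_(j < n) tnth t j) * cos (S eta t))).
Proof.
move=> L1 C3 n25 LaN LaL Cpos.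
have Z0 := int1_gauss_gt0; have k0 := kappa_gt0; have hd := d0; have hr := r0.
have hl := lam0; have sk0 := sk.
have L0 : 0 < L by lra.
have kV0 : 0 < k^-1 by rewrite invr_gt0.
have La4 : 4 <= La by lra.
have La0 : 0 < La by lra.
have N0 : 0 < n%:R :> R by lra.
have N2 : 0 < n%:R - 2 :> R by lra.
have /andP[m0 m1] := m_bounds.
have A0 := gaussrate_gt0.
have c30 : 0 <= c3.
  by apply: divr_ge0 => //; apply: mulr_ge0; [exact: ltW|lra].
have etaN x : eta (- x) = - eta x by ring.
have u_small xi x : - L <= xi <= L -> - d <= x <= d -> `|eta x + xi * (Num.sqrt k * x)| <= 1.
  move=> xiL xd; apply: le_trans C3; apply: (le_trans (ler_normD _ _)).
  have xi' : `|xi| <= L by rewrite ler_norml.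
  have x' : `|x| <= d by rewrite ler_norml.
  rewrite addrC; apply: lerD.
    rewrite normrM normrM (gtr0_norm sk0); apply: ler_pM => //.
    by apply: le_trans skd; rewrite ler_wpM2l// ltW.
  rewrite normrN normrM [`|c3 * _|]normrM (ger0_norm c30) (gtr0_norm N0).
  have hb : `|x ^+ 3 + 3 * m * x| <= 4 * d ^+ 3.
    apply: (le_trans (ler_normD _ _)).
    have := normX_le 3 xd.
    have : `|3 * m * x| <= 3 * (d ^+ 2 * d).
      rewrite normrM [`|3 * m|]normrM (ger0_norm m0) ger0_norm// -mulrA ler_wpM2l//.
      by apply: ler_pM.
    rewrite (_ : d ^+ 3 = d ^+ 2 * d); last by ring.
    clear LaN Cpos; lra.
  have cn0 : 0 <= c3 * n%:R by rewrite mulr_ge0// ltW.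
  apply: (le_trans (ler_wpM2l cn0 hb)).
  have := ler_wpM2l (ltW N0) kd3.
  have -> : c3 * n%:R * (4 * d ^+ 3) = 4 / 6 * (n%:R * (k * (1 + 2 * lam) * d ^+ 3)) by field.
  clear LaN Cpos; lra.
(* The argument of the cosine is at most 1 in absolute value, so the cosine is at least 1/2. This
   makes the sign of the [n]-th power independent of the parity of [n]. *)
have C_ge0 xi : - L <= xi <= L -> 0 <= C xi.
  move=> xiL.
  have -> : 0 = int1 d (fun=> 0) :> R.
    by rewrite /int1 Rintegral_cst// mul0r.
  apply: int1_le; [exact: bmeas1_cst|exact: bmeas1_cont|].
  move=> x xd; apply: mulr_ge0; first exact: gauss_ge0.
  have := u_small xi x xiL xd; set u := eta x + _ => hu.
  have := vers_le u; have : u ^+ 2 <= 1.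
    by rewrite -real_normK ?num_real// exprn_ile1.
  clear C3 LaN Cpos; lra.
pose J i := int1 d (fun x => x ^+ i * gauss A x).
have J0E : J 0 = Z by rewrite ZE; apply: int1_eq => x _; rewrite expr0 mul1r.
pose a2 := k * (n%:R - 2).
have a20 : 0 < a2 by rewrite mulr_gt0.
have a2E : 2 * A = a2 by rewrite AE /a2; field.
have J2 : a2 * J 2 <= Z by have := @gauss_moment R A d 0 hd isT; rewrite a2E mul1r -J0E.
have J4 : a2 * J 4 <= 3 * J 2 by have := @gauss_moment R A d 2 hd isT; rewrite a2E.
have J6 : a2 * J 6 <= 5 * J 4 by have := @gauss_moment R A d 4 hd isT; rewrite a2E.
have J4p : 0 <= J 4.
  by apply: Rintegral_ge0 => x _; rewrite mulr_ge0 ?gauss_ge0// exprn_even_ge0.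
have J6b : J 6 <= 15 / a2 ^+ 3 * Z.
  have -> : 15 / a2 ^+ 3 * Z = (15 * Z) / a2 ^+ 3 by ring.
  rewrite ler_pdivlMr ?exprn_gt0//.
  have -> : J 6 * a2 ^+ 3 = a2 * (a2 * (a2 * J 6)) by ring.
  have s1 := ler_wpM2l (ltW a20) J6; have s2 := ler_wpM2l (ltW a20) J4.
  have s3 := ler_wpM2l (ltW a20) s1.
  clear C3 LaN Cpos s1; lra.
have J2b : J 2 <= Z / a2 by rewrite ler_pdivlMr// mulrC.
have mb : m <= a2^-1.
  by rewrite mE ler_pdivrMr// mulrC.
(* The frequency at which [xi * sqrt k * x] cancels the linear term of [eta]. *)
pose xi0 := 3 * m * c3 * n%:R / Num.sqrt k.
have xi00 : 0 <= xi0.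
  by rewrite /xi0; apply: divr_ge0; [apply: mulr_ge0; [apply: mulr_ge0 => //; apply: mulr_ge0|]|] => //; exact: ltW.
have c3sq : c3 ^+ 2 = k ^+ 3 * La / 36.
  have -> : k ^+ 3 * La / 36 = k ^+ 2 * (1 + 4 * k) / 36 by field; rewrite gt_eqF.
  by rewrite kE /kappa; field.
have xi02 : xi0 ^+ 2 <= La / 4 * (n%:R ^+ 2 / (n%:R - 2) ^+ 2).
  have -> : xi0 ^+ 2 = 9 * m ^+ 2 * c3 ^+ 2 * n%:R ^+ 2 / k.
    rewrite /xi0 expr_div_n sqr_sqrtr ?(ltW k0)//; ring.
  have msq : m ^+ 2 <= a2^-1 ^+ 2 by rewrite lerXn2r// nnegrE// invr_ge0 ltW.
  have -> : La / 4 * (n%:R ^+ 2 / (n%:R - 2) ^+ 2) =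
    9 * a2^-1 ^+ 2 * (k ^+ 3 * La / 36) * n%:R ^+ 2 / k.
    by rewrite /a2; field; rewrite !gt_eqF.
  rewrite c3sq ler_pM2r// ler_pM2r ?exprn_gt0// ler_pM2r; last first.
    by rewrite divr_gt0// mulr_gt0// exprn_gt0.
  by rewrite ler_pM2l.
(* [v] bounds the mean of [u^2 / 2] under the normalised weight, where [u] is the phase left at
   frequency [xi0 + tau]; the 15 is the sixth Gaussian moment. *)
pose v tau := (15 / 36 * La * (n%:R ^+ 2 / (n%:R - 2) ^+ 3) + tau ^+ 2 / (n%:R - 2)) / 2.
have win tau : 0 <= tau -> La * tau <= 1 ->
    expR (- (La / 3 + 5)) * Z ^+ n <= gauss 2^-1 (xi0 + tau) * C (xi0 + tau) ^+ n /\ xi0 <= La.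
  move=> t0 t1.
  have [v0 v3 xL ex] := window_exponent n25 La4 LaN t0 t1 xi00 xi02 (erefl (v tau)).
  split => //.
  have Cb : Z * (1 - v tau) <= C (xi0 + tau).
    (* This is [cos u >= 1 - u^2 / 2] integrated. In [u^2] the cross term between [x^3] and [tau x]
       is negative because [tau >= 0], so it is dropped: this is why the window lies to the right of
       [xi0]. *)
    apply: (@le_trans _ _ (int1 d (fun x => gauss A x -
        (c3 ^+ 2 * n%:R ^+ 2 / 2 * (x ^+ 6 * gauss A x) +
         (- (c3 * n%:R * Num.sqrt k * tau)) * (x ^+ 4 * gauss A x) +
         k * tau ^+ 2 / 2 * (x ^+ 2 * gauss A x))))).
      have bz (e : R) i : bmeas1 d (fun x => e * (x ^+ i * gauss A x)).
        by apply: bmeas1M => //; exact: bmeas1_cst.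
      rewrite int1B//; last by apply: bmeas1D => //; exact: bmeas1D.
      rewrite int1D//; last exact: bmeas1D.
      rewrite int1D// !int1Z// -/(J 6) -/(J 4) -/(J 2) -ZE.
      have x1 : 0 <= c3 ^+ 2 * n%:R ^+ 2 / 2 by rewrite divr_ge0// mulr_ge0// sqr_ge0.
      have x2 : 0 <= c3 * n%:R * Num.sqrt k * tau * J 4.
        by rewrite mulr_ge0// mulr_ge0// mulr_ge0 ?(ltW sk0)// mulr_ge0// ltW.
      have x3 : 0 <= k * tau ^+ 2 / 2 by rewrite divr_ge0// mulr_ge0 ?sqr_ge0// ltW.
      have y1 := ler_wpM2l x1 J6b; have y3 := ler_wpM2l x3 J2b.
      have vE : Z * v tau = c3 ^+ 2 * n%:R ^+ 2 / 2 * (15 / a2 ^+ 3 * Z) + k * tau ^+ 2 / 2 * (Z / a2).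
        by rewrite c3sq /v /a2; field; rewrite !gt_eqF.
      rewrite mulrBr mulr1 vE lerD2l lerN2; apply: lerD => //; apply: le_trans y1.
      by rewrite mulNr gerDl oppr_le0.
    apply: int1_le; [|exact: bmeas1_cont|].
      apply: bmeas1_cont => x; apply: cvgB; first exact: continuous_gauss.
      apply: cvgD; last by apply: cvgM; [exact: cvg_cst|exact: continuous_Xgauss].
      by apply: cvgD; apply: cvgM; by [exact: cvg_cst|exact: continuous_Xgauss].
    move=> x _.
    have -> : eta x + (xi0 + tau) * (Num.sqrt k * x) =
       - (c3 * n%:R * x ^+ 3) + Num.sqrt k * tau * x.
      by rewrite /xi0; field; rewrite gt_eqF.
    set u := - _ + _.
    have uE : u ^+ 2 / 2 = c3 ^+ 2 * n%:R ^+ 2 / 2 * x ^+ 6 -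
        c3 * n%:R * Num.sqrt k * tau * x ^+ 4 + k * tau ^+ 2 / 2 * x ^+ 2.
      have -> : k * tau ^+ 2 / 2 * x ^+ 2 = Num.sqrt k ^+ 2 * tau ^+ 2 / 2 * x ^+ 2.
        by rewrite sqr_sqrtr// ltW.
      by rewrite /u; field.
    have := vers_le u; rewrite uE => hv.
    have := ler_wpM2l (gauss_ge0 A x) hv; rewrite mulrBr mulr1 lerBlDr -lerBlDl.
    by apply: le_trans; rewrite le_eqVlt; apply/orP; left; apply/eqP; ring.
  have e1 := expR_le_1B v0 v3.
  have e2 : (Z * expR (- (v tau + 2 * v tau ^+ 2))) ^+ n <= C (xi0 + tau) ^+ n.
    rewrite lerXn2r ?nnegrE ?mulr_ge0 ?expR_ge0 ?(ltW Z0)//.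
      apply: le_trans Cb; apply: mulr_ge0; first exact: ltW.
      by rewrite subr_ge0 -(ler_pM2l (_ : 0 < 3))// (le_trans v3)// mulr1 ler1n.
    by apply: le_trans Cb; rewrite ler_wpM2l// ltW.
  have e3 := ler_wpM2l (gauss_ge0 2^-1 (xi0 + tau)) e2.
  apply: le_trans e3; rewrite exprMn mulrCA mulrC; apply: ler_wpM2l.
    by rewrite exprn_ge0// ltW.
  rewrite -expRM_natl /gauss -expRD ler_expR lerNl; apply: le_trans ex.
  by rewrite le_eqVlt; apply/orP; left; apply/eqP; field.
have [_ xiL] := win 0 (lexx 0) (ltac:(by rewrite mulr0)).
have LaV : 0 < La^-1 by rewrite invr_gt0.
have LaV1 : La^-1 <= 1 by rewrite invf_le1// (le_trans _ La4)// ler1n.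
have bI : bmeas1 L (fun xi => gauss 2^-1 xi * C xi ^+ n).
  apply: bmeas1_cont => x; apply: cvgM; first exact: continuous_gauss.
  apply: (@continuous_comp _ _ _ (fun xi : R => C xi) (fun y : R => y ^+ n)); first exact: continuous_C.
  exact: exprn_continuous.
have I0 xi : - L <= xi <= L -> 0 <= gauss 2^-1 xi * C xi ^+ n.
  by move=> xiL'; apply: mulr_ge0; [exact: gauss_ge0|exact/exprn_ge0/C_ge0].
have hI := @int1_ge_window L xi0 (xi0 + La^-1) (expR (- (La / 3 + 5)) * Z ^+ n) _ bI I0.
have {}hI : expR (- (La / 3 + 5)) * Z ^+ n * (xi0 + La^-1 - xi0) <=
    int1 L (fun xi => gauss 2^-1 xi * C xi ^+ n).
  apply: hI.
  - by apply: le_trans xi00; rewrite oppr_le0 ltW.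
  - by rewrite lerDl ltW.
  - exact: le_trans (lerD xiL LaV1) LaL.
  move=> x /andP[x1 x2].
  have -> : x = xi0 + (x - xi0) by ring.
  apply: (win _ _ _).1; first by rewrite subr_ge0.
  by rewrite -ler_pdivlMl// mulr1 lerBlDl.
have K0 := trunc_fourier0_gt0 L0; have K1 := trunc_fourier0_le L0.
have Zn : 0 < Z ^+ n by rewrite exprn_gt0.
have h := main_term_ge n L0 (ltW A0) (ltW sk) (ltW d0) continuous_eta etaN.
rewrite -ZE in h.
set M := tbint _ _ in h *.
pose B := expR (- (La / 3 + 5)) / La - 2 * (n%:R * r) * gauss 2^-1 L.
have B0 : 0 <= B by rewrite /B subr_ge0.
have hM : B * Z ^+ n <= trunc_fourier L 0 * M.
  apply: le_trans h; rewrite /B mulrBl lerB//.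
    apply: le_trans hI.
    by rewrite le_eqVlt; apply/orP; left; apply/eqP; ring.
  have : Num.sqrt k * (n%:R * d) <= n%:R * r.
    by rewrite mulrCA ler_wpM2l// ltW.
  move=> h1; apply: ler_wpM2r; first exact: ltW.
  apply: ler_wpM2r; first exact: gauss_ge0.
  by rewrite ler_pM2l.
have M0 : 0 <= M.
  have : 0 <= trunc_fourier L 0 * M by apply: le_trans hM; rewrite mulr_ge0// ltW.
  by rewrite pmulr_rge0.
rewrite -/B mulrAC ler_pdivrMr ?mulr_gt0//.
apply: (le_trans hM); rewrite mulrC; exact: ler_wpM2l.
Qed.

End central.
End estimates.

(** * Coordinates away from the poles *)

Section trig.
Context (R : realType).
Implicit Types (x y w : R).

(** Since [2 vers z = |e^(i z) - 1|^2], this is the triangle inequality with squares; the difference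
    of the two sides is half of [|e^(i (x + y)) - 2 e^(i x) + 1|^2]. *)
Lemma versD_le x y : vers (x + y) <= 2 * vers x + 2 * vers y.
Proof.
have h : 2 * (2 * vers x + 2 * vers y - vers (x + y)) =
  (cos (x + y) - 2 * cos x + 1) ^+ 2 + (sin (x + y) - 2 * sin x) ^+ 2.
  have e1 := cos2Dsin2 (x + y); have e2 := cos2Dsin2 x.
  have e3 : cos (x + y) * cos x + sin (x + y) * sin x = cos y.
    by rewrite -cosB; congr cos; ring.
  have -> : (cos (x + y) - 2 * cos x + 1) ^+ 2 + (sin (x + y) - 2 * sin x) ^+ 2 =
    (cos (x + y) ^+ 2 + sin (x + y) ^+ 2) + 4 * (cos x ^+ 2 + sin x ^+ 2) + 1 -
    4 * (cos (x + y) * cos x + sin (x + y) * sin x) + 2 * cos (x + y) - 4 * cos x by ring.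
  by rewrite e1 e2 e3 /vers; ring.
have := addr_ge0 (sqr_ge0 (cos (x + y) - 2 * cos x + 1)) (sqr_ge0 (sin (x + y) - 2 * sin x)).
rewrite -h; lra.
Qed.

Lemma versB_le x y : vers (x - y) <= 2 * vers x + 2 * vers y.
Proof. by rewrite -[vers y]versN; exact: versD_le. Qed.

(** The right side is [|e^(i x) - e^(-i y)|^2], of which the left side is the imaginary part
    squared. *)
Lemma versD_ge_sin x y : (sin x + sin y) ^+ 2 <= 2 * vers (x + y).
Proof.
rewrite /vers cosD; have := sqr_ge0 (cos x - cos y).
have := cos2Dsin2 x; have := cos2Dsin2 y; lra.
Qed.

Definition is_pole w := w = 0 \/ w = pi.

Lemma vers_pole w x y : is_pole w -> vers (x + w + (y + w)) = vers (x + y).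
Proof.
case=> ->; first by rewrite !addr0.
have -> : x + pi + (y + pi) = x + y + pi *+ 2 by rewrite mulr2n; ring.
by rewrite /vers cosD2pi.
Qed.

Lemma sin_pole w x : is_pole w -> sin (x + w) ^+ 2 = sin x ^+ 2.
Proof. by case=> ->; rewrite ?addr0// sinDpi sqrrN. Qed.

Lemma sin2_vers x : sin x ^+ 2 = vers x * (2 - vers x).
Proof. by rewrite sin2cos2 /vers; ring. Qed.

Lemma vers_double x : vers (x + x) = 2 * sin x ^+ 2.
Proof. by rewrite /vers cosD -!expr2 cos2sin2; ring. Qed.

(** [vers (2 x) = 2 (1 - cos x) (1 + cos x)]; the larger factor is at least 1, and the pole is
    chosen to make [vers (x + w)] the smaller one. *)
Lemma near_pole x : exists2 w, is_pole w & 2 * vers (x + w) <= vers (x + x).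
Proof.
rewrite vers_double sin2cos2.
have h1 := cos_le1 x; have h2 := cos_geN1 x.
have [c0|c0] := leP 0 (cos x).
  by exists 0; [left|rewrite addr0 /vers; nra].
by exists pi; [right|rewrite /vers cosDpi; nra].
Qed.

Lemma logmod_ge k x (y : R) : 0 <= y -> y <= k * vers x -> 2 * y <= 1 ->
  y / 2 <= logmod k x.
Proof.
move=> y0 yk y1; rewrite /logmod ler_pM2r//.
apply: (@le_trans _ _ (ln (1 + 2 * y))).
  have y2 : 0 <= 2 * y by lra.
  have /andP[h2 _] := ln1D_bounds y2; nra.
by rewrite ler_ln ?posrE; lra.
Qed.

(** The second-order term of the logarithm costs [(k u^2)^2 / 4 <= 2 c k u^2], which is the relative
    loss [4 c]. *)
Lemma logmod_ge_sq k x u c : 0 <= k -> u ^+ 2 <= 2 * vers x -> k * u ^+ 2 <= 8 * c ->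
  k / 2 * (1 - 4 * c) * u ^+ 2 <= logmod k x.
Proof.
move=> k0 uv ku; rewrite /logmod.
have ku0 : 0 <= k * u ^+ 2 by rewrite mulr_ge0// sqr_ge0.
have /andP[h _] := ln1D_bounds ku0.
have h2 : ln (1 + k * u ^+ 2) <= ln (1 + 2 * k * vers x).
  have := ler_wpM2l k0 uv => ?; by rewrite ler_ln ?posrE; lra.
have h3 : (k * u ^+ 2) ^+ 2 <= (k * u ^+ 2) * (8 * c).
  by rewrite expr2 ler_wpM2l.
lra.
Qed.

End trig.

(** * Most coordinates lie near a common pole *)

Section structure.
Context (R : realType).

(* Since few pairs carry a large [logmod], some [th j0] is almost antipodal to
   most of the others, two of which are almost antipodal to each other; hence
   [2 th j0] is almost a multiple of [2 pi]. *)
Lemma most_near_pole (n : nat) (th : 'I_n -> R) (k x0 E : R) :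
  0 < k -> 0 < x0 -> 2 * x0 <= 1 -> 16 <= n%:R :> R ->
  pairsum (fun j i => logmod k (th j + th i)) <= E ->
  64 * E <= x0 * n%:R ^+ 2 ->
  exists2 w, is_pole w &
    #|[set i | 12 * x0 < k * vers (th i + w)]%SET|%:R <= 4 * E / (x0 * n%:R) + 1.
Proof.
move=> k0 x00 x01 n16 hE En.
have N0 : 0 < n%:R :> R by lra.
pose bad (j i : 'I_n) := (j != i) && (x0 < k * vers (th j + th i)).
have badC j i : bad j i = bad i j by rewrite /bad eq_sym addrC.
pose P := 4 * E / x0.
have P16 : P <= n%:R ^+ 2 / 16 by rewrite /P ler_pdivrMr//; lra.
have badsum : \sum_j \sum_i (bad j i)%:R <= P.
  pose G j i := (bad j i)%:R * (x0 / 2).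
  have GL : pairsum G <= E.
    apply: le_trans hE; apply: pairsum_le => j i; rewrite /G.
    case: (boolP (bad j i)) => [/andP[_ h]|_].
      rewrite mul1r; apply: logmod_ge => //; exact: ltW.
    by rewrite mul0r logmod_ge0// ltW.
  have := @pairsum_double R n G (fun j i => congr1 (fun b : bool => b%:R * (x0 / 2)) (badC j i)).
  have -> : \sum_(j < n) G j j = 0 by rewrite big1// => j _; rewrite /G /bad eqxx mul0r.
  have -> : \sum_(j < n) \sum_(i < n) G j i = (\sum_j \sum_i (bad j i)%:R) * (x0 / 2).
    by rewrite mulr_suml; apply: eq_bigr => j _; rewrite mulr_suml.
  by rewrite /P ler_pdivlMr//; lra.
pose deg j := #|[set i | bad j i]%SET|.
have degE j : (deg j)%:R = \sum_i (bad j i)%:R :> R.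
  rewrite /deg -sum1_card natr_sum big_mkcond; apply: eq_bigr => i _.
  by rewrite inE; case: (bad j i).
(* An index with at most the average number of bad partners. *)
have [j0 hj0] : exists j0, n%:R * (deg j0)%:R <= P.
  apply: contrapT => hN.
  have h j : P < n%:R * (deg j)%:R.
    by rewrite ltNge; apply/negP => h; apply: hN; exists j.
  have : \sum_(j < n) P < \sum_(j < n) n%:R * (deg j)%:R.
    apply: ltr_sum => [|j _]; last exact: h.
    have n0 : (0 < n)%N by rewrite -(ltr0n R).
    by apply/hasP; exists (Ordinal n0) => //; rewrite mem_index_enum.
  rewrite sumr_const card_ord -mulr_sumr -[P *+ n]mulr_natl ltr_pM2l//.
  by under eq_bigr do rewrite degE; rewrite ltNge badsum.
pose M0 := (~: (j0 |: [set i | bad j0 i]))%SET.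
have cM : #|(~: M0)%SET|%:R <= P / n%:R + 1 :> R.
  rewrite finset.setCK.
  apply: (@le_trans _ _ ((deg j0).+1%:R)).
    by rewrite ler_nat cardsU1 -add1n leq_add2r leq_b1.
  rewrite -natr1 lerD2r ler_pdivlMr// mulrC; exact: hj0.
have Mn : #|M0|%:R + #|(~: M0)%SET|%:R = n%:R :> R.
  by rewrite -natrD cardsC card_ord.
(* Otherwise all ordered pairs of distinct elements of [M0] are bad: at least [(7/8 n) (13/16 n)] of
   them, against at most [n^2 / 16]. *)
have [i [i' [iM iM' ii' nb]]] : exists i i', [/\ i \in M0, i' \in M0, i != i' & ~~ bad i i'].
  apply: contrapT => hN.
  have h i i' : i \in M0 -> i' \in M0 -> i != i' -> bad i i'.
    by move=> iM iM' ii'; apply: contrapT => /negP nb; apply: hN; exists i, i'.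
  have degM i : i \in M0 -> #|M0|%:R - 1 <= (deg i)%:R :> R.
    move=> iM; rewrite lerBlDr natr1 ler_nat (cardsD1 i M0) iM add1n ltnS.
    apply: subset_leq_card; apply/fintype.subsetP => i'; rewrite !inE => /andP[ii' iM'].
    by apply: h => //; [rewrite !inE|rewrite eq_sym].
  have : \sum_(i in M0) (#|M0|%:R - 1) <= P :> R.
    apply: le_trans badsum.
    rewrite [leRHS](bigID (fun i => i \in M0))/= -[leLHS]addr0 lerD//.
      by apply: ler_sum => i iM; rewrite -degE; exact: degM.
    by apply: sumr_ge0 => i _; apply: sumr_ge0 => i' _; exact: ler0n.
  rewrite sumr_const -[X in X <= _ -> _]mulr_natl.
  have Pn : P / n%:R <= n%:R / 16.
    rewrite ler_pdivrMr//; apply: (le_trans P16).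
    by rewrite le_eqVlt; apply/orP; left; apply/eqP; field.
  have m1 : 7 / 8 * n%:R <= #|M0|%:R :> R by move: Mn cM; lra.
  set mm := #|M0|%:R in m1 * => hm.
  have : (7 / 8 * n%:R) * (13 / 16 * n%:R) <= mm * (mm - 1).
    by clear -m1 n16; apply: ler_pM; lra.
  have : 0 < n%:R ^+ 2 :> R by rewrite exprn_gt0.
  move: hm P16; lra.
have small j : j \in M0 -> k * vers (th j0 + th j) <= x0.
  rewrite !inE negb_or /bad => /andP[jj0]; rewrite eq_sym jj0 /=.
  by rewrite -leNgt.
have hi := small i iM; have hi' := small i' iM'.
have hii : k * vers (th i + th i') <= x0.
  by move: nb; rewrite /bad ii' /= -leNgt.
have [w pw hw] := near_pole (th j0).
have k0' := ltW k0.
(* By [versD_le] and [versB_le], [k vers (2 th j0) <= 2 x0 + 2 (2 x0 + 2 x0) = 10 x0], and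
   [near_pole] halves this. *)
have hj : k * vers (th j0 + w) <= 5 * x0.
  have e : th j0 + th j0 = (th j0 + th i) + ((th j0 + th i') - (th i + th i')) by ring.
  have h1 := versD_le (th j0 + th i) ((th j0 + th i') - (th i + th i')).
  have h2 := versB_le (th j0 + th i') (th i + th i').
  rewrite -e in h1.
  have h3 : 2 * vers (th j0 + w) <= 2 * vers (th j0 + th i) +
     2 * (2 * vers (th j0 + th i') + 2 * vers (th i + th i')) by lra.
  have := ler_wpM2l k0' h3; lra.
exists w => //.
have PE : P / n%:R + 1 = 4 * E / (x0 * n%:R) + 1.
  by rewrite /P; field; rewrite !gt_eqF.
rewrite -PE; apply: le_trans cM; rewrite ler_nat.
apply: subset_leq_card; apply/fintype.subsetP => j.
rewrite inE => hlt; rewrite inE; apply/negP => jM.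
have hj' := small j jM.
(* Gives [2 x0 + 2 * 5 x0], the threshold [12 x0] of the statement. *)
have e : th j + w = (th j + w + (th j0 + w)) - (th j0 + w) by ring.
have := versB_le (th j + w + (th j0 + w)) (th j0 + w).
rewrite -e vers_pole// [th j + th j0]addrC => h.
have := ler_wpM2l k0' h; lra.
Qed.

End structure.

(** * Product bound for the modulus away from the boxes *)

Section region.
Context (R : realType).

Lemma sum_ifE (n : nat) (P : pred 'I_n) (x y : R) :
  \sum_i (if P i then x else y) = n%:R * x - #|[set i | ~~ P i]%SET|%:R * (x - y).
Proof.
have -> : #|[set i | ~~ P i]%SET|%:R = \sum_i (~~ P i)%:R :> R.
  rewrite -sum1_card natr_sum big_mkcond; apply: eq_bigr => i _.
  by rewrite inE; case: (P i).
have -> : n%:R * x = \sum_(i < n) x by rewrite sumr_const card_ord mulr_natl.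
rewrite mulr_suml -sumrB; apply: eq_bigr => i _.
by case: (P i) => /=; ring.
Qed.

(** Pairs of good coordinates yield the quadratic form in the sines, and those with one bad member a
    gain attributed to it. A bad coordinate gains against almost all others, which lie within
    [12 x0] of the pole; the at most [Q] exceptions are charged [X1], enough to pay for the sine of
    a good partner. The square of the sum of the sines is dropped. *)
Lemma region_bound (n : nat) (th : 'I_n -> R) (k w x0 X1 X2 Q : R) (b0 : 'I_n) :
  is_pole w -> 0 < k -> 0 < x0 -> 48 * x0 <= X1 -> X1 <= X2 -> 4 * X2 <= 1 ->
  #|[set i | 12 * x0 < k * vers (th i + w)]%SET|%:R <= Q ->
  Q <= n%:R / 2 -> 12 * n%:R * x0 + Q * X1 <= n%:R * X1 / 32 ->
  X2 < k * vers (th b0 + w) ->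
  k / 2 * (1 - 4 * X1) * (n%:R - 2) *
    \sum_j (if k * vers (th j + w) <= X1 then sin (th j) ^+ 2 else 0) +
  \sum_j (if k * vers (th j + w) <= X1 then 0 else n%:R * X1 / 32) +
  n%:R * (X2 - X1) / 16 <= pairsum (fun j i => logmod k (th j + th i)).
Proof.
move=> pw k0 x00 x0X1 X12 X21 hQ Qn small hb0.
pose good j := k * vers (th j + w) <= X1.
pose near i := ~~ (12 * x0 < k * vers (th i + w)).
pose s j := if good j then sin (th j) else 0.
pose K := k / 2 * (1 - 4 * X1).
have K0 : 0 <= K by rewrite /K mulr_ge0//; lra.
have Kk : K <= k / 2.
  by rewrite /K ler_piMr//; lra.
(* The gain of a bad [j] against a near coordinate: [b0] is beyond [X2], any other bad one only
   beyond [X1]. *)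
pose y j := if j == b0 then X2 / 8 else X1 / 8.
pose h j i := if good j then 0 else if near i then y j - 12 * x0 else - X1 - 12 * x0.
have near_good i : near i -> good i by rewrite /near /good -leNgt; lra.
have bad_near j i : ~~ good j -> near i -> y j <= logmod k (th j + th i).
  move=> bj ni.
  have e : th j + w = (th j + w + (th i + w)) - (th i + w) by ring.
  have hv := versB_le (th j + w + (th i + w)) (th i + w).
  rewrite -e vers_pole// in hv.
  have {}hv := ler_wpM2l (ltW k0) hv.
  move: ni; rewrite /near -leNgt => ni.
  (* [versB_le] gives [k vers (th j + th i) >= Y / 2 - 12 x0], which is at least [Y / 4] because
     [48 x0 <= X1 <= Y]; [logmod_ge] halves it once more. *)
  have gen (Y : R) : X1 <= Y -> Y <= X2 -> Y <= k * vers (th j + w) ->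
      Y / 8 <= logmod k (th j + th i).
    move=> Y1 Y2 Yj.
    have -> : Y / 8 = Y / 4 / 2 by lra.
    by clear -Y1 Y2 Yj hv ni x00 x0X1 X12 X21; apply: logmod_ge; lra.
  rewrite /y; case: eqP => [jb|_]; apply: gen => //.
    by rewrite jb; exact: ltW.
  by move: bj; rewrite /good -ltNge => /ltW.
have ssq i : k * sin (th i) ^+ 2 <= 2 * (k * vers (th i + w)).
  rewrite -(sin_pole (th i) pw) sin2_vers.
  have v0 := vers_ge0 (th i + w).
  have : vers (th i + w) * (2 - vers (th i + w)) <= 2 * vers (th i + w) by nra.
  by move=> /(ler_wpM2l (ltW k0)); lra.
have pair j i : K * (s j + s i) ^+ 2 + (h j i + h i j) <= logmod k (th j + th i).
  have L0 : 0 <= logmod k (th j + th i) by apply: logmod_ge0; exact: ltW.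
  have mixed j' i' : ~~ good j' -> good i' ->
      K * sin (th i') ^+ 2 + h j' i' <= logmod k (th j' + th i').
    move=> bj gi; rewrite /h (negbTE bj).
    have h1 : K * sin (th i') ^+ 2 <= k * sin (th i') ^+ 2 / 2.
      by have := ler_wpM2r (sqr_ge0 (sin (th i'))) Kk; lra.
    have h2 := ssq i'.
    have L1 : 0 <= logmod k (th j' + th i') by apply: logmod_ge0; exact: ltW.
    case: ifPn => ni.
      have := bad_near _ _ bj ni; move: ni; rewrite /near -leNgt; lra.
    move: gi; rewrite /good; lra.
  have sE j' : good j' -> s j' = sin (th j') by rewrite /s => ->.
  have sE0 j' : ~~ good j' -> s j' = 0 by rewrite /s => /negbTE->.
  have hE0 j' i' : good j' -> h j' i' = 0 by rewrite /h => ->.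
  have [gj|bj] := boolP (good j); have [gi|bi] := boolP (good i).
  - rewrite !sE// !hE0// !addr0; apply: logmod_ge_sq; first exact: ltW.
      exact: versD_ge_sin.
    have hj := ssq j; have hi := ssq i.
    have : (sin (th j) + sin (th i)) ^+ 2 <= 2 * sin (th j) ^+ 2 + 2 * sin (th i) ^+ 2.
      have := sqr_ge0 (sin (th j) - sin (th i)); lra.
    move=> /(ler_wpM2l (ltW k0)); move: gj gi; rewrite /good; lra.
  - rewrite (sE _ gj) (sE0 _ bi) (hE0 _ _ gj) addr0 add0r [th j + _]addrC; have := mixed i j bi gj; lra.
  - rewrite (sE0 _ bj) (sE _ gi) (hE0 _ _ gi) add0r addr0; exact: mixed.
  - rewrite !sE0// addr0 expr0n mulr0 add0r.
    have hn j' i' : ~~ good j' -> ~~ good i' -> h j' i' <= 0.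
      move=> bj' bi'; rewrite /h (negbTE bj').
      by case: ifPn => [/near_good|_]; [rewrite (negbTE bi')|lra].
    have := hn _ _ bj bi; have := hn _ _ bi bj; lra.
have := pairsum_le pair; rewrite pairsumD pairsumZ pairsum_sq.
set S1 := (\sum_j s j ^+ 1) ^+ 2.
have S10 : 0 <= S1 by exact: sqr_ge0.
have -> : \sum_j s j ^+ 2 =
    \sum_j (if k * vers (th j + w) <= X1 then sin (th j) ^+ 2 else 0).
  by apply: eq_bigr => j _; rewrite /s /good; case: ifP; rewrite ?expr0n.
set SS := \sum_j (if _ then sin (th j) ^+ 2 else 0).
have := pairsum_double (fun j i => addrC (h j i) (h i j)).
have -> : \sum_j \sum_i (h j i + h i j) = 2 * \sum_j \sum_i h j i.
  rewrite mulr2n mulrDl mul1r; transitivity (\sum_j (\sum_i h j i + \sum_i h i j)).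
    by apply: eq_bigr => j _; rewrite big_split.
  by rewrite big_split/= [X in _ + X]exchange_big.
have hjj : \sum_j (h j j + h j j) <= 0.
  rewrite -oppr_ge0 -sumrN; apply: sumr_ge0 => j _; rewrite /h.
  case: ifPn => [|bj]; first by rewrite addr0 oppr0.
  by case: ifPn => [/near_good|_]; [rewrite (negbTE bj)|lra].
have hsum : \sum_j (if k * vers (th j + w) <= X1 then 0 else n%:R * X1 / 32) +
    n%:R * (X2 - X1) / 16 <= \sum_j \sum_i h j i.
  have -> : n%:R * (X2 - X1) / 16 = \sum_j (if j == b0 then n%:R * (X2 - X1) / 16 else 0).
    by rewrite -big_mkcond big_pred1_eq.
  rewrite -big_split/=; apply: ler_sum => j _; rewrite /h /good.
  case: ifPn => [gj|bj].
    rewrite big1// add0r; case: eqP => // jb; move: gj; rewrite jb; lra.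
  rewrite (@sum_ifE n near).
  have -> : #|[set i | ~~ near i]%SET| = #|[set i | 12 * x0 < k * vers (th i + w)]%SET|.
    by apply: eq_card => i; rewrite !inE /near negbK.
  set q := #|_|%:R in hQ *.
  have y0 : 0 <= y j by rewrite /y; case: ifP => _; clear -x00 x0X1 X12; lra.
  have h1 : q * (y j + X1) <= Q * (y j + X1).
    by apply: ler_wpM2r => //; clear -y0 x00 x0X1; lra.
  have h2 : Q * y j <= n%:R / 2 * y j by apply: ler_wpM2r.
  by move: h1 h2; rewrite /y; case: eqP => _ h1 h2; clear -h1 h2 small; nra.
move=> h1 h2; have : 0 <= K * S1 by rewrite mulr_ge0.
rewrite /K in h2 *; move: hsum hjj h1 h2.
set a1 := \sum_j \sum_i _; set a2 := \sum_j (h j j + _).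
set a3 := pairsum _; set a4 := pairsum _.
set a5 := \sum_j (if _ then 0 else _); clearbody a1 a2 a3 a4 a5 SS S1.
set a6 := n%:R * (X2 - X1) / 16; set a7 := k / 2 * (1 - 4 * X1); clearbody a6 a7.
clear; lra.
Qed.

(** Per-coordinate majorant: a Gaussian in [sin x] close to the pole [w], a flat price [e^(-bt)]
    elsewhere. The square of the sine is the same at both poles. *)
Definition regionfun (k w X1 bt A x : R) : R :=
  if k * vers (x + w) <= X1 then expR (- (A * sin x ^+ 2)) else expR (- bt).

Lemma region_exp (n : nat) (th : 'I_n -> R) (k w x0 X1 X2 Q : R) (b0 : 'I_n) :
  is_pole w -> 0 < k -> 0 < x0 -> 48 * x0 <= X1 -> X1 <= X2 -> 4 * X2 <= 1 ->
  #|[set i | 12 * x0 < k * vers (th i + w)]%SET|%:R <= Q ->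
  Q <= n%:R / 2 -> 12 * n%:R * x0 + Q * X1 <= n%:R * X1 / 32 ->
  X2 < k * vers (th b0 + w) ->
  expR (- pairsum (fun j i => logmod k (th j + th i))) <=
  expR (- (n%:R * (X2 - X1) / 16)) * \prod_j
    regionfun k w X1 (n%:R * X1 / 32) (k / 2 * (1 - 4 * X1) * (n%:R - 2)) (th j).
Proof.
move=> pw k0 x00 x0X1 X12 X21 hQ Qn small hb0.
have := region_bound pw k0 x00 x0X1 X12 X21 hQ Qn small hb0.
set SS := \sum_j (if _ then sin (th j) ^+ 2 else 0); set TT := \sum_j (if _ then 0 else _) => h.
have -> : \prod_j regionfun k w X1 (n%:R * X1 / 32) (k / 2 * (1 - 4 * X1) * (n%:R - 2)) (th j)
   = expR (- (k / 2 * (1 - 4 * X1) * (n%:R - 2) * SS + TT)).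
  rewrite /SS /TT mulr_sumr -big_split/= -sumrN expR_sum.
  apply: eq_bigr => j _; rewrite /regionfun.
  by case: ifP => _; rewrite ?addr0// mulr0 add0r.
by rewrite -expRD ler_expR; lra.
Qed.

End region.

(** * The one-dimensional majorant *)

Section onedim.
Context (R : realType).
Local Notation leb := (@lebesgue_measure R).
Implicit Types (f : R -> R) (A a b c d k s w x : R).

Lemma continuous_Rintegrable f a b : continuous f ->
  leb.-integrable `[a, b] (EFin \o f).
Proof.
move=> cf; apply: continuous_compact_integrable; first exact: segment_compact.
exact: continuous_subspaceT.
Qed.

Lemma Rintegral_split f a b c : continuous f -> a <= b -> b <= c ->
  \int[leb]_(x in `[a, c]) f x =
  \int[leb]_(x in `[a, b]) f x + \int[leb]_(x in `[b, c]) f x.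
Proof.
move=> cf ab bc; have iac := continuous_Rintegrable a c cf.
have := Rintegral_itvB iac (x := b); rewrite !bnd_simp => /(_ ab bc).
rewrite Rintegral_itv_obnd_cbnd => [<-|]; first by rewrite addrC subrK.
apply: integrableS (continuous_Rintegrable b c cf) => //.
by move=> x /=; rewrite !in_itv/= => /andP[/ltW-> ->].
Qed.

Lemma Rintegral_subset_le disp (T : measurableType disp) (mu : {measure set T -> \bar R})
    (D D' : set T) (f : T -> R) : measurable D -> measurable D' -> D `<=` D' ->
  mu.-integrable D' (EFin \o f) -> (forall z, D' z -> 0 <= f z) ->
  \int[mu]_(z in D) f z <= \int[mu]_(z in D') f z.
Proof.
move=> mD mD' DD' fi f0; have fiD := integrableS mD' mD DD' fi.
rewrite /Rintegral; apply: fine_le.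
- exact: integrable_fin_num fiD.
- exact: integrable_fin_num fi.
- apply: ge0_subset_integral => //; first exact: measurable_int fi.
Qed.

Lemma int1_widen f c d : continuous f -> (forall x, 0 <= f x) -> c <= d ->
  int1 c f <= int1 d f.
Proof.
move=> cf f0 cd; apply: Rintegral_subset_le => //; last exact: continuous_Rintegrable.
move=> x /=; rewrite !in_itv/= => /andP[h1 h2].
by rewrite (le_trans _ h1) ?(le_trans h2)// lerN2.
Qed.

Lemma Rintegral_le_cst f a b c : continuous f -> a <= b ->
  (forall x, a <= x <= b -> f x <= c) -> \int[leb]_(x in `[a, b]) f x <= c * (b - a).
Proof.
move=> cf ab fc.
have -> : c * (b - a) = \int[leb]_(x in `[a, b]) c.
  rewrite Rintegral_cst// /= lebesgue_measure_itv/= lte_fin.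
  have [ab'|ba] := ltP a b; first by rewrite -EFinB.
  by rewrite (_ : b = a) ?subrr//; apply/eqP; rewrite eq_le ba.
apply: le_Rintegral => //; first exact: continuous_Rintegrable.
  by apply: (@continuous_Rintegrable (fun=> c)) => x; exact: cvg_cst.
Qed.

Lemma gauss_anti A x y : 0 <= A -> `|x| <= `|y| -> gauss A y <= gauss A x.
Proof.
move=> A0 xy; rewrite /gauss ler_expR lerN2 ler_wpM2l//.
by rewrite -(real_normK (num_real x)) -(real_normK (num_real y)) lerXn2r// nnegrE.
Qed.

Lemma int1_gauss_tail A d c : 0 <= A -> 0 <= d -> d <= c ->
  int1 c (gauss A) <= int1 d (gauss A) + 2 * c * gauss A d.
Proof.
move=> A0 d0 dc; have cg := @continuous_gauss R A.
have g0 := gauss_ge0 A d.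
have e1 : `|d| = d by rewrite ger0_norm.
have h1 : \int[leb]_(x in `[- c, - d]) gauss A x <= gauss A d * (- d - - c).
  apply: Rintegral_le_cst => //; first lra.
  move=> x /andP[_ xd]; apply: gauss_anti => //; rewrite e1.
  by rewrite ler0_norm; lra.
have h2 : \int[leb]_(x in `[d, c]) gauss A x <= gauss A d * (c - d).
  apply: Rintegral_le_cst => //.
  move=> x /andP[xd _]; apply: gauss_anti => //; rewrite e1.
  by rewrite ger0_norm; lra.
have h3 : 0 <= gauss A d * d by rewrite mulr_ge0.
rewrite /int1 (@Rintegral_split _ (- c) (- d) c)//; [|lra|lra].
rewrite (@Rintegral_split _ (- d) d c)//; last lra.
by move: h1 h2 h3; clear; lra.
Qed.

Lemma int1_gauss_scale A s c : 0 < s -> 0 <= c ->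
  s * int1 c (gauss (A * s ^+ 2)) = int1 (s * c) (gauss A).
Proof.
move=> s0 c0; have cg := @continuous_gauss R A.
have := @Rintegral_affine R (gauss A) (- c) c s 0 s0 _ cg.
rewrite !addr0 mulrN => h; rewrite /int1 h; last lra.
congr (_ * _); apply: eq_Rintegral => x _.
suff e (y : R) : gauss (A * s ^+ 2) y = gauss A (s * y + 0) by exact: e.
by rewrite /gauss; congr expR; rewrite addr0; ring.
Qed.

Lemma Rintegral_shift f a b c : continuous f -> a <= b ->
  \int[leb]_(x in `[a, b]) f (x + c) = \int[leb]_(x in `[a + c, b + c]) f x.
Proof.
move=> cf ab; have := Rintegral_affine c ltr01 ab cf.
rewrite [1 * a]mul1r [1 * b]mul1r => ->; rewrite [RHS]mul1r.
by congr (Rintegral _ _ _); apply/funext => x; rewrite mul1r.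
Qed.

(** For the pole [pi] the mass of [[-pi, pi]] sits at both ends; translated, the two halves form one
    centred Gaussian. *)
Lemma int1_gauss_shift A c : 0 <= c ->
  int1 c (fun x => gauss A (x - c)) + int1 c (fun x => gauss A (x + c)) =
  int1 (2 * c) (gauss A).
Proof.
move=> c0; have cg := @continuous_gauss R A.
have c1 : - (2 * c) <= 0 by lra.
have c2 : 0 <= 2 * c by lra.
have cc : - c <= c by lra.
rewrite /int1 (Rintegral_shift (- c) cg cc) (Rintegral_shift c cg cc).
rewrite (Rintegral_split cg c1 c2).
rewrite (_ : - c - c = - (2 * c)); last by ring.
rewrite (_ : c + - c = 0); last by ring.
rewrite (_ : - c + c = 0); last by ring.
by rewrite (_ : c + c = 2 * c); last by ring.
Qed.

(** The quartic bound suffices up to 3. Beyond, [vers] has already reached [9/8] and is increasing,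
    while [x^2 <= 16]. *)
Lemma sq_le_vers x : - pi <= x <= pi -> x ^+ 2 <= 16 * vers x.
Proof.
wlog x0 : x / 0 <= x => [hw /andP[h1 h2]|].
  have [/hw|/ltW x0] := leP 0 x; first by apply; apply/andP.
  by rewrite -sqrrN -versN; apply: hw; [|apply/andP]; lra.
move=> /andP[_ xpi]; have p4 := pihalf_lt2 R.
have [x3|x3] := leP x 3.
  have h := vers_ge x; rewrite -/(vers x) in h.
  have : x ^+ 2 <= 3 ^+ 2 by rewrite lerXn2r ?nnegrE.
  rewrite (_ : x ^+ 4 = x ^+ 2 * x ^+ 2) in h; last by ring.
  move: h; have := sqr_ge0 x; nra.
have h := vers_ge (3 : R); rewrite -/(vers (3 : R)) in h.
have : vers 3 <= vers x.
  rewrite /vers lerD2l lerN2 ltW// ltr_cos ?in_itv/=//; apply/andP; split; lra.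
have : x ^+ 2 <= 4 ^+ 2 by rewrite lerXn2r ?nnegrE//; lra.
lra.
Qed.

Lemma sin_sq_ge x (v : R) : - pi <= x <= pi -> vers x <= v -> v <= 2^-1 ->
  x ^+ 2 * (1 - 2 * v) <= sin x ^+ 2.
Proof.
move=> xpi xv v1; have h1 := sq_le_vers xpi; rewrite sin2_vers.
have h := vers_ge x; rewrite -/(vers x) in h.
have h2 := vers_ge0 x; have h3 := sqr_ge0 x.
have e : x ^+ 4 = x ^+ 2 * x ^+ 2 by ring.
have h4 : x ^+ 2 / 2 * (1 - 4 / 3 * v) <= vers x.
  rewrite e in h; nra.
have h5 : vers x * (2 - v) <= vers x * (2 - vers x) by apply: ler_wpM2l; lra.
apply: le_trans h5.
have : x ^+ 2 / 2 * (1 - 4 / 3 * v) * (2 - v) <= vers x * (2 - v) by apply: ler_wpM2r => //; lra.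
apply: le_trans; have : 0 <= x ^+ 2 * v ^+ 2 by rewrite mulr_ge0// sqr_ge0.
have : 0 <= x ^+ 2 * v by rewrite mulr_ge0//; lra.
nra.
Qed.

Lemma bmeas1_regionfun c k w X1 bt A : 0 <= A -> bmeas1 c (regionfun k w X1 bt A).
Proof.
move=> A0.
have cv : continuous (fun x => k * vers (x + w)).
  move=> x; apply: cvgM; first exact: cvg_cst.
  apply: (@continuous_comp _ _ _ (fun x : R => x + w) (@vers R)); last exact: continuous_vers.
  by apply: cvgD; [exact: cvg_id|exact: cvg_cst].
have ce : continuous (fun x => expR (- (A * sin x ^+ 2))).
  move=> x; apply: (@continuous_comp _ _ _ (@sin R) (fun y => expR (- (A * y ^+ 2)))).
    exact: continuous_sin.
  exact: continuous_gauss.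
split; last first.
  exists (1 + expR (- bt)) => x _; rewrite /regionfun; case: ifP => _.
    rewrite ger0_norm ?expR_ge0//; have := expR_ge0 (- bt).
    have : expR (- (A * sin x ^+ 2)) <= 1.
      by rewrite -[leRHS]expR0 ler_expR oppr_le0 mulr_ge0// sqr_ge0.
    lra.
  by rewrite ger0_norm ?expR_ge0// lerDr.
apply: measurable_fun_ifT.
- apply: measurable_fun_ler; last exact: measurable_cst.
  exact: (continuous_measurable_fun cv).
- exact: (continuous_measurable_fun ce).
- exact: measurable_cst.
Qed.

(** Replacing [sin x ^ 2] by [x^2] costs the factor [1 - 2 X1 / k]. Its product with [1 - 4 X1] is
    at least [s], hence at least [s^2]; the square is what a substitution [x -> s x] can remove. *)
Lemma regionfun_le k X1 bt A s x : - pi <= x <= pi -> 0 < k -> 0 <= X1 -> 0 <= A ->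
  s = 1 - 4 * X1 - 2 * (X1 / k) -> 0 < s ->
  regionfun k 0 X1 bt (A * (1 - 4 * X1)) x <= expR (- bt) + gauss (A * s ^+ 2) x.
Proof.
move=> xpi k0 X10 A0 sE s0; rewrite /regionfun addr0; case: ifPn => [h|_]; last first.
  by rewrite lerDl gauss_ge0.
apply: ler_wpDl; first exact: expR_ge0.
rewrite /gauss ler_expR lerN2 -mulrA -mulrA; apply: ler_wpM2l => //.
have v0 : 0 <= X1 / k by rewrite divr_ge0// ltW.
have hv : vers x <= X1 / k by rewrite ler_pdivlMr// mulrC.
have v1 : X1 / k <= 2^-1 by lra.
have := sin_sq_ge xpi hv v1; have := sqr_ge0 x.
set S := sin x ^+ 2; set X := x ^+ 2; set v := X1 / k in sE v0 hv v1 * => X0 hS.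
have h1 : X * (1 - 2 * v) * (1 - 4 * X1) <= S * (1 - 4 * X1) by apply: ler_wpM2r => //; lra.
rewrite [leRHS]mulrC; apply: le_trans h1; rewrite [leLHS]mulrC -mulrA; apply: ler_wpM2l => //.
have : s ^+ 2 <= s by rewrite expr2 ler_piMr//; lra.
have : 0 <= X1 * v by rewrite mulr_ge0.
lra.
Qed.

Lemma vers_addpi_pi x : vers (x + pi) = vers (x - pi).
Proof. by rewrite -[in LHS](subrK pi x) /vers -addrA -mulr2n cosD2pi. Qed.

Lemma regionfun_pi_le k X1 bt A s x : - pi <= x <= pi -> 0 < k -> 0 <= X1 -> 0 <= A ->
  s = 1 - 4 * X1 - 2 * (X1 / k) -> 0 < s ->
  regionfun k pi X1 bt (A * (1 - 4 * X1)) x <=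
  expR (- bt) + (gauss (A * s ^+ 2) (x - pi) + gauss (A * s ^+ 2) (x + pi)).
Proof.
move=> /andP[x1 x2] k0 X10 A0 sE s0; have p0 := pi_ge0 R.
have pole (z : R) : sin (z + pi) ^+ 2 = sin z ^+ 2 by rewrite sinDpi sqrrN.
have key z : - pi <= z <= pi -> vers (x + pi) = vers z -> sin x ^+ 2 = sin z ^+ 2 ->
    regionfun k pi X1 bt (A * (1 - 4 * X1)) x <= expR (- bt) + gauss (A * s ^+ 2) z.
  move=> zpi vz sz; have := regionfun_le bt zpi k0 X10 A0 sE s0.
  by rewrite /regionfun addr0 vz sz.
have [x0|/ltW x0] := leP 0 x.
  rewrite addrA; apply: ler_wpDr; first exact: gauss_ge0.
  apply: key; last by rewrite -(pole (x - pi)) subrK.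
    by rewrite lerBlDr lerBrDl subrr x0 (le_trans x2)// lerDl.
  exact: vers_addpi_pi.
rewrite [gauss _ (x - pi) + _]addrC addrA; apply: ler_wpDr; first exact: gauss_ge0.
apply: key; [|by []|by rewrite pole].
by rewrite -lerBlDr -opprD (le_trans _ x1) ?lerN2 ?lerDl// -lerBrDr subrr.
Qed.

(** For either pole the Gaussian part is at most its integral over [[-2 pi, 2 pi]], which is
    rescaled by [s] and cut at [d]. *)
Lemma int1_regionfun k w X1 bt A d s : is_pole w -> 0 < k -> 0 <= X1 -> 0 <= A ->
  s = 1 - 4 * X1 - 2 * (X1 / k) -> 0 < s -> 0 <= d -> d <= 2 * pi * s ->
  int1 pi (regionfun k w X1 bt (A * (1 - 4 * X1))) <=
  2 * pi * expR (- bt) + s^-1 * (int1 d (gauss A) + 4 * pi * gauss A d).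
Proof.
move=> pw k0 X10 A0 sE s0 d0 ds.
have v0 : 0 <= X1 / k by rewrite divr_ge0// ltW.
have p0 := pi_gt0 R.
have s1 : s <= 1 by lra.
pose e := gauss (A * s ^+ 2).
have ce : continuous e by exact: continuous_gauss.
have cem y : continuous (fun x => e (x + y)).
  move=> x; apply: continuous_comp; last exact: ce.
  by apply: cvgD; [exact: cvg_id|exact: cvg_cst].
have A2 : 0 <= A * (1 - 4 * X1) by rewrite mulr_ge0//; lra.
have be : bmeas1 pi e by exact: bmeas1_cont.
have bp y : bmeas1 pi (fun x => e (x + y)) by exact: bmeas1_cont.
have b1 : bmeas1 pi (fun x => e (x - pi) + e (x + pi)) by exact: bmeas1D.
have hJ : s * int1 (2 * pi) e <= int1 d (gauss A) + 4 * pi * gauss A d.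
  rewrite int1_gauss_scale//; last lra.
  apply: (le_trans (int1_gauss_tail A0 d0 (_ : d <= s * (2 * pi)))); first by rewrite mulrC.
  rewrite lerD2l; apply: ler_wpM2r; first exact: gauss_ge0.
  have := ler_wpM2r (ltW p0) s1; lra.
have {}hJ : int1 (2 * pi) e <= s^-1 * (int1 d (gauss A) + 4 * pi * gauss A d).
  by rewrite ler_pdivlMl.
have cst : int1 pi (fun=> expR (- bt)) = 2 * pi * expR (- bt).
  rewrite /int1 Rintegral_cst// /= lebesgue_measure_itv/= lte_fin.
  by rewrite ifT; [rewrite -EFinB /=; ring|lra].
have hsum : int1 pi (fun x => e (x - pi) + e (x + pi)) = int1 (2 * pi) e.
  by rewrite int1D// -int1_gauss_shift// ltW.
have key g : bmeas1 pi g -> int1 pi g <= int1 (2 * pi) e ->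
    (forall x, - pi <= x <= pi ->
      regionfun k w X1 bt (A * (1 - 4 * X1)) x <= expR (- bt) + g x) ->
    int1 pi (regionfun k w X1 bt (A * (1 - 4 * X1))) <=
    2 * pi * expR (- bt) + s^-1 * (int1 d (gauss A) + 4 * pi * gauss A d).
  move=> bg hg hle; apply: (@le_trans _ _ (int1 pi (fun x => expR (- bt) + g x))).
    apply: int1_le => //; first exact: bmeas1_regionfun.
    by apply: bmeas1D => //; exact: bmeas1_cst.
  rewrite int1D//; last exact: bmeas1_cst.
  by rewrite cst lerD2l; exact: le_trans hJ.
have g0 x : 0 <= e x by exact: gauss_ge0.
case: pw => wE.
  apply: (key e) => //; last by move=> x xpi; rewrite wE; exact: regionfun_le.
  by apply: int1_widen => //; rewrite ler_peMl// ?(ler_nat R 1 2)// ltW.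
apply: (key (fun x => e (x - pi) + e (x + pi))) => //; first by rewrite hsum.
by move=> x xpi; rewrite wE; exact: regionfun_pi_le.
Qed.

End onedim.

(** * The integral over a set far from both poles *)

Section outer.
Context (R : realType).
Local Notation Rn n := (n.-tuple (measurableTypeR R)).

(** The pole depends on the point, so the majorant contains one product for each pole, whence the
    factor 2. Being nonnegative, it may be integrated over the whole cube, where it factorises. *)
Lemma outer_bound n (k x0 X1 X2 E Q A d s : R) (D : set (Rn n)) :
  (16 <= n)%N -> 0 < k -> 0 < x0 -> 48 * x0 <= X1 -> X1 <= X2 -> 4 * X2 <= 1 ->
  64 * E <= x0 * n%:R ^+ 2 -> Q = 4 * E / (x0 * n%:R) + 1 -> Q <= n%:R / 2 ->
  12 * n%:R * x0 + Q * X1 <= n%:R * X1 / 32 ->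
  A = k * (n%:R - 2) / 2 -> s = 1 - 4 * X1 - 2 * (X1 / k) -> 0 < s ->
  0 <= d -> d <= 2 * pi * s ->
  measurable D -> D `<=` sqbox pi n ->
  (forall t w, D t -> is_pole w -> exists b, X2 < k * vers (tnth t b + w)) ->
  \int[lebesgue_tuple R n]_(t in D) expR (- modsum k t) <=
  expR (- E) * (2 * pi) ^+ n + 2 * expR (- (n%:R * (X2 - X1) / 16)) *
  (2 * pi * expR (- (n%:R * X1 / 32)) + s^-1 * (int1 d (gauss A) + 4 * pi * gauss A d)) ^+ n.
Proof.
move=> n16 k0 x00 x0X1 X12 X21 En QE Qn small AE sE s0 d0 ds mD Dpi Dfar.
have N16 : 16 <= n%:R :> R by rewrite (ler_nat R 16).
have p0 := pi_gt0 R.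
have A0 : 0 <= A by rewrite AE divr_ge0// mulr_ge0//; lra.
have X10 : 0 <= X1 by lra.
have v0 : 0 <= X1 / k by rewrite divr_ge0// ltW.
have A2 : 0 <= A * (1 - 4 * X1) by rewrite mulr_ge0//; lra.
pose f w := regionfun k w X1 (n%:R * X1 / 32) (A * (1 - 4 * X1)).
pose P w (t : Rn n) := \prod_j f w (tnth t j).
pose c := expR (- (n%:R * (X2 - X1) / 16)).
pose G (t : Rn n) := expR (- E) + c * (P 0 t + P pi t).
have bf w : bmeas1 pi (f w) by exact: bmeas1_regionfun.
have bP w : bmeas pi (P w) by exact: bmeas_prod1.
have bPP : bmeas pi (fun t => P 0 t + P pi t) by exact: bmeasD.
have bcP : bmeas pi (fun t => c * (P 0 t + P pi t)).
  by apply: bmeasM => //; exact: bmeas_cst.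
have bG : bmeas pi G by apply: bmeasD => //; exact: bmeas_cst.
have P0 w t : 0 <= P w t.
  by apply: prodr_ge0 => j _; rewrite /f /regionfun; case: ifP => _; exact: expR_ge0.
have c0 : 0 <= c by exact: expR_ge0.
have G0 t : 0 <= G t.
  by rewrite /G addr_ge0 ?expR_ge0// mulr_ge0// addr_ge0.
have bF : bmeas pi (fun t : Rn n => expR (- modsum k t)).
  apply: (bmeas_comp (@continuous_expR R)); apply: bmeasN.
  exact: bmeas_pairsum (continuous_logmod (ltW k0)).
have FG (t : Rn n) : D t -> expR (- modsum k t) <= G t.
  move=> Dt; rewrite /G.
  have [hE|hE] := leP (modsum k t) E; last first.
    apply: (@le_trans _ _ (expR (- E))); first by rewrite ler_expR; lra.
    by rewrite lerDl mulr_ge0// addr_ge0.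
  have x01 : 2 * x0 <= 1 by lra.
  have [w pw hw] := most_near_pole k0 x00 x01 N16 hE En.
  rewrite -QE in hw.
  have [b hb] := Dfar t w Dt pw.
  have := region_exp pw k0 x00 x0X1 X12 X21 hw Qn small hb.
  have -> : k / 2 * (1 - 4 * X1) * (n%:R - 2) = A * (1 - 4 * X1) by rewrite AE; field.
  rewrite -/c -/(P w t) => h; apply: (le_trans h).
  have h2 : 0 <= expR (- E) by exact: expR_ge0.
  apply: ler_wpDl => //; apply: ler_wpM2l => //.
  by case: pw => ->; rewrite ?lerDl ?lerDr.
have iF := bmeas_integrable bF; have iG := bmeas_integrable bG.
have mpi := @measurable_sqbox R pi n.
apply: (@le_trans _ _ (\int[lebesgue_tuple R n]_(t in D) G t)).
  apply: le_Rintegral => //.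
  - exact: integrableS iF.
  - exact: integrableS iG.
apply: (@le_trans _ _ (tbint pi G)).
  by apply: Rintegral_subset_le.
rewrite tbintD//; last exact: bmeas_cst.
rewrite tbintZ// tbintD// !tbint_prod//.
have cst : int1 pi (fun=> 1) = 2 * pi :> R.
  rewrite /int1 Rintegral_cst// /= lebesgue_measure_itv/= lte_fin.
  by rewrite ifT; [rewrite -EFinB /=; ring|lra].
have -> : tbint pi (fun _ : Rn n => expR (- E)) = expR (- E) * (2 * pi) ^+ n.
  rewrite -cst -(tbint_prod n (bmeas1_cst pi 1)) -tbintZ.
    by apply: tbint_eq => t _; rewrite big1// mulr1.
  exact: (bmeas_prod1 n (bmeas1_cst pi 1)).
rewrite lerD2l; set J := 2 * pi * _ + _.
have fJ w : is_pole w -> int1 pi (f w) ^+ n <= J ^+ n.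
  move=> pw; have h0 : 0 <= int1 pi (f w).
    apply: Rintegral_ge0 => // x _; rewrite /f /regionfun; case: ifP => _; exact: expR_ge0.
  have h1 : int1 pi (f w) <= J by exact: int1_regionfun.
  by apply: lerXn2r; rewrite ?nnegrE//; exact: le_trans h1.
have := fJ 0 (or_introl erefl); have := fJ pi (or_intror erefl).
rewrite -mulrA mulrCA => h1 h2; apply: ler_wpM2l => //; lra.
Qed.

End outer.

(** * The regions of integration *)

Section regions.
Context (R : realType).
Local Notation Rn n := (n.-tuple (measurableTypeR R)).
Variables (eps : R) (n l : nat).
Hypothesis n2 : (2 < n)%N.
Let lam := density R n l.
Let d := scale R eps n / (1 + lam).
Hypothesis dpi : 4 * d < pi.

Let lam0 : 0 <= lam.
Proof. by apply: density_ge0; exact: ltnW. Qed.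

Let lam1 : 0 < 1 + lam.
Proof. by have := lam0; lra. Qed.

Let d0 : 0 <= d.
Proof. by rewrite divr_ge0 ?powR_ge0// ltW. Qed.

Let rE : scale R eps n = (1 + lam) * d.
Proof. by rewrite /d mulrC divfK// gt_eqF. Qed.

Let N3 : 3 <= n%:R :> R.
Proof. by rewrite (ler_nat R 3). Qed.

Lemma box0E : box0 R eps n l = sqbox d n.
Proof.
by apply/seteqP; split=> t /= h j; have := h j; rewrite ler_norml.
Qed.

Let nearpi : set R := [set x | `|x + pi| <= d] `|` [set x | `|x - pi| <= d].

Let boxpi_cube t : cube R n t ->
  boxpi R eps n l t <-> forall j, nearpi (tnth t j).
Proof.
move=> ct; have hd := dpi; have p0 := pi_gt0 R; have d0' := d0.
split=> h j; last first.
  case: (h j) => /= hj; [exists 0|exists (-1)].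
    by rewrite mul0r addr0.
  by rewrite (_ : _ + _ = tnth t j - pi)//; rewrite mulrN1z; ring.
have [m hm] := h j; have /andP[t1 t2] := ct j.
(* Only the shifts [m = 0] and [m = -1] can occur, as [|t_j| <= pi] and [4 d < pi]. *)
move: hm; rewrite -/lam -/d; case: m => [[|k]|[|k]] hm.
- by left; move: hm; rewrite /= mul0r addr0.
- move: hm; rewrite ler_norml => /andP[_ m2].
  have : (1 : R) <= (Posz k.+1)%:~R by rewrite (ler_int R 1).
  by move=> /(ler_wpM2r (ltW p0)); lra.
- right; move: hm; rewrite (_ : _ + _ = tnth t j - pi)//.
  by rewrite NegzE mulrN1z; ring.
- move: hm; rewrite ler_norml => /andP[m1 _].
  have : (Negz k.+1)%:~R <= (-2 : R) by rewrite (ler_int R _ (-2)).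
  by move=> /(ler_wpM2r (ltW p0)); lra.
Qed.

Lemma boxcE : boxc R eps n l =
  sqbox pi n `\` (sqbox d n `|` [set t | forall j, nearpi (tnth t j)]).
Proof.
apply/seteqP; split=> t [ct nt]; split=> // ht; apply: nt; rewrite ?box0E.
  by case: ht => [|/(boxpi_cube ct)]; [left|right].
by case: ht => [|/(boxpi_cube ct)]; [rewrite box0E; left|right].
Qed.

Let measurable_nearpi : measurable nearpi.
Proof.
have e (c : R) : [set x : R | `|x + c| <= d] = `[- d - c, d - c]%classic.
  by apply/seteqP; split=> x /=; rewrite in_itv/= ler_norml lerBlDr lerBrDr.
by apply: measurableU; rewrite e; exact: measurable_itv.
Qed.

Lemma measurable_boxc : measurable (boxc R eps n l).
Proof.
rewrite boxcE; apply: measurableD; first exact: measurable_sqbox.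
apply: measurableU; first exact: measurable_sqbox.
by have [] := @lebesgue_tuple_box R n (fun=> nearpi) (fun=> measurable_nearpi).
Qed.

Lemma boxc_cube : boxc R eps n l `<=` sqbox pi n.
Proof. by rewrite boxcE => t []. Qed.

(** Failing to lie in either box means that, for each pole, some coordinate is farther than [d] from
    it; the 16 comes from [sq_le_vers]. *)
Lemma boxc_far k X2 t w : 0 < k -> 16 * X2 <= k * d ^+ 2 ->
  boxc R eps n l t -> is_pole w -> exists b, X2 < k * vers (tnth t b + w).
Proof.
move=> k0 hX2; rewrite boxcE => -[ct nt] pw.
have d0' := d0.
have far (x : R) : - pi <= x <= pi -> d < `|x| -> X2 < k * vers x.
  move=> xpi dx.
  have h1 : d ^+ 2 < x ^+ 2 by rewrite -(real_normK (num_real x)) ltrXn2r// nnegrE.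
  have h2 := sq_le_vers xpi.
  have : k * d ^+ 2 < k * (16 * vers x) by rewrite ltr_pM2l//; lra.
  lra.
apply: contrapT => hN; apply: nt.
case: pw => wE.
  left=> j; rewrite -ler_norml leNgt; apply/negP => dj; apply: hN.
  by exists j; rewrite wE addr0; apply: far => //; exact: ct.
right=> j /=; apply: contrapT => hj; apply: hN; exists j; rewrite wE.
have /andP[t1 t2] := ct j.
have /andP[h1 h2] : (d < `|tnth t j + pi|) && (d < `|tnth t j - pi|).
  by apply/andP; split; rewrite ltNge; apply/negP => h; apply: hj; [left|right].
have [x0|x0] := leP 0 (tnth t j : R).
  have -> : vers (tnth t j + pi) = vers (tnth t j - pi).
    by rewrite -[in LHS](subrK pi (tnth t j : R)) /vers -addrA -mulr2n cosD2pi.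
  by apply: far => //; apply/andP; split; have := x0; lra.
by apply: far => //; apply/andP; split; have := x0; lra.
Qed.

Let c := ccoef R n.

Let c_bounds : 0 <= c <= 2^-1.
Proof.
have N := N3.
have N1 : 0 < 2 * (n%:R - 1) :> R by lra.
rewrite /c /ccoef; apply/andP; split.
  rewrite subr_ge0 -[leRHS]sqrtr1 ler_wsqrtr// ler_pdivrMr//; lra.
rewrite lerBlDr -lerBlDl.
have -> : 1 - 2^-1 = Num.sqrt (2^-1 ^+ 2) :> R by rewrite sqrtr_sqr ger0_norm; lra.
by rewrite ler_wsqrtr// ler_pdivlMr//; lra.
Qed.

(** The inverse of [Tmap], found by noting that [Tmap] multiplies the sum of the coordinates by
    [(1 - c) / (1 + lam)]. *)
Let coord (t : Rn n) (j : 'I_n) : R :=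
  (1 + lam) * (tnth t j + c / (1 - c) / n%:R * \sum_i tnth t i).

Let n_neq0 : n%:R != 0 :> R.
Proof. by have := N3 => h; rewrite gt_eqF//; lra. Qed.

Let c1_neq0 : 1 - c != 0.
Proof. by have /andP[h1 h2] := c_bounds; rewrite gt_eqF//; lra. Qed.

Let mean_Tmap z : \sum_i tnth (Tmap R n l z) i = (1 - c) / (1 + lam) * \sum_i tnth z i.
Proof.
rewrite (eq_bigr (fun i => (tnth z i - c / n%:R * \sum_k tnth z k) / (1 + lam))); last first.
  by move=> i _; rewrite tnth_mktuple.
rewrite -mulr_suml sumrB sumr_const card_ord -[X in _ - X]mulr_natr.
set S := \sum_i _; field.
by rewrite n_neq0 gt_eqF.
Qed.

Let boxTE : boxT R eps n l =
  [set t | forall j, `|coord t j| <= 2 * scale R eps n].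
Proof.
apply/seteqP; split=> [_ [z hz <-] j|t ht].
  suff -> : coord (Tmap R n l z) j = tnth z j by exact: hz.
  rewrite /coord mean_Tmap tnth_mktuple -/c -/lam; set S := \sum_i _; field.
  by rewrite n_neq0 c1_neq0 gt_eqF.
exists [tuple coord t j | j < n] => [j|]; first by rewrite tnth_mktuple; exact: ht.
apply: eq_from_tnth => j; rewrite !tnth_mktuple.
rewrite (eq_bigr (coord t)); last by move=> i _; rewrite tnth_mktuple.
have -> : \sum_i coord t i = (1 + lam) / (1 - c) * \sum_i tnth t i.
  rewrite -mulr_sumr big_split/= sumr_const card_ord -[_ *+ n]mulr_natr.
  by set S := \sum_i _; field; rewrite n_neq0 c1_neq0.
rewrite /coord -/c -/lam; set S := \sum_i _; field.
by rewrite n_neq0 c1_neq0 gt_eqF.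
Qed.

Lemma measurable_boxT : measurable (boxT R eps n l).
Proof.
rewrite boxTE.
have -> : [set t | forall j, `|coord t j| <= 2 * scale R eps n] =
    \bigcap_(j in [set: 'I_n]) [set t | `|coord t j| <= 2 * scale R eps n].
  by apply/seteqP; split=> t /= h j; [move=> _; exact: h|exact: h].
apply: fin_bigcap_measurable => // j _.
rewrite -[X in measurable X]setTI.
have mc : measurable_fun setT (fun t => `|coord t j|).
  apply: measurableT_comp => //; apply: measurable_funM => //.
  apply: measurable_funD; first exact: measurable_tnthR.
  by apply: measurable_funM => //; apply: (@measurable_sum1 R n id).
rewrite (_ : [set t | _] = (fun t => `|coord t j|) @^-1` `]-oo, 2 * scale R eps n]).
  exact: mc.
by apply/seteqP; split=> t /=; rewrite in_itv.
Qed.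

Lemma norm_mean_le (t : Rn n) (B : R) : 0 <= B -> (forall j, `|tnth t j| <= B) ->
  `|n%:R^-1 * \sum_i tnth t i| <= B.
Proof.
move=> B0 hB; have N0 : 0 < n%:R :> R by have := N3; lra.
rewrite normrM gtr0_norm ?invr_gt0// ler_pdivrMl//.
exact: norm_sum_le.
Qed.

(** As [c <= 1/2], the correction [c / (1 - c)] times the mean is at most [d]; this is what the
    factor 2 in [boxz] leaves room for. *)
Lemma box0_boxT : sqbox d n `<=` boxT R eps n l.
Proof.
rewrite boxTE rE => t ht j /=; have /andP[c0 c1] := c_bounds.
have hm : `|n%:R^-1 * \sum_i tnth t i| <= d.
  by apply: norm_mean_le => // i; rewrite ler_norml; exact: ht.
rewrite /coord normrM (gtr0_norm lam1) mulrCA ler_pM2l//.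
have hj : `|tnth t j| <= d by rewrite ler_norml; exact: ht.
apply: (le_trans (ler_normD _ _)).
have q0 : 0 <= c / (1 - c) by rewrite divr_ge0//; lra.
have q1 : c / (1 - c) <= 1 by rewrite ler_pdivrMr; lra.
have : `|c / (1 - c) / n%:R * \sum_i tnth t i| <= 1 * d.
  by rewrite -mulrA normrM ger0_norm// ler_pM.
move: hj; lra.
Qed.

(** The image points have coordinates at most [3 d], and [4 d < pi] keeps these away from the box at
    [pi]. *)
Lemma boxT_boxc : boxT R eps n l `\` sqbox d n `<=` boxc R eps n l.
Proof.
rewrite boxcE => _ [[z hz <-] nd].
have hd := dpi; have d0' := d0.
have small j : `|tnth (Tmap R n l z) j| <= 3 * d.
  have /andP[c0 c1] := c_bounds.
  have r0 : 0 <= 2 * scale R eps n by rewrite mulr_ge0// powR_ge0.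
  have hm := norm_mean_le r0 hz.
  rewrite tnth_mktuple -/c -/lam normrM [X in _ * X]gtr0_norm ?invr_gt0// ler_pdivrMr//.
  apply: (le_trans (ler_normB _ _)).
  have : `|c / n%:R * \sum_k tnth z k| <= 2^-1 * (2 * scale R eps n).
    by rewrite -mulrA normrM ger0_norm// ler_pM.
  by have := hz j; rewrite rE; lra.
split=> [j|[//|h]].
  by have := small j; rewrite ler_norml => /andP[h1 h2]; apply/andP; split; lra.
have n0 : (0 < n)%N by apply: leq_trans n2.
have := small (Ordinal n0); rewrite ler_norml => /andP[h1 h2].
by case: (h (Ordinal n0)) => /=; rewrite ler_norml => /andP[h3 h4]; lra.
Qed.

(** What [boxT] adds to the central box lies in [boxc], so the integral of [|F|] over [boxc] bounds
    its contribution. *)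
Lemma Re_cintegral_boxT :
  tbint d (fun t : Rn n => expR (- modsum (kappa lam) t) * cos (phasesum lam t)) -
  \int[lebesgue_tuple R n]_(t in boxc R eps n l) expR (- modsum (kappa lam) t) <=
  complex.Re (cintegral (lebesgue_tuple R n) (boxT R eps n l) (integrand R n l)).
Proof.
set k := kappa lam; have n1 : (1 < n)%N by exact: ltnW.
have k0 : 0 <= k by exact: kappa_ge0.
pose F (t : Rn n) := expR (- modsum k t).
pose H (t : Rn n) := F t * cos (phasesum lam t).
have bF : bmeas pi F.
  apply: (bmeas_comp (@continuous_expR R)); apply: bmeasN.
  exact: bmeas_pairsum (continuous_logmod k0).
have bH : bmeas pi H.
  apply: bmeasM => //; apply: (bmeas_comp (@continuous_cos R)).
  exact: bmeas_pairsum (continuous_phase lam0).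
have iF := bmeas_integrable bF; have iH := bmeas_integrable bH.
have mpi := @measurable_sqbox R pi n; have md := @measurable_sqbox R d n.
have mc := measurable_boxc; have mT := measurable_boxT.
have mTd : measurable (boxT R eps n l `\` sqbox d n) by exact: measurableD.
have Tpi : boxT R eps n l `\` sqbox d n `<=` sqbox pi n.
  exact: subset_trans boxT_boxc boxc_cube.
have dpi' : sqbox d n `<=` sqbox pi n.
  move=> t h j; have /andP[h1 h2] := h j; have := dpi; have := d0.
  by move=> *; apply/andP; split; lra.
have TE : boxT R eps n l = sqbox d n `|` (boxT R eps n l `\` sqbox d n).
  by rewrite setDUK//; exact: box0_boxT.
have -> : complex.Re (cintegral (lebesgue_tuple R n) (boxT R eps n l) (integrand R n l)) =
    \int[lebesgue_tuple R n]_(t in boxT R eps n l) H t.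
  by apply: eq_Rintegral => t _; rewrite Re_integrand.
rewrite TE Rintegral_setU//; last 2 first.
- by rewrite -TE; apply: integrableS iH => //; rewrite TE => t [/dpi'|/Tpi].
- by apply/disj_set2P; rewrite setDE setICA setICr setI0.
rewrite lerD2l.
have iFT : (lebesgue_tuple R n).-integrable (boxT R eps n l `\` sqbox d n) (EFin \o F).
  exact: integrableS iF.
have iHT : (lebesgue_tuple R n).-integrable (boxT R eps n l `\` sqbox d n) (EFin \o H).
  exact: integrableS iH.
rewrite lerNl; apply: (@le_trans _ _
    (\int[lebesgue_tuple R n]_(t in boxT R eps n l `\` sqbox d n) F t)); last first.
  apply: Rintegral_subset_le => //; first exact: boxT_boxc.
    by apply: integrableS iF => //; exact: boxc_cube.
  by move=> t _; exact: expR_ge0.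
rewrite -mulN1r -RintegralZl//.
apply: le_Rintegral => //.
  have bNH : bmeas pi (fun t => -1 * H t) by apply: bmeasM => //; exact: bmeas_cst.
  exact: integrableS (bmeas_integrable bNH).
move=> t _; rewrite mulN1r -mulrN /H; apply: ler_piMr; first exact: expR_ge0.
by rewrite lerNl; exact: cos_geN1.
Qed.

End regions.

(** * The asymptotic regime *)

(* Everything here is at a fixed [n]. The letter [y] stands for [n ^ (eps / 10)],
   so that [r = y ^ 10 / w] is the half-width of the central box in the variable
   [(1 + lam) t]; [T] stands for [3 a ln n], which bounds [1 / lam]. *)
Section regime.
Context (R : realType).
Local Notation Rn n := (n.-tuple (measurableTypeR R)).
Variables (n : nat) (y w ell T lam : R).
Hypothesis nE : n%:R = w ^+ 2.
Hypothesis w_ell : w ^+ 2 = expR ell.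
Hypothesis w_gt0 : 0 < w.
Hypothesis ell_ge0 : 0 <= ell.
Hypothesis hy : 64 * (1 + ell + T) <= y.
Hypothesis hyw : y ^+ 100 <= w.
(** With [T = 3 a ln n] and [w = sqrt n] this reads [n^(a + 6 eps) <= n^(1/2)]: the main term beats
    the errors. *)
Hypothesis hTw : expR (T / 3) * y ^+ 60 <= w.
Hypothesis lam_gt0 : 0 < lam.
Hypothesis lamV : lam^-1 <= T.
Hypothesis lam_le : lam <= expR y.

Let r := y ^+ 10 / w.
Let d := r / (1 + lam).
Let k := kappa lam.
Let A := k * (n%:R - 2) / 2.
Let Z := int1 d (gauss A).

Let T_gt0 : 0 < T.
Proof. by apply: lt_le_trans lamV; rewrite invr_gt0. Qed.

Let y_ge : 64 <= y.
Proof. by have := hy; have := ell_ge0; have := T_gt0; lra. Qed.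

Let y_gt0 : 0 < y.
Proof. by have := y_ge; lra. Qed.

Let y_mono i j : (i <= j)%N -> y ^+ i <= y ^+ j.
Proof. by move=> ij; apply: ler_weXn2l => //; have := y_ge; lra. Qed.

Let y_step i : 64 * y ^+ i <= y ^+ i.+1.
Proof. by rewrite exprS ler_wpM2r// exprn_ge0// ltW. Qed.

Let w_ge : y <= w.
Proof. by apply: le_trans hyw; rewrite -[leLHS]expr1 y_mono. Qed.

Let w_le_n : w <= n%:R.
Proof. by rewrite nE expr2 ler_peMr//; [exact: ltW|have := w_ge; have := y_ge; lra]. Qed.

Let n_big : 64 <= n%:R :> R.
Proof. by have := w_le_n; have := w_ge; have := y_ge; lra. Qed.

Let n2 : (16 <= n)%N.
Proof. by rewrite -(ler_nat R); have := n_big; lra. Qed.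

Let n3 : (2 < n)%N. Proof. exact: leq_trans n2. Qed.

Let yw i : (i < 100)%N -> 64 * (y ^+ i / w) <= 1.
Proof.
move=> i1; rewrite mulrA ler_pdivrMr// mul1r.
by apply: le_trans hyw; apply: le_trans (y_step i) _; exact: y_mono.
Qed.

Let yw_ge0 i : 0 <= y ^+ i / w.
Proof. by rewrite divr_ge0 ?exprn_ge0// ltW. Qed.

Let r_gt0 : 0 < r.
Proof. by rewrite divr_gt0// exprn_gt0. Qed.

Let lam1 : 1 < 1 + lam.
Proof. by have := lam_gt0; lra. Qed.

Let d_gt0 : 0 < d.
Proof. by rewrite divr_gt0//; have := lam1; lra. Qed.

Let d_le : d <= r.
Proof.
rewrite /d ler_pdivrMr; last by have := lam1; lra.
by rewrite ler_peMr//; [exact: ltW|have := lam1; lra].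
Qed.

Let rd : r = (1 + lam) * d.
Proof. by rewrite /d mulrC divfK// gt_eqF//; have := lam1; lra. Qed.

Let d2 : d ^+ 2 <= r ^+ 2.
Proof. by apply: lerXn2r => //; rewrite nnegrE ltW. Qed.

Let k_gt0 : 0 < k.
Proof. by rewrite /k /kappa mulr_gt0//; have := lam1; lra. Qed.

Let kd2 : k * d ^+ 2 <= r ^+ 2.
Proof.
rewrite rd [leRHS]exprMn; apply: ler_wpM2r; first exact: sqr_ge0.
by rewrite /k /kappa expr2; apply: ler_wpM2r; have := lam_gt0; lra.
Qed.

Let kV : k^-1 <= T.
Proof.
apply: le_trans lamV; rewrite lef_pV2 ?posrE// /k /kappa.
by rewrite ler_peMr//; [exact: ltW|have := lam1; lra].
Qed.

Let r2 : r ^+ 2 = y ^+ 20 / n%:R.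
Proof. by rewrite /r expr_div_n -exprM nE. Qed.

(* [k d^2 = r^2 lam / (1 + lam)], and [lam / (1 + lam)] is at least [64 / y]. *)
Let kd2_ge : 64 * (y ^+ 19 / n%:R) <= k * d ^+ 2.
Proof.
have l1 := lam1; have l0 := lam_gt0.
have e : k * d ^+ 2 * (1 + lam) = r ^+ 2 * lam.
  by rewrite rd /k /kappa; ring.
have h : 64 * (1 + lam) <= y * lam.
  have : 1 <= T * lam by rewrite -ler_pdivrMr// div1r.
  have := hy; have := ell_ge0 => e0 hy'.
  have : 64 * (1 + T) * lam <= y * lam by apply: ler_wpM2r; lra.
  by move: l0; lra.
have : 64 * (1 + lam) * (y ^+ 19 / n%:R) <= y * lam * (y ^+ 19 / n%:R).
  by apply: ler_wpM2r => //; rewrite divr_ge0// exprn_ge0// ltW.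
have -> : y * lam * (y ^+ 19 / n%:R) = k * d ^+ 2 * (1 + lam).
  by rewrite e r2 exprS; ring.
by move=> h1; rewrite -(ler_pM2r (_ : 0 < 1 + lam)); lra.
Qed.

Let N_exp : n%:R <= expR y.
Proof. by rewrite nE w_ell ler_expR; have := hy; have := ell_ge0; have := T_gt0; lra. Qed.

Let A_ge0 : 0 <= A.
Proof. by rewrite /A divr_ge0// mulr_ge0//; [exact: ltW|have := n_big; lra]. Qed.

(** A crude bound, wanted only to absorb much smaller terms. On [|x| <= 1 / (2 n e^y)] the exponent
    is at most 1, because [lam <= e^y]. *)
Lemma regime_Z_ge : expR (- (2 * y)) <= Z.
Proof.
have N0 : 0 < n%:R :> R by have := n_big; lra.
pose u := (2 * n%:R * expR y)^-1.
have u0 : 0 < u by rewrite invr_gt0 !mulr_gt0// expR_gt0.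
have y1 : 1 <= expR y by rewrite -expR0 ler_expR ltW.
have l1 := lam1; have l2 := lam_le.
have ud : u <= d.
  rewrite /d /u -[leLHS]div1r ler_pdivrMr; last by rewrite !mulr_gt0// expR_gt0.
  rewrite mulrAC ler_pdivlMr; last by lra.
  have rN : 1 <= r * n%:R.
    rewrite /r nE expr2 mulrA divfK ?gt_eqF//.
    apply: le_trans (_ : y ^+ 10 * 1 <= _); last first.
      by rewrite ler_wpM2l ?exprn_ge0// ?ltW//; have := w_ge; have := y_ge; lra.
    by rewrite mulr1 -(expr1n R 10) lerXn2r ?nnegrE//; have := y_ge; lra.
  have : 1 * (2 * expR y) <= r * n%:R * (2 * expR y).
    by apply: ler_wpM2r => //; rewrite mulr_ge0// expR_ge0.
  lra.
have Au : A * u ^+ 2 <= 1.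
  have k2 : k <= 2 * expR y ^+ 2.
    rewrite /k /kappa expr2 [2 * _]mulrCA; apply: ler_pM; lra.
  have A1 : A <= (n%:R * expR y) ^+ 2.
    apply: (@le_trans _ _ (k * n%:R / 2)).
      by rewrite /A ler_pM2r ?invr_gt0// ler_pM2l//; lra.
    have h1 := ler_wpM2r (ltW N0) k2.
    have h2 : expR y ^+ 2 * n%:R <= expR y ^+ 2 * (n%:R * n%:R).
      by apply: ler_wpM2l; [exact: sqr_ge0|rewrite ler_peMl//; have := n_big; lra].
    by rewrite exprMn; lra.
  apply: (@le_trans _ _ ((n%:R * expR y) ^+ 2 * u ^+ 2)).
    by apply: ler_wpM2r => //; exact: sqr_ge0.
  rewrite -exprMn /u -[2 * _ * _]mulrA invfM mulrCA divff ?mulr1; last first.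
    by rewrite gt_eqF// mulr_gt0// expR_gt0.
  by lra.
have hw := @int1_ge_window R d (- u) u (expR (-1)) (gauss A)
  (bmeas1_cont d (@continuous_gauss R A)) (fun x _ => gauss_ge0 A x).
have : expR (-1) * (u - - u) <= Z.
  apply: hw => //; [lra|lra|move=> x /andP[x1 x2]].
  rewrite /gauss ler_expR lerN2; apply: le_trans Au; apply: ler_wpM2l => //.
  have xu : `|x| <= u by rewrite ler_norml x1.
  by rewrite -(real_normK (num_real x)); apply: lerXn2r; rewrite // nnegrE ltW.
apply: le_trans.
have -> : u - - u = expR (- ell - y).
  rewrite /u nE w_ell -[2 * _ * _]mulrA -expRD invfM -expRN opprD.
  by set E := expR _; field.
by rewrite -expRD ler_expR; have := hy; have := T_gt0; have := ell_ge0; lra.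
Qed.

Lemma regime_tail : gauss A d <= expR (- y ^+ 16).
Proof.
rewrite /gauss ler_expR lerN2.
have N0 : 0 < n%:R :> R by have := n_big; lra.
have h1 : 64 * (y ^+ 19 / n%:R) * ((n%:R - 2) / 2) <= A * d ^+ 2.
  have -> : A * d ^+ 2 = k * d ^+ 2 * ((n%:R - 2) / 2) by rewrite /A; ring.
  by apply: ler_wpM2r => //; have := n_big; lra.
apply: le_trans h1.
have h2 : y ^+ 19 / n%:R * (n%:R / 4) <= y ^+ 19 / n%:R * ((n%:R - 2) / 2).
  apply: ler_wpM2l; last by have := n_big; lra.
  by rewrite divr_ge0 ?exprn_ge0// ltW.
have h3 : y ^+ 19 / n%:R * (n%:R / 4) = y ^+ 19 / 4.
  by field; rewrite gt_eqF.
have h4 : 64 * y ^+ 16 <= y ^+ 17 by exact: y_step.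
have h6 : y ^+ 17 <= y ^+ 19 by exact: y_mono.
have h7 : 0 <= y ^+ 16 by rewrite exprn_ge0// ltW.
have h5 : 0 <= y ^+ 19 by rewrite exprn_ge0// ltW.
by rewrite h3 in h2; lra.
Qed.

Let expR_ge_lin (x : R) : 1 + x <= expR x.
Proof. exact: expR_ge1Dx. Qed.

Let pi_le4 : pi <= 4 :> R.
Proof. by have := pihalf_lt2 R; lra. Qed.

Let two_pi : 2 * pi <= 8 :> R.
Proof. by have := pi_le4; lra. Qed.

Let four_pi : 4 * pi <= 16 :> R.
Proof. by have := pi_le4; lra. Qed.

Let k_small : 4 + 2 * k^-1 <= y / 16.
Proof. by have := kV; have := hy; have := ell_ge0; have := T_gt0; lra. Qed.

(** [1/s <= 1 + 2 (1 - s)] and the tails are at most [Z / n], so the relative error is at most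
    [2 (1 - s) + 1/n]; its [n]-fold multiple is at most [y^18 / 8 + 1]. *)
Lemma regime_factor (s : R) : 2^-1 <= s -> s <= 1 -> n%:R * (1 - s) <= y ^+ 18 / 16 ->
  0 <= 2 * pi * expR (- (y ^+ 17 / 32)) + s^-1 * (Z + 4 * pi * gauss A d) /\
  (2 * pi * expR (- (y ^+ 17 / 32)) + s^-1 * (Z + 4 * pi * gauss A d)) ^+ n <=
  Z ^+ n * expR (y ^+ 18 / 8 + 1).
Proof.
move=> s2 s1' sg; set J := 2 * pi * _ + _.
have N0 : 0 < n%:R :> R by have := n_big; lra.
have Nn0 : n%:R != 0 :> R by rewrite gt_eqF.
have yb := y_ge; have y0 := y_gt0.
have p0 : 0 <= pi :> R by exact: pi_ge0.
have p4 := pi_le4.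
have Z0 : 0 < Z by apply: lt_le_trans regime_Z_ge; exact: expR_gt0.
have s0 : 0 < s by move: s2; lra.
have s1 : 0 <= 1 - s by move: s1'; lra.
have s16 := y_step 16.
have P16 : 0 < y ^+ 16 by rewrite exprn_gt0.
have Zl := regime_Z_ge.
have J0 : 0 <= J.
  apply: addr_ge0; first by rewrite !mulr_ge0 ?expR_ge0.
  apply: mulr_ge0; first by rewrite invr_ge0 ltW.
  by apply: addr_ge0; [exact: ltW|rewrite !mulr_ge0 ?gauss_ge0].
have y16 : 17 * y <= y ^+ 16.
  rewrite exprSr; apply: ler_wpM2r; first exact: ltW.
  by apply: (@le_trans _ _ y); [lra|rewrite -[leLHS]expr1 y_mono].
have JZ : J <= Z * (1 + (2 * (1 - s) + n%:R^-1)).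
  have g := regime_tail; set q := expR (- y ^+ 16) in g.
  have b : expR (- (y ^+ 17 / 32)) <= q.
    by rewrite ler_expR lerN2; move: s16 P16; lra.
  have q0 : 0 <= q by exact: expR_ge0.
  have sV : s^-1 <= 1 + 2 * (1 - s).
    rewrite -[leLHS]div1r ler_pdivrMr//.
    have : 0 <= (1 - s) * (2 * s - 1) by rewrite mulr_ge0//; lra.
    by lra.
  have sV0 : 0 <= s^-1 by rewrite invr_ge0 ltW.
  have hq : 40 * q <= Z * n%:R^-1.
    rewrite ler_pdivlMr//; apply: le_trans Zl.
    have h40 : 40 <= expR y by have := expR_ge_lin y; lra.
    apply: (@le_trans _ _ (expR y * q * expR y)).
      apply: ler_pM; [by rewrite mulr_ge0|exact: ltW| |exact: N_exp].
      by apply: ler_wpM2r.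
    by rewrite /q -!expRD ler_expR; lra.
  have t1 : 2 * pi * expR (- (y ^+ 17 / 32)) <= 8 * q.
    by apply: ler_pM; [rewrite mulr_ge0|exact: expR_ge0|exact: two_pi|exact: b].
  have t2 : 4 * pi * gauss A d <= 16 * q.
    by apply: ler_pM; [rewrite mulr_ge0|exact: gauss_ge0|exact: four_pi|exact: g].
  have t3 : s^-1 * (Z + 4 * pi * gauss A d) <= (1 + 2 * (1 - s)) * Z + 2 * (16 * q).
    rewrite mulrDr; apply: lerD; first by apply: ler_wpM2r => //; exact: ltW.
    apply: ler_pM => //; last by lra.
    by rewrite !mulr_ge0 ?gauss_ge0//; lra.
  by move: hq t1 t3; rewrite /J; lra.
have JZn : J ^+ n <= Z ^+ n * expR (y ^+ 18 / 8 + 1).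
  apply: (@le_trans _ _ ((Z * expR (2 * (1 - s) + n%:R^-1)) ^+ n)).
    apply: lerXn2r; rewrite ?nnegrE//; first by rewrite mulr_ge0 ?expR_ge0// ltW.
    by apply: (le_trans JZ); rewrite ler_pM2l.
  rewrite exprMn -expRM_natl ler_pM2l ?exprn_gt0// ler_expR mulrDr divff//.
  by move: sg; lra.
by split.
Qed.

Lemma regime_upper (D : set (Rn n)) : measurable D -> D `<=` sqbox pi n ->
  (forall t v, D t -> is_pole v ->
    exists b, y ^+ 19 / n%:R < k * vers (tnth t b + v)) ->
  \int[lebesgue_tuple R n]_(t in D) expR (- modsum k t) <= expR (- (2 * y)) * Z ^+ n.
Proof.
move=> mD Dpi Dfar.
have N0 : 0 < n%:R :> R by have := n_big; lra.
have Nn0 : n%:R != 0 :> R by rewrite gt_eqF.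
have yb := y_ge; have Nb := n_big; have k0 := k_gt0; have y0 := y_gt0.
have p0 := pi_gt0 R; have p4 := pi_le4.
have Z0 : 0 < Z by apply: lt_le_trans regime_Z_ge; exact: expR_gt0.
have yn i : (i < 100)%N -> 64 * (y ^+ i / n%:R) <= 1.
  move=> i1; have h : y ^+ i / n%:R <= y ^+ i / w.
    apply: ler_wpM2l; first exact: exprn_ge0 (ltW y0).
    by rewrite (lef_pV2 N0 w_gt0); exact: w_le_n.
  have four : 0 <= 64 :> R by [].
  exact: le_trans (ler_wpM2l four h) (yw i1).
have P i : 0 < y ^+ i by rewrite exprn_gt0.
have P5 := P 5%N.
have yn17 := yn 17%N isT; have yn19 := yn 19%N isT.
(* The scales are separated by powers of [y >= 64]. [X2] is the largest power that [boxc_far]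
   permits. The gain [y^19 / 16] from the farthest coordinate must beat the loss [y^18 / 8] of
   [regime_factor], caused by [X1]. With [E = n y^10] the number of exceptions is about [4 n / y^5],
   so [Q X1] is negligible against [n X1 = y^17]. *)
pose x0 := y ^+ 15 / n%:R.
pose X1 := y ^+ 17 / n%:R.
pose X2 := y ^+ 19 / n%:R.
pose E := n%:R * y ^+ 10.
pose Q := 4 * E / (x0 * n%:R) + 1.
pose s := 1 - 4 * X1 - 2 * (X1 / k).
have QE : Q = 4 * n%:R / y ^+ 5 + 1.
  rewrite /Q /E /x0; have -> : y ^+ 15 = y ^+ 10 * y ^+ 5 by ring.
  by field; rewrite ?Nn0 gt_eqF.
have ynle i : 64 * (y ^+ i / n%:R) <= y ^+ i.+1 / n%:R.
  by rewrite mulrA; apply: ler_wpM2r; [rewrite invr_ge0 ltW|exact: y_step].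
have X01 : 64 * x0 <= X1.
  by apply: (le_trans (ynle 15%N)); apply: ler_wpM2r; [rewrite invr_ge0 ltW|exact: y_mono].
have X12 : 64 * X1 <= X2.
  by apply: (le_trans (ynle 17%N)); apply: ler_wpM2r; [rewrite invr_ge0 ltW|exact: y_mono].
have x00 : 0 < x0 by rewrite divr_gt0.
have X10 : 0 < X1 by rewrite divr_gt0.
have Qy : 4 * n%:R / y ^+ 5 <= 4 * n%:R / 64.
  apply: ler_wpM2l; first by lra.
  rewrite lef_pV2 ?posrE//; apply: (le_trans yb); rewrite -[leLHS]expr1; exact: y_mono.
have Qn : Q <= n%:R / 2 by rewrite QE; lra.
have small : 12 * n%:R * x0 + Q * X1 <= n%:R * X1 / 32.
  have -> : 12 * n%:R * x0 + Q * X1 = 12 * y ^+ 15 + 4 * y ^+ 12 + X1.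
    rewrite QE /x0 /X1; have -> : y ^+ 17 = y ^+ 12 * y ^+ 5 by ring.
    by field; rewrite ?Nn0 gt_eqF.
  have -> : n%:R * X1 = y ^+ 17 by rewrite /X1 mulrCA divff ?mulr1.
  have : 64 * X1 <= 1 by exact: yn17.
  have : 1 <= y ^+ 12 by apply: exprn_ege1; apply: le_trans yb; rewrite ler1n.
  have s12 := y_step 12; have s13 := y_step 13; have s14 := y_step 14.
  have s15 := y_step 15; have s16 := y_step 16.
  by clear QE Qn Qy X01 X12 yn17 yn19 x00 X10; lra.
have En : 64 * E <= x0 * n%:R ^+ 2.
  have -> : x0 * n%:R ^+ 2 = y ^+ 15 * n%:R by rewrite /x0; field.
  have : 64 * (n%:R * y ^+ 10) <= n%:R * y ^+ 11.
    by rewrite mulrCA; apply: ler_wpM2l; [exact: ltW|exact: y_step].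
  have : n%:R * y ^+ 11 <= n%:R * y ^+ 15 by rewrite ler_pM2l// y_mono.
  have : 0 <= n%:R * y ^+ 10 by rewrite mulr_ge0// ltW.
  by clear QE Qn Qy small X01 X12 yn17 yn19 x00 X10; rewrite /E; lra.
have sg : n%:R * (1 - s) <= y ^+ 18 / 16.
  have -> : n%:R * (1 - s) = y ^+ 17 * (4 + 2 * k^-1).
    by rewrite /s /X1; field; rewrite Nn0 gt_eqF.
  have -> : y ^+ 18 / 16 = y ^+ 17 * (y / 16) by rewrite exprSr; ring.
  by apply: ler_wpM2l; [exact: ltW|exact: k_small].
have s2 : 2^-1 <= s.
  have h1 : n%:R * (1 - s) / n%:R <= y ^+ 18 / 16 / n%:R by rewrite ler_pM2r ?invr_gt0.
  have h2 := yn 18%N isT.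
  rewrite mulrAC divff// mul1r mulrAC in h1.
  by clear QE Qn Qy small En sg X01 X12 yn17 yn19 x00 X10; lra.
have s0 : 0 < s by apply: lt_le_trans s2; rewrite invr_gt0.
have s1 : 0 <= 1 - s.
  rewrite /s -addrA -opprD subr_ge0 lerBlDr lerDl addr_ge0// mulr_ge0//; first exact: ltW.
  by rewrite divr_ge0// ltW.
have dr := d_le; have rw := yw (isT : (10 < 100)%N).
have ds : d <= 2 * pi * s.
  apply: (le_trans dr); apply: (@le_trans _ _ 1).
    by apply: le_trans rw; rewrite ler_peMl ?yw_ge0// (ler_nat R 1 64).
  rewrite -[leLHS]mulr1 mulrAC; apply: ler_pM => //.
    by rewrite -ler_pdivrMl// mulr1.
  by apply: le_trans (pi_ge2 R); rewrite ler1n.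
have n16 := n2.
have Xl : 48 * x0 <= X1 by apply: le_trans X01; rewrite ler_pM2r// (ler_nat R 48 64).
have Xl2 : X1 <= X2 by apply: le_trans X12; rewrite ler_peMl ?(ler_nat R 1 64)// ltW.
have Xl3 : 4 * X2 <= 1.
  apply: le_trans yn19; rewrite ler_wpM2r ?(ler_nat R 4 64)//.
  by rewrite divr_ge0 ?exprn_ge0// ltW.
have := @outer_bound R n k x0 X1 X2 E Q A d s D n16 k0 x00 Xl Xl2 Xl3 En erefl Qn small
  erefl erefl s0 (ltW d_gt0) ds mD Dpi Dfar.
have -> : n%:R * (X2 - X1) / 16 = (y ^+ 19 - y ^+ 17) / 16 by rewrite /X1 /X2; field.
have -> : n%:R * X1 / 32 = y ^+ 17 / 32 by rewrite /X1; field.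
rewrite -/Z; have s1' : s <= 1 by rewrite -subr_ge0.
have := regime_factor s2 s1' sg; set J := 2 * pi * _ + _ => -[J0 JZn] h; apply: (le_trans h).
have Zl := regime_Z_ge.
clear h Dfar Dpi mD QE QE ynle X01 X12 x00 X10 Qy Qn small En Xl Xl2 Xl3 ds dr rw sg s2 s1 s0 yn yn17 yn19 n16.
have y16 : 17 * y <= y ^+ 16.
  rewrite exprSr; apply: ler_wpM2r; first exact: ltW.
  by apply: (@le_trans _ _ y); [lra|rewrite -[leLHS]expr1 y_mono].
have u2 : 2 * expR (- ((y ^+ 19 - y ^+ 17) / 16)) * J ^+ n <=
    expR (- (2 * y) - 1) * Z ^+ n.
  apply: (@le_trans _ _ (expR 1 * expR (- ((y ^+ 19 - y ^+ 17) / 16)) *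
      (Z ^+ n * expR (y ^+ 18 / 8 + 1)))).
    apply: ler_pM => //; first exact: exprn_ge0.
    by apply: ler_wpM2r; [exact: expR_ge0|have := expR_ge_lin 1; lra].
  rewrite mulrCA mulrC ler_pM2r ?exprn_gt0// -!expRD ler_expR.
  have P17 := P 17%N; have s16 := y_step 16; have s17 := y_step 17.
  have s18 := y_step 18; lra.
(* [E] is superlinear in [n], so it beats [(2 pi)^n] as well as [Z^(-n) <= e^(2 y n)]. *)
have u1 : expR (- E) * (2 * pi) ^+ n <= expR (- (2 * y) - 1) * Z ^+ n.
  apply: (@le_trans _ _ (expR (- E) * expR (7 * n%:R))).
    apply: ler_wpM2l; first exact: expR_ge0.
    rewrite expRM_natr; apply: lerXn2r; rewrite ?nnegrE ?expR_ge0//; first by lra.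
    by have := expR_ge_lin 7; lra.
  apply: (@le_trans _ _ (expR (- (2 * y) - 1) * expR (n%:R * - (2 * y)))).
    rewrite -!expRD ler_expR /E.
    have h1 : 64 * (n%:R * y) <= n%:R * y ^+ 10.
      rewrite mulrCA ler_pM2l//; apply: le_trans (y_mono (isT : 2 <= 10)%N).
      by have := y_step 1; rewrite expr1.
    have h2 : n%:R * 7 <= n%:R * y by rewrite ler_pM2l//; lra.
    have h3 : 1 * y <= n%:R * y by rewrite ler_pM2r//; lra.
    by move: h1 h2 h3; lra.
  apply: ler_wpM2l; first exact: expR_ge0.
  rewrite expRM_natl; apply: lerXn2r; rewrite ?nnegrE ?expR_ge0//; exact: ltW.
apply: (le_trans (lerD u1 u2)).
rewrite -mulrDl; apply: ler_wpM2r; first by rewrite exprn_ge0// ltW.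
rewrite expRD; have : expR (-1) <= 2^-1 :> R.
  by rewrite expRN lef_pV2 ?posrE ?expR_gt0//; have := expR_ge_lin 1; lra.
by have := expR_ge0 (- (2 * y)); nra.
Qed.

Let sqrt_n : Num.sqrt n%:R = w.
Proof. by rewrite nE sqrtr_sqr ger0_norm// ltW. Qed.

Let w_neq0 : w != 0. Proof. by rewrite gt_eqF. Qed.

Let r_pow i : r ^+ i = y ^+ (10 * i) / w ^+ i.
Proof. by rewrite /r expr_div_n -exprM. Qed.

Let err4 : n%:R * Num.sqrt n%:R * r ^+ 4 = y ^+ 40 / w.
Proof. by rewrite sqrt_n nE r_pow; field. Qed.

Let err3 : n%:R * r ^+ 3 = y ^+ 30 / w.
Proof. by rewrite nE r_pow; field. Qed.

Let err5 : n%:R ^+ 2 * r ^+ 5 = y ^+ 50 / w.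
Proof. by rewrite nE r_pow; field. Qed.

Let err4_small : 6 * (n%:R * Num.sqrt n%:R * r ^+ 4) <= 1.
Proof.
rewrite err4; apply: le_trans (yw (isT : (40 < 100)%N)).
by apply: ler_wpM2r; [exact: yw_ge0|rewrite (ler_nat R 6 64)].
Qed.

Let err6_le_err4 : 192 * (n%:R ^+ 2 * r ^+ 6) + 3 * (n%:R * r ^+ 4) <=
  6 * (n%:R * Num.sqrt n%:R * r ^+ 4).
Proof.
have -> : n%:R ^+ 2 * r ^+ 6 = y ^+ 20 / w * (y ^+ 40 / w) by rewrite nE r_pow; field.
have -> : n%:R * r ^+ 4 = y ^+ 40 / w / w by rewrite nE r_pow; field.
have q40 : 0 <= y ^+ 40 / w by exact: yw_ge0.
rewrite err4; have h1 : 64 * (y ^+ 20 / w) * (y ^+ 40 / w) <= 1 * (y ^+ 40 / w).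
  by apply: ler_wpM2r => //; exact: yw.
have h2 : y ^+ 40 / w / w <= y ^+ 40 / w.
  by rewrite ler_pdivrMr// ler_peMr//; have := w_ge; have := y_ge; lra.
by move: h1 h2; lra.
Qed.

Let window_small : y * r + 2 * (n%:R * r ^+ 3) <= 1.
Proof.
have -> : y * r = y ^+ 11 / w by rewrite /r exprS; ring.
have h1 := yw (isT : (11 < 100)%N); have h2 := yw (isT : (30 < 100)%N).
by rewrite err3; lra.
Qed.

(** Frequencies are cut at [L = y], where the truncation error is of order [e^(-y^2/2)]. The main
    term [B0 / (4 y)] is split in halves: one covers the errors, the other exceeds
    [(n + 1) e^(-2 y)]. *)
Lemma regime_lower : (n%:R + 1) * expR (- (2 * y)) * Z ^+ n <=
  tbint d (fun t : Rn n => expR (- modsum k t) * cos (phasesum lam t)).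
Proof.
have N0 : 0 < n%:R :> R by have := n_big; lra.
have yb := y_ge; have y0 := y_gt0; have w0 := w_gt0; have wy := w_ge.
have kT := kV; have hyT := hy; have e0 := ell_ge0; have T0 := T_gt0.
have k0 : 0 < k^-1 by rewrite invr_gt0; exact: k_gt0.
have La0 : 0 < 4 + k^-1 by lra.
have Lay : 4 + k^-1 + 1 <= y by lra.
have m1 : 1 <= y by lra.
have m3 : (25 : R) <= n%:R by have := n_big; lra.
have m4 : (4 + k^-1 + 1) ^+ 2 <= n%:R.
  apply: le_trans w_le_n; apply: le_trans hyw; apply: (@le_trans _ _ (y ^+ 2)).
    apply: lerXn2r; rewrite ?nnegrE//; last exact: ltW.
    by rewrite addr_ge0// ltW.
  exact: y_mono.
pose La := 4 + k^-1.
have yE : La / 3 + 5 <= y by rewrite /La; lra.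
pose B0 := expR (- (La / 3 + 5)) / La.
have m5 : 2 * (n%:R * r) * gauss 2^-1 y <= B0 / 2.
  have -> : 2 * (n%:R * r) = 2 * (w * y ^+ 10) by rewrite nE /r; field.
  rewrite /B0 [leRHS]mulrAC ler_pdivlMr//.
  have h2 : 2 * (w * y ^+ 10) * gauss 2^-1 y * La <= 2 * expR y * gauss 2^-1 y.
    rewrite mulrAC; apply: ler_wpM2r; first exact: gauss_ge0.
    rewrite -mulrA ler_pM2l//; apply: le_trans N_exp.
    rewrite -mulrA nE expr2 ler_pM2l//; apply: (@le_trans _ _ (y ^+ 11)).
      rewrite [leRHS]exprSr; apply: ler_wpM2l; first exact: exprn_ge0 (ltW y0).
      by rewrite /La; lra.
    by apply: le_trans hyw; exact: y_mono.
  apply: (le_trans h2).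
  have h3 : 4 <= expR y by have := expR_ge_lin y; lra.
  have h4 : expR y * gauss 2^-1 y * expR y <= expR (- (La / 3 + 5)).
    rewrite /gauss -!expRD ler_expR.
    have : 64 * y <= y * y by rewrite ler_pM2r.
    by rewrite -expr2; lra.
  have h5 : 4 * (expR y * gauss 2^-1 y) <= expR y * gauss 2^-1 y * expR y.
    by rewrite mulrC ler_wpM2l// mulr_ge0 ?expR_ge0 ?gauss_ge0.
  by move: h4 h5; lra.
have B00 : 0 < B0 by rewrite /B0 divr_gt0// expR_gt0.
have m6 : 2 * (n%:R * r) * gauss 2^-1 y <= B0.
  by apply: (le_trans m5); rewrite ler_pdivrMr// ler_peMr ?ler1n// ltW.
have Z0 : 0 < Z by apply: lt_le_trans regime_Z_ge; exact: expR_gt0.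
have Zn : 0 < Z ^+ n by rewrite exprn_gt0.
have := main_lower n3 lam_gt0 d_gt0 r_gt0 erefl d2 kd2 erefl erefl erefl m1 window_small m3 m4 Lay m6.
have := central_lower n3 lam_gt0 d_gt0 r_gt0 erefl d2 kd2 erefl erefl erefl erefl err4_small err6_le_err4.
rewrite -/k -/A -/Z -/La -/B0 err4 err3 err5.
clear m1 m3 m4 m6.
set q := (k + 6 * k ^+ 2) / 24 * _; set M := tbint d _; set TT := tbint d _.
set err := 2304 * _ + _ + _ => hT hM; apply: le_trans hT.
have q0 : 1 <= expR q.
  rewrite -expR0 ler_expR /q; apply: mulr_ge0.
    have h1 := ltW k_gt0; have h2 := sqr_ge0 k.
    by apply: divr_ge0 => //; apply: addr_ge0 => //; exact: mulr_ge0.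
  have int_ge0 i : ~~ odd i -> 0 <= int1 d (fun x : R => x ^+ i * gauss A x).
    move=> oi; apply: Rintegral_ge0 => // x _.
    by apply: mulr_ge0; [exact: exprn_even_ge0|exact: gauss_ge0].
  have n20 : 0 <= n%:R ^+ 2 :> R by exact: sqr_ge0.
  apply: addr_ge0; apply: mulr_ge0.
  - exact: n20.
  - by apply: divr_ge0; [exact: int_ge0|exact: ltW].
  - by apply: mulr_ge0 => //; exact: n20.
  - exact: sqr_ge0.
clearbody q.
have hM' : B0 / (4 * y) * Z ^+ n <= M.
  apply: le_trans hM; apply: ler_wpM2r; first exact: ltW.
  rewrite ler_pdivlMr; last by rewrite mulr_gt0.
  have -> : B0 / (4 * y) * (2 * y) = B0 / 2 by field; rewrite gt_eqF.
  by rewrite lerBrDr [leRHS]splitr lerD2l.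
have herr : err <= 3 * (y ^+ 52 / w).
  (* As [y >= 64], a constant up to [64^2] costs two powers of [y], from [y^50] to [y^52]. *)
  have num : (2304 : R) <= 64 * 64 by rewrite -natrM ler_nat.
  have s50 i : (i <= 50)%N -> y ^+ i / w <= y ^+ 50 / w.
    by move=> hi; apply: ler_wpM2r; [rewrite invr_ge0 ltW|exact: y_mono].
  have g (c : R) i : 0 <= c -> c <= 64 * 64 -> (i <= 50)%N -> c * (y ^+ i / w) <= y ^+ 52 / w.
    move=> c0 cc hi; apply: (@le_trans _ _ (64 * 64 * (y ^+ 50 / w))).
      by apply: ler_pM => //; exact: s50.
    have -> : 64 * 64 * (y ^+ 50 / w) = 64 * (64 * y ^+ 50) / w by ring.
    apply: ler_wpM2r; first by rewrite invr_ge0 ltW.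
    have h64 : 0 <= 64 :> R by rewrite ler0n.
    exact: le_trans (ler_wpM2l h64 (y_step 50)) (y_step 51).
  have n1 : 0 <= 2304 :> R by rewrite ler0n.
  have g1 := g 2304 40%N n1 num isT.
  have g2 := g 192 50%N (ler0n _ _) _ isT; have g3 := g 130 30%N (ler0n _ _) _ isT.
  have : (192 : R) <= 64 * 64 by rewrite -natrM ler_nat.
  have : (130 : R) <= 64 * 64 by rewrite -natrM ler_nat.
  move=> /g3 g3' /g2 g2'; have -> : 3 * (y ^+ 52 / w) = y ^+ 52 / w + y ^+ 52 / w + y ^+ 52 / w by ring.
  exact: lerD (lerD g1 g2') g3'.
clearbody err M TT; clear hM m5.
(* [La <= 4 + T] gives [La / 3 + 5 <= T / 3 + 7]. Two powers of [y] for [La * y], three for [e^7],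
   and the rest for constants raise [y^52] to the [y^60] of [hTw]. *)
have hB : 3 * (y ^+ 52 / w) <= B0 / (8 * y).
  rewrite /B0 -mulrA -invfM ler_pdivlMr; last by rewrite !mulr_gt0.
  have La_y : La <= y by rewrite /La; lra.
  have h1 : expR (- (T / 3 + 7)) <= expR (- (La / 3 + 5)).
    by rewrite ler_expR /La; lra.
  apply: le_trans h1; rewrite expRN -[leRHS]div1r ler_pdivlMr ?expR_gt0// expRD.
  have h7 : expR 7 <= y ^+ 3 :> R.
    have -> : 7 = 7%:R * 1 :> R by rewrite mulr1.
    rewrite expRM_natl; apply: (@le_trans _ _ (4 ^+ 7)).
      by apply: lerXn2r; rewrite ?nnegrE ?expR_ge0//; exact: expR1_le4.
    have -> : 4 ^+ 7 = 64 * 64 * 4 :> R by ring.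
    rewrite !exprS expr0 mulr1 mulrA; apply: ler_pM => //; first by apply: ler_pM.
    by apply: le_trans yb; rewrite (ler_nat R 4 64).
  have h8 : 24 * y ^+ 57 <= y ^+ 60.
    apply: le_trans (y_mono (isT : 58 <= 60)%N); apply: le_trans (y_step 57).
    by rewrite ler_pM2r ?exprn_gt0// (ler_nat R 24 64).
  have h9 : 3 * y ^+ 52 * (La * (8 * y)) * expR 7 <= 24 * y ^+ 57.
    have -> : 3 * y ^+ 52 * (La * (8 * y)) * expR 7 = 24 * y ^+ 53 * (La * expR 7) by ring.
    have -> : 24 * y ^+ 57 = 24 * y ^+ 53 * (y * y ^+ 3) by ring.
    apply: ler_wpM2l; first by rewrite mulr_ge0// exprn_ge0// ltW.
    by apply: ler_pM; rewrite ?expR_ge0// ltW.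
  have -> : 3 * (y ^+ 52 / w) * (La * (8 * y)) * (expR (T / 3) * expR 7) =
     3 * y ^+ 52 * (La * (8 * y)) * expR 7 * expR (T / 3) / w by ring.
  rewrite ler_pdivrMr// mul1r; apply: le_trans hTw.
  rewrite mulrC; apply: ler_wpM2l; first exact: expR_ge0.
  exact: le_trans h9 h8.
have hN : (n%:R + 1) * expR (- (2 * y)) <= B0 / (8 * y).
  apply: le_trans hB.
  have h1 : (n%:R + 1) * w <= n%:R * n%:R.
    have h2 : 64 * w <= n%:R by rewrite nE expr2 ler_pM2r//; lra.
    have h3 : (n%:R + 1) * (64 * w) <= (n%:R + 1) * n%:R by rewrite ler_pM2l//; lra.
    have h4 : 1 * n%:R <= n%:R * n%:R :> R by rewrite ler_pM2r//; have := n_big; lra.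
    by move: h3 h4; lra.
  have h2 : n%:R * n%:R <= expR (2 * y).
    have -> : 2 * y = y + y by ring.
    by rewrite expRD; apply: ler_pM; rewrite ?N_exp// ltW.
  have h3 : 1 <= y ^+ 52 by apply: exprn_ege1; lra.
  rewrite expRN ler_pdivrMr ?expR_gt0// mulrAC mulrA ler_pdivlMr//.
  apply: (le_trans h1); apply: (le_trans h2).
  by rewrite mulrAC ler_peMl ?expR_ge0//; lra.
have h : err * Z ^+ n <= B0 / (8 * y) * Z ^+ n.
  by rewrite ler_pM2r//; exact: le_trans hB.
have h' : (n%:R + 1) * expR (- (2 * y)) * Z ^+ n <= B0 / (8 * y) * Z ^+ n.
  by rewrite ler_pM2r.
have e : B0 / (4 * y) * Z ^+ n = B0 / (8 * y) * Z ^+ n + B0 / (8 * y) * Z ^+ n.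
  by field; rewrite gt_eqF.
rewrite e in hM'; have D : (n%:R + 1) * expR (- (2 * y)) * Z ^+ n <= M - err * Z ^+ n.
  rewrite lerBrDr; apply: le_trans hM'; exact: lerD h' h.
apply: (le_trans D); rewrite ler_peMl//; apply: le_trans D.
by rewrite !mulr_ge0 ?expR_ge0 ?addr_ge0// ltW.
Qed.

(** The central box contributes at least [n + 1] times the bound on the outer integral, and the rest
    of [boxT] removes at most one such multiple; [n] of them remain. *)
Lemma regime_conclusion (eps : R) (l : nat) :
  scale R eps n = r -> density R n l = lam ->
  \int[lebesgue_tuple R n]_(t in boxc R eps n l)
     ComplexField.Normc.normc (integrand R n l t) <=
  n%:R^-1 * ComplexField.Normc.normc
     (cintegral (lebesgue_tuple R n) (boxT R eps n l) (integrand R n l)).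
Proof.
move=> sE lE.
have N0 : 0 < n%:R :> R by have := n_big; lra.
have n1 : (1 < n)%N := ltnW n3.
have dE : scale R eps n / (1 + density R n l) = d by rewrite sE lE.
have dpi : 4 * (scale R eps n / (1 + density R n l)) < pi.
  rewrite dE; apply: (@lt_le_trans _ _ 2); last exact: pi_ge2.
  have rw := yw (isT : (10 < 100)%N); rewrite -/r in rw.
  by have dr := d_le; lra.
have mc := measurable_boxc n3 dpi.
have cpi := boxc_cube n3 dpi.
have far t v : boxc R eps n l t -> is_pole v ->
    exists b, y ^+ 19 / n%:R < k * vers (tnth t b + v).
  apply: (boxc_far n3 dpi k_gt0); rewrite dE; apply: le_trans kd2_ge.
  apply: ler_wpM2r; first by rewrite divr_ge0 ?exprn_ge0// ltW.
  by rewrite (ler_nat R 16 64).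
have U := regime_upper mc cpi far.
have L := regime_lower.
have := Re_cintegral_boxT n3 dpi; rewrite dE lE -/k => C.
have -> : \int[lebesgue_tuple R n]_(t in boxc R eps n l)
     ComplexField.Normc.normc (integrand R n l t) =
   \int[lebesgue_tuple R n]_(t in boxc R eps n l) expR (- modsum k t).
  by apply: eq_Rintegral => t _; rewrite normc_integrand// lE.
have Re_le (z : R[i]) : complex.Re z <= ComplexField.Normc.normc z.
  case: z => u v /=; apply: le_trans (ler_norm u) _.
  by rewrite -sqrtr_sqr ler_wsqrtr// lerDl sqr_ge0.
rewrite ler_pdivlMl//; apply: le_trans (Re_le _); apply: le_trans C.
move: U L; set e := expR (- (2 * y)) * Z ^+ n; set I := Rintegral _ _ _.
set TT := tbint d _; rewrite -mulrA -/e mulrDl mul1r => U L.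
have := ler_wpM2l (ltW N0) U; lra.
Qed.

End regime.

(** * Choice of the parameters and passage to large [n] *)

Lemma expR_dominates_linear (R : realType) (c K : R) : 0 < c -> 0 <= K ->
  exists M, 1 <= M /\ forall x, M <= x -> K * (1 + x) <= expR (c * x).
Proof.
move=> c0 K0; have c2 : 0 < c ^+ 2 by rewrite exprn_gt0.
have q0 : 0 <= 8 * K / c ^+ 2 by rewrite divr_ge0 ?mulr_ge0// ltW.
exists (1 + 8 * K / c ^+ 2); split; first by rewrite lerDl.
move=> x xM; have x1 : 1 <= x by apply: le_trans xM; rewrite lerDl.
have x0 : 0 < x by lra.
have h1 : 8 * K <= c ^+ 2 * x.
  rewrite -ler_pdivrMl// mulrC; apply: le_trans xM; lra.
have h2 : 8 * K * x <= c ^+ 2 * x * x by rewrite ler_pM2r.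
have h5 : 0 <= c * x by rewrite mulr_ge0// ltW.
have h3 : (1 + c * x / 2) ^+ 2 <= expR (c * x).
  have -> : expR (c * x) = expR (c * x / 2) ^+ 2.
    by rewrite -expRM_natl; congr expR; field.
  apply: lerXn2r; rewrite ?nnegrE ?expR_ge0//; first lra.
  exact: expR_ge1Dx.
have h4 : K * x >= K by rewrite ler_peMr.
apply: le_trans h3; nra.
Qed.

Theorem theorem4p3 (R : realType) (a b : R) (a_gt0 : 0 < a) (b_gt0 : 0 < b)
    (ab : a + b < 2^-1) :
  exists eps0 : R, 0 < eps0 /\
  forall (eps : R), 0 < eps -> eps < eps0 ->
  forall (l : nat -> nat),
    (\forall n \near \oo, ~~ odd (l n * n)) ->
    (\forall n \near \oo, (3 * a * ln (n%:R : R))^-1 <= density R n (l n)) ->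
    (exists u : nat -> R, u =O_\oo (fun _ => 1 : R) /\
       \forall n \near \oo, density R n (l n) = n%:R `^ u n) ->
  (fun n => \int[lebesgue_tuple R n]_(t in boxc R eps n (l n))
     ComplexField.Normc.normc (integrand R n (l n) t))
  =O_\oo
  (fun n => n%:R^-1 * ComplexField.Normc.normc
     (cintegral (lebesgue_tuple R n) (boxT R eps n (l n)) (integrand R n (l n)))).
Proof.
(* The regime needs [y^60 = n^(6 eps)] below [n^(1/2 - a)] and [y^100 = n^(10 eps)] below [n^(1/2)];
   20 leaves room for both. *)
exists ((2^-1 - a) / 20); split; first by apply: divr_gt0 => //; lra.
move=> eps eps_gt0 eps_lt l _ dens_ge [u [/eqO_exP[C /= C_gt0 uC] densE]].
have normc0 (z : R[i]) : 0 <= ComplexField.Normc.normc z.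
  by case: z => v v' /=; exact: sqrtr_ge0.
(* One constant for two demands on [y = n^(eps/10)]: it must exceed [64 (1 + ln n + 3 a ln n)], and
   also [C ln n], so that [lam <= n^C <= e^y]. *)
have K0 : 0 <= 64 * (1 + 3 * a) + C by rewrite addr_ge0 ?mulr_ge0//; lra.
have e10 : 0 < eps / 10 by rewrite divr_gt0.
have [M [M1 hM]] := expR_dominates_linear e10 K0.
apply/eqO_exP; exists 1 => //=.
near=> n.
rewrite mul1r ger0_norm; last first.
  by apply: Rintegral_ge0 => // t _; exact: normc0.
rewrite ger0_norm; last first.
  by rewrite mulr_ge0 ?invr_ge0//; exact: normc0.
have hdens : (3 * a * ln (n%:R : R))^-1 <= density R n (l n) by near: n; exact: dens_ge.
have hu : `|u n| <= C * `|1 : R| by near: n; exact: uC.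
have hdE : density R n (l n) = n%:R `^ u n by near: n; exact: densE.
pose ell := ln (n%:R : R); rewrite -/ell in hdens.
have nM : expR M <= n%:R :> R by near: n; exact: nbhs_infty_ger.
have N0 : 0 < n%:R :> R by apply: lt_le_trans nM; exact: expR_gt0.
have nE : n%:R = expR ell :> R by rewrite /ell lnK// posrE.
have ellM : M <= ell by rewrite -ler_expR -nE.
have ell0 : 0 < ell by lra.
have aell : 0 < 3 * a * ell by rewrite !mulr_gt0.
have dens0 : 0 < density R n (l n) by apply: lt_le_trans hdens; rewrite invr_gt0.
rewrite normr1 mulr1 in hu.
have big := hM _ ellM.
set y := expR (eps / 10 * ell) in big.
have aell' := ltW aell.
have Cell : 0 <= C * ell by rewrite mulr_ge0// ltW.
have powE i : y ^+ i = expR (i%:R * (eps / 10 * ell)) by rewrite expRM_natl.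
apply: (@regime_conclusion R n y (expR (ell / 2)) ell (3 * a * ell) (density R n (l n))) => //.
- by rewrite nE -expRM_natl; congr expR; field.
- by rewrite -expRM_natl; congr expR; field.
- exact: expR_gt0.
- exact: ltW.
- by move: big; lra.
- have := ler_wpM2r (ltW ell0) (_ : 100 * (eps / 10) <= 2^-1).
  by rewrite powE ler_expR => h; have := h ltac:(lra); lra.
- have := ler_wpM2r (ltW ell0) (_ : 60 * (eps / 10) <= 2^-1 - a).
  by rewrite powE -expRD ler_expR => h; have := h ltac:(lra); lra.
- by rewrite -[leRHS]invrK lef_pV2 ?posrE ?invr_gt0.
- rewrite hdE /powR gt_eqF// ler_expR -/ell.
  have : u n * ell <= C * ell.
    by rewrite ler_pM2r//; apply: le_trans hu; exact: ler_norm.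
  move: big; rewrite -/y; lra.
- rewrite /scale /powR gt_eqF// -/ell powE -expRN -expRD; congr expR; field.
Unshelve. all: by end_near.
Qed.
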